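(* Let $Q$ be a quasilattice in $\mathbb{R}^n$ and let $\Delta\subset(\mathbb{R}^n)^*$ be an $n$-dimensional simple pointed polyhedron with $d$ facets that is quasirational with respect to $Q$; write $\Delta=\bigcap_{j=1}^d\{\mu\in(\mathbb{R}^n)^*\mid\langle\mu,X_j\rangle\ge\lambda_j\}$ with $X_1,\dots,X_d\in Q$ and $\lambda_1,\dots,\lambda_d\in\mathbb{R}$. Let $M$ be the symplectic toric quasifold associated to $(\Delta,Q,\{X_1,\dots,X_d\})$, with its action of the quasitorus $D^n=\mathbb{R}^n/Q$ and its moment mapping $\Phi\colon M\to(\mathbb{R}^n)^*$. Let $Y\in Q$, $Y\neq 0$, and $\varepsilon\in\mathbb{R}$ be such that $$\Delta_{\varepsilon^+}=\Delta\cap\{\mu\in(\mathbb{R}^n)^*\mid\langle\mu,Y\rangle\ge\varepsilon\}\quad\text{and}\quad\Delta_{\varepsilon^-}=\Delta\cap\{\mu\in(\mathbb{R}^n)^*\mid\langle\mu,Y\rangle\le\varepsilon\}$$ are both $n$-dimensional simple pointed polyhedra. Let $\overline{M}_{\Phi_Y\ge\varepsilon}$ and $\overline{M}_{\Phi_Y\le\varepsilon}$ be the two symplectic cut spaces of $M$ determined by $Y$ and $\varepsilon$, with their induced $D^n$-actions. Let $M_{\varepsilon^+}$ be the symplectic toric quasifold associated to $\Delta_{\varepsilon^+}$, the quasilattice $Q$, and the normal vectors consisting of $Y$ together with those $X_j$ for which $\{\mu\in \Delta_{\varepsilon^+}\mid\langle\mu,X_j\rangle=\lambda_j\}$ is a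 facet of $\Delta_{\varepsilon^+}$; let $M_{\varepsilon^-}$ be the symplectic toric quasifold associated to $\Delta_{\varepsilon^-}$, the quasilattice $Q$, and the normal vectors consisting of $-Y$ together with those $X_j$ for which $\{\mu\in \Delta_{\varepsilon^-}\mid\langle\mu,X_j\rangle=\lambda_j\}$ is a facet of $\Delta_{\varepsilon^-}$. Then there exist $D^n$-equivariant homeomorphisms $$f_+\colon M_{\varepsilon^+}\to\overline{M}_{\Phi_Y\ge\varepsilon},\qquad f_-\colon M_{\varepsilon^-}\to\overline{M}_{\Phi_Y\le\varepsilon}.$$ Moreover, $\overline{M}_{\Phi_Y\ge\varepsilon}$ and $\overline{M}_{\Phi_Y\le\varepsilon}$ naturally inherit (by transport of structure along $f_+$ and $f_-$) symplectic toric quasifold structures from $M_{\varepsilon^+}$ and $M_{\varepsilon^-}$ respectively.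
   Context: All quotients carry the quotient topology, products the product topology, subsets the subspace topology. **Polyhedra and quasilattices.** A polyhedron in $(\mathbb{R}^n)^*$ is a finite intersection of closed half-spaces; it is pointed if it has at least one vertex. An $n$-dimensional pointed polyhedron is simple if each vertex lies in exactly $n$ facets. A quasilattice $Q$ in $\mathbb{R}^n$ is the $\mathbb{Z}$-span of a finite set of vectors that span $\mathbb{R}^n$ over $\mathbb{R}$. The group $D^n=\mathbb{R}^n/Q$ is called a quasitorus, and $\exp_{D^n}\colon\mathbb{R}^n\to D^n$ denotes the projection. An $n$-dimensional polyhedron $\Delta$ with $d$ facets is quasirational with respect to $Q$ if $\Delta=\bigcap_{j=1}^d\{\mu\mid\langle\mu,X_j\rangle\ge\lambda_j\}$ for some $X_1,\dots,X_d\in Q$, $\lambda_j\in\mathbb{R}$ (one inward-pointing normal vector $X_j$ for each facet). **Symplectic toric quasifold associated to $(\Delta,Q,\{X_1,\dots,X_d\})$ (generalized Delzant procedure).** Here $\Delta$ is an $n$-dimensional simple pointed polyhedron with exactly $d$ facets, quasirational with respect to $Q$, written as $\Delta=\bigcap_{j=1}^d\{\mu\in(\mathbb{R}^n)^*\mid\langle\mu,X_j\rangle\ge\lambda_j\}$ with $X_1,\dots,X_d\in Q$ and $\lambda_1,\dots,\lambda_d\in\mathbb{R}$ (one inward-pointing normal vector $X_j$ for each facet). Let $\pi\colon\mathbb{R}^d\to\mathbb{R}^n$ be the (surjective) linear map $e_j\mapsto X_j$, let $T^d=\mathbb{R}^d/\mathbb{Z}^d$ act on $\mathbb{C}^d$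 by $\exp_{T^d}(x)\cdot z=(e^{2\pi i x_1}z_1,\dots,e^{2\pi i x_d}z_d)$, let $\Pi\colon T^d\to D^n$ be the epimorphism induced by $\pi$, and let $N=\ker\Pi=\{\exp_{T^d}(x)\mid \pi(x)\in Q\}$. Put $J(z)=\sum_j(|z_j|^2+\lambda_j)e_j^*\in(\mathbb{R}^d)^*$, and $\Psi=i^*\circ J$, where $i\colon\ker\pi\to\mathbb{R}^d$ is the inclusion. Then $\Psi^{-1}(0)$ is the set of $z$ for which there is a (unique) $\xi\in(\mathbb{R}^n)^*$ with $\langle\xi,X_j\rangle=|z_j|^2+\lambda_j$ for all $j$. Set $M=\Psi^{-1}(0)/N$, with points $[z]=[z_1:\dots:z_d]$. The quasitorus $D^n\simeq T^d/N$ acts on $M$ by $\exp_{D^n}(\pi(x))\cdot[z]=[\exp_{T^d}(x)\cdot z]$, and the moment mapping $\Phi\colon M\to(\mathbb{R}^n)^*$ is given by $\Phi([z])=\xi$, the unique element with $\langle\xi,X_j\rangle=|z_j|^2+\lambda_j$ for all $j$; its image is $\Delta$. **Quasifold structure.** A quasifold model is a quotient $\tilde U/\Gamma$ of a connected manifold $\tilde U$ by a countable discrete group $\Gamma$ acting by diffeomorphisms, freely on a connected dense subset. A quasifold atlas on a topological space is an open cover by sets $U_\alpha$ with homeomorphisms $\tilde U_\alpha/\Gamma_\alpha\to U_\alpha$ from models such that on overlaps the changes of charts lift to diffeomorphisms between the universal covers of the corresponding open subsets of $\tilde U_\alpha$ and $\tilde U_\beta$; a symplectic form is a family of $\Gamma_\alpha$-invariant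 symplectic forms on the $\tilde U_\alpha$ that correspond under these lifts. The space $M=\Psi^{-1}(0)/N$ associated to $(\Delta,Q,\{X_1,\dots,X_d\})$ is a symplectic quasifold with atlas indexed by the vertices $\mu$ of $\Delta$: let $I_\mu\subset\{1,\dots,d\}$ be the set of the $n$ indices of facets containing $\mu$; for $v=(v_i)_{i\in I_\mu}\in\mathbb{C}^{I_\mu}$ let $\xi_v\in(\mathbb{R}^n)^*$ be the unique element with $\langle\xi_v,X_i\rangle=|v_i|^2+\lambda_i$ ($i\in I_\mu$); let $\tilde U_\mu=\{v\in\mathbb{C}^{I_\mu}\mid\langle\xi_v,X_j\rangle>\lambda_j\ \forall j\notin I_\mu\}$; let $\Gamma_\mu=\{(e^{2\pi i x_i})_{i\in I_\mu}\mid\sum_{i\in I_\mu}x_iX_i\in Q\}$ act diagonally; the chart sends $[v]$ to $[u(v)]$, where $u_i(v)=v_i$ for $i\in I_\mu$ and $u_j(v)=\sqrt{\langle\xi_v,X_j\rangle-\lambda_j}$ for $j\notin I_\mu$; its image is $U_\mu=\{[z]\in M\mid z_j\ne0\ \forall j\notin I_\mu\}$. The symplectic form, induced from $\frac{1}{2\pi i}\sum_{j=1}^d dz_j\wedge d\bar z_j$ on $\mathbb{C}^d$, is represented on $\tilde U_\mu$ by $\frac{1}{2\pi i}\sum_{i\in I_\mu}dv_i\wedge d\bar v_i$. A symplectic toric quasifold is such a space $M$ with this structure and its effective Hamiltonian $D^n$-action. **Symplectic cutting.** Let $\Phi_Y=\langle\Phi,Y\rangle\colon M\to\mathbb{R}$.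 Let $D^1=\{\exp_{D^n}(tY)\mid t\in\mathbb{R}\}\subset D^n$; with $Q^1=\{l\in\mathbb{R}\mid lY\in Q\}\supset\mathbb{Z}$ one has $D^1\simeq\mathbb{R}/Q^1$, and $\exp_{D^1}(t)$ denotes the class of $t$, corresponding to $\exp_{D^n}(tY)$. Let $\Lambda=\{e^{2\pi i t}\mid tY\in Q\}\subset S^1$, acting on $\mathbb{C}$ by multiplication. For each choice of sign, $D^1$ acts on $M\times(\mathbb{C}/\Lambda)$ by $$\exp_{D^1}(t)\cdot(m,[w])=\big(\exp_{D^n}(tY)\cdot m,\,[e^{\mp2\pi i t}w]\big),$$ with moment map $\nu_\mp(m,[w])=\Phi_Y(m)\mp|w|^2$. The cut spaces are $$\overline{M}_{\Phi_Y\ge\varepsilon}=\nu_-^{-1}(\varepsilon)/D^1,\qquad\overline{M}_{\Phi_Y\le\varepsilon}=\nu_+^{-1}(\varepsilon)/D^1,$$ where the action with $e^{-2\pi it}$ is used for $\nu_-$ and the one with $e^{+2\pi it}$ for $\nu_+$. The action of $D^n$ on the factor $M$ commutes with the $D^1$-action and induces the $D^n$-actions on the cut spaces. *)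

(* Defs.v *)
From HB Require Import structures.
From mathcomp Require Import all_boot all_order all_algebra complex.
From mathcomp Require Import generic_quotient.
From mathcomp Require Import all_classical all_reals all_analysis ring.
Import numFieldNormedType.Exports.

Set Implicit Arguments.
Unset Strict Implicit.
Unset Printing Implicit Defensive.

Import Order.TTheory GRing.Theory Num.Theory.

Local Open Scope classical_set_scope.
Local Open Scope card_scope.
Local Open Scope ring_scope.
Local Open Scope complex_scope.
Local Open Scope quotient_scope.

(* Topological quotients. The quotient is by the equivalence relation generated
   by r; every r used below is the orbit relation of a group action, hence is
   already an equivalence relation. *)
Section Quotients.
Variables (T : topologicalType) (r : T -> T -> Prop).

Definition eqv_gen (x y : T) : Prop :=
  forall e : T -> T -> Prop,
    (forall a, e a a) -> (forall a b, e a b -> e b a) ->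
    (forall a b c, e a b -> e b c -> e a c) ->
    (forall a b, r a b -> e a b) -> e x y.

Definition eqv_genb : rel T := fun x y => `[< eqv_gen x y >].

Lemma eqv_genb_equiv : equiv_class_of eqv_genb.
Proof.
split=> [x|x y|y x z].
- by apply/asboolP=> e r0.
- apply/asboolP/asboolP => h e e1 e2 e3 e4; apply: (e2);
    exact: (h e e1 e2 e3 e4).
- move=> /asboolP h1 /asboolP h2; apply/asboolP=> e e1 e2 e3 e4.
  by apply: (e3) (h1 _ e1 e2 e3 e4) (h2 _ e1 e2 e3 e4).
Qed.

Canonical eqv_gen_equiv := EquivRelPack eqv_genb_equiv.

Definition quot_space : topologicalType :=
  quotient_topology {eq_quot eqv_gen_equiv}.

Definition cls (x : T) : quot_space := \pi_(quot_space) x.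
Definition rep (q : quot_space) : T := repr q.

Lemma rep_cls (x : T) : eqv_gen x (rep (cls x)).
Proof.
apply/asboolP.
have /eqquotP : (x = repr (cls x) %[mod {eq_quot eqv_gen_equiv}]).
  by rewrite /cls reprK.
by [].
Qed.

End Quotients.

Section Polyhedra.
Variables (R : realType) (n : nat).

(* R^n is 'rV[R]_n and its dual is 'cV[R]_n. *)
Definition pairing (mu : 'cV[R]_n) (X : 'rV[R]_n) : R := (X *m mu) 0 0.

Definition polyhedron (P : set 'cV[R]_n) :=
  exists (k : nat) (A : 'I_k -> 'rV[R]_n) (b : 'I_k -> R),
    (forall i, A i != 0) /\ P = [set mu | forall i, b i <= pairing mu (A i)].

(* S has affine dimension k. *)
Definition has_dim (S : set 'cV[R]_n) (k : nat) :=
  let dirs l s0 (s : 'I_l -> 'cV[R]_n) := \matrix_(i < l) (s i - s0)^T in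
  (exists s0 (s : 'I_k -> 'cV[R]_n),
     [/\ S s0, forall i, S (s i) & \rank (dirs k s0 s) = k]) /\
  (forall l s0 (s : 'I_l -> 'cV[R]_n),
     S s0 -> (forall i, S (s i)) -> (\rank (dirs l s0 s) <= k)%N).

Definition face (P F : set 'cV[R]_n) :=
  F !=set0 /\
  exists (A : 'rV[R]_n) (b : R),
    P `<=` [set mu | b <= pairing mu A] /\
    F = P `&` [set mu | pairing mu A = b].

Definition facet (P F : set 'cV[R]_n) :=
  face P F /\ exists2 k, n = k.+1 & has_dim F k.

Definition vertex (P : set 'cV[R]_n) (mu : 'cV[R]_n) := face P [set mu].

Definition simple_pointed (P : set 'cV[R]_n) :=
  [/\ polyhedron P, has_dim P n, exists mu, vertex P mu &
      forall mu, vertex P mu -> [set F | facet P F /\ F mu] #= `I_n].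

Definition halfspaces (J : Type) (X : J -> 'rV[R]_n) (lam : J -> R) :
    set 'cV[R]_n :=
  [set mu | forall j, lam j <= pairing mu (X j)].

(* P is quasirational with respect to Q, as witnessed by the X_j: P is cut out
   by the corresponding half-spaces, exactly one for each facet of P. *)
Definition quasirational (Q : set 'rV[R]_n) (P : set 'cV[R]_n)
    (J : Type) (X : J -> 'rV[R]_n) (lam : J -> R) :=
  [/\ P = halfspaces X lam, forall j, Q (X j) &
      set_bij setT (facet P)
        (fun j => P `&` [set mu | pairing mu (X j) = lam j])].

Definition quasilattice (Q : set 'rV[R]_n) :=
  exists (k : nat) (B : 'M[R]_(k, n)),
    row_full B /\ Q = [set map_mx intr c *m B | c in [set: 'rV[int]_k]].

Definition quasitorus (Q : set 'rV[R]_n) : topologicalType :=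
  quot_space (fun y y' : 'rV[R]_n => Q (y' - y)).

Definition expD (Q : set 'rV[R]_n) (y : 'rV[R]_n) : quasitorus Q := cls _ y.

End Polyhedra.

Section Complex.
Variable R : realType.

(* R[i]^o is R[i] with its norm topology. *)
Definition expi (x : R) : R[i]^o := cos (2 * pi * x) +i* sin (2 * pi * x).

Definition sqmod (z : R[i]^o) : R := complex.Re z ^+ 2 + complex.Im z ^+ 2.

Lemma sqmod_expi (x : R) (z : R[i]^o) : sqmod (expi x * z) = sqmod z.
Proof.
case: z => a b; rewrite /sqmod /expi /=.
set c := cos _; set s := sin _.
have cs : c ^+ 2 + s ^+ 2 = 1 by rewrite /c /s cos2Dsin2.
transitivity ((c ^+ 2 + s ^+ 2) * (a ^+ 2 + b ^+ 2)); last by rewrite cs mul1r.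
by ring.
Qed.

End Complex.

Section Toric.
Variables (R : realType) (n : nat) (Q : set 'rV[R]_n).
Variables (J : finType) (X : J -> 'rV[R]_n) (lam : J -> R).

Definition CJ : topologicalType := prod_topology (fun _ : J => R[i]^o).

(* The linear map pi : R^J -> R^n, e_j |-> X_j. *)
Definition piX (x : J -> R) : 'rV[R]_n := \sum_j x j *: X j.

Definition rotJ (x : J -> R) (z : CJ) : CJ := fun j => expi (x j) * z j.

(* Psi^{-1}(0): the functional J(z) vanishes on the kernel of pi. *)
Definition level_set : set CJ :=
  [set z | forall x, piX x = 0 -> \sum_j (sqmod (z j) + lam j) * x j = 0].

Lemma rot_level_set x z : z \in level_set -> rotJ x z \in level_set.
Proof.
rewrite !inE => h y y0; rewrite -[RHS](h y y0).
by apply: eq_bigr => j _; rewrite /rotJ sqmod_expi.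
Qed.

Definition rotL (x : J -> R) (z : level_set) : level_set :=
  exist _ (rotJ x (val z)) (rot_level_set x (valP z)).

(* Orbit relation of N on Psi^{-1}(0). *)
Definition N_rel (z z' : level_set) : Prop :=
  exists2 x, Q (piX x) & z' = rotL x z.

Definition toric_space : topologicalType := quot_space N_rel.

(* Some x with exp_{D^n}(pi(x)) = q; the action does not depend on it. *)
Definition lift_torus (q : quasitorus Q) : J -> R :=
  xget (fun=> 0) [set x | expD Q (piX x) = q].

Definition toric_act (q : quasitorus Q) (m : toric_space) : toric_space :=
  cls _ (rotL (lift_torus q) (rep m)).

Definition moment_set (z : CJ) : set 'cV[R]_n :=
  [set xi | forall j, pairing xi (X j) = sqmod (z j) + lam j].

Definition moment (m : toric_space) : 'cV[R]_n :=
  xget 0 (moment_set (val (rep m))).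

Lemma moment_cls_rep (z : level_set) :
  moment_set (val (rep (cls N_rel z))) = moment_set (val z).
Proof.
have /(_ (fun z z' : level_set => moment_set (val z') = moment_set (val z))) :=
  @rep_cls _ N_rel z.
apply=> // [a b c -> ->//|].
move=> a _ [x _ ->]; apply/seteqP.
by split=> xi + j => /(_ j) ->; rewrite /= /rotJ sqmod_expi.
Qed.

Lemma moment_act q m : moment (toric_act q m) = moment m.
Proof.
rewrite /moment /toric_act moment_cls_rep; congr (xget 0 _); apply/seteqP.
by split=> xi + j => /(_ j) ->; rewrite /= /rotJ sqmod_expi.
Qed.

End Toric.

Section Cut.
Variables (R : realType) (n : nat) (Q : set 'rV[R]_n).
Variables (J : finType) (X : J -> 'rV[R]_n) (lam : J -> R).
Variables (Y : 'rV[R]_n) (eps : R).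
(* sg = 1 gives the cut space Phi_Y >= eps, and sg = -1 gives Phi_Y <= eps. *)
Variable sg : R.

(* C / Lambda. *)
Definition CLam : topologicalType :=
  quot_space (fun w w' : R[i]^o => exists2 t : R, Q (t *: Y) & w' = expi t * w).

Definition cut_amb : topologicalType := (toric_space Q X lam * CLam)%type.

Definition D1_act (t : R) (p : cut_amb) : cut_amb :=
  (toric_act (expD Q (t *: Y)) p.1, cls _ (expi (- sg * t) * rep p.2)).

Definition nu (p : cut_amb) : R :=
  pairing (moment p.1) Y - sg * sqmod (rep p.2).

Definition nu_level : set cut_amb := [set p | nu p = eps].

Definition cut_space : topologicalType :=
  quot_space (fun p p' : nu_level => exists t : R, val p' = D1_act t (val p)).

Lemma act_nu_level q (p : nu_level) :
  (toric_act q (val p).1, (val p).2) \in nu_level.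
Proof.
have /set_mem := valP p; rewrite /nu_level /= /nu => pE.
by apply/mem_set; rewrite /nu_level /= /nu /= moment_act.
Qed.

Definition act_nu (q : quasitorus Q) (p : nu_level) : nu_level :=
  exist (fun p' => p' \in nu_level) _ (act_nu_level q p).

Definition cut_act (q : quasitorus Q) (c : cut_space) : cut_space :=
  cls _ (act_nu q (rep c)).

End Cut.

Section Smooth.
Variables (R : realType) (U V : normedModType R).

Fixpoint Ck (k : nat) (W : set U) (f : U -> V) : Prop :=
  match k with
  | 0 => forall x, W x -> {for x, continuous f}
  | k'.+1 => (forall x, W x -> differentiable f x) /\
             (forall u, Ck k' W (fun x => 'd f x u))
  end.

(* C^oo on the open set W; the values of f outside W are irrelevant. *)
Definition smooth_on (W : set U) (f : U -> V) := forall k, Ck k W f.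

End Smooth.

Section Coverings.
Variable R : realType.

Definition covering_map (E V : topologicalType) (W : set V) (p : E -> V) :=
  [/\ continuous p, range p = W &
      forall x, W x -> exists O : set V,
        [/\ open O, O x, O `<=` W &
          exists (I : Type) (s : I -> set E),
            [/\ p @^-1` O = \bigcup_i s i, trivIset setT s &
                forall i, [/\ open (s i), set_bij (s i) O p &
                  forall A, open A -> A `<=` s i -> open (p @` A)]]]].

(* Path connected, and every loop is null-homotopic (through loops). Paths are
   parametrized by R, only their restriction to [0, 1] matters. *)
Definition simply_connected (E : topologicalType) :=
  [/\ exists x : E, True,
      forall x y : E, exists c : R -> E, [/\ continuous c, c 0 = x & c 1 = y] &
      forall c : R -> E, continuous c -> c 0 = c 1 ->
        exists (H : R * R -> E) (x : E), continuous H /\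
          (forall t, 0 <= t <= 1 ->
            [/\ H (0, t) = c t, H (1, t) = x & H (t, 0) = H (t, 1)])].

Definition universal_cover (E V : topologicalType) (W : set V) (p : E -> V) :=
  simply_connected E /\ covering_map W p.

(* p and q are covering maps onto open subsets of vector spaces, so they are
   local coordinates on E and E'. G is the expression of g in these
   coordinates on the neighbourhood O of e. *)
Definition local_expr (E E' : topologicalType) (V V' : normedModType R)
    (p : E -> V) (q : E' -> V') (g : E -> E') (e : E) (O : set E)
    (G : V -> V') :=
  [/\ open O, O e, smooth_on (p @` O) G &
      forall e', O e' -> q (g e') = G (p e')].

Definition cover_diffeo (E E' : topologicalType) (V V' : normedModType R)
    (p : E -> V) (q : E' -> V') (g : E -> E') :=
  exists h : E' -> E,
    [/\ cancel g h, cancel h g, continuous g, continuous h &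
        (forall e, exists O G, local_expr p q g e O G) /\
        (forall e, exists O G, local_expr q p h e O G)].

Definition cover_symplectic (E E' : topologicalType) (V V' : normedModType R)
    (p : E -> V) (q : E' -> V') (g : E -> E')
    (om : V -> V -> V -> R) (om' : V' -> V' -> V' -> R) :=
  forall e, exists O G, local_expr p q g e O G /\
    forall u v, om' (q (g e)) ('d G (p e) u) ('d G (p e) v) = om (p e) u v.

End Coverings.

Section Models.
Variable R : realType.

Definition orbit_rel k (W : set 'rV[R]_k) (G : set ('rV[R]_k -> 'rV[R]_k))
    (x y : W) : Prop :=
  exists2 g, G g & val y = g (val x).

Definition model k (W : set 'rV[R]_k) (G : set ('rV[R]_k -> 'rV[R]_k)) :
    topologicalType :=
  quot_space (@orbit_rel k W G).

(* W is a nonempty connected open subset of R^k and G is (represented by) a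
   countable group of diffeomorphisms of W. *)
Definition quasifold_model k (W : set 'rV[R]_k)
    (G : set ('rV[R]_k -> 'rV[R]_k)) :=
  [/\ [/\ open W, W !=set0 & connected W],
      [/\ countable G, G id, forall g h, G g -> G h -> G (g \o h) &
          forall g, G g -> exists2 h, G h &
            forall x, W x -> h (g x) = x /\ g (h x) = x],
      forall g, G g -> smooth_on W g /\ (forall x, W x -> W (g x)) &
      exists D : set 'rV[R]_k,
        [/\ D `<=` W, connected D, W `<=` closure D,
            forall g x, G g -> D x -> D (g x) &
            forall g x, G g -> D x -> g x = x -> forall y, W y -> g y = y]].

(* om x is the value at x of a 2-form. *)
Definition symplectic_form k (W : set 'rV[R]_k)
    (om : 'rV[R]_k -> 'rV[R]_k -> 'rV[R]_k -> R) :=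
  [/\ forall x, W x -> forall a u v w,
        om x (a *: u + v) w = a * om x u w + om x v w,
      forall x, W x -> forall u v, om x u v = - om x v u,
      forall x, W x -> forall u, (forall v, om x u v = 0) -> u = 0,
      forall u v, smooth_on W (fun x => om x u v : R^o) &
      forall x, W x -> forall u v w,
        'd (fun y => om y v w : R^o) x u + 'd (fun y => om y w u : R^o) x v +
        'd (fun y => om y u v : R^o) x w = 0].

End Models.

(* The data of an atlas on S: for each index, the model W / G, the chart from
   W / G to S, and a 2-form on W. *)
Record charts (R : realType) (S : Type) := Charts {
  ch_idx : Type;
  ch_dim : ch_idx -> nat;
  ch_dom : forall a, set 'rV[R]_(ch_dim a);
  ch_grp : forall a, set ('rV[R]_(ch_dim a) -> 'rV[R]_(ch_dim a));
  ch_map : forall a, model (@ch_dom a) (@ch_grp a) -> S;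
  ch_form : forall a,
    'rV[R]_(ch_dim a) -> 'rV[R]_(ch_dim a) -> 'rV[R]_(ch_dim a) -> R
}.

Arguments ch_idx {R S} A : rename.
Arguments ch_dim {R S} A a : rename.
Arguments ch_dom {R S} A a : rename.
Arguments ch_grp {R S} A a : rename.
Arguments ch_map {R S} A a : rename.
Arguments ch_form {R S} A a : rename.

Definition transport_charts (R : realType) (S S' : Type) (f : S -> S')
    (A : charts R S) : charts R S' :=
  @Charts R S' (ch_idx A) (ch_dim A) (ch_dom A) (ch_grp A)
    (fun a => f \o ch_map A a) (ch_form A).

Section Atlas.
Variables (R : realType) (S : topologicalType) (A : charts R S).
Implicit Types a b : ch_idx A.

Definition chart_pt a (x : ch_dom A a) : S := ch_map A a (cls _ x).

Definition overlap a b : set 'rV[R]_(ch_dim A a) :=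
  [set val x | x in [set x : ch_dom A a | range (ch_map A b) (chart_pt x)]].

Arguments overlap : clear implicits.

(* g lifts the change of charts to a diffeomorphism of universal covers. *)
Definition chart_change a b (E E' : topologicalType)
    (p : E -> 'rV[R]_(ch_dim A a)) (q : E' -> 'rV[R]_(ch_dim A b)) (g : E -> E') :=
  [/\ universal_cover R (overlap a b) p, universal_cover R (overlap b a) q,
      cover_diffeo p q g &
      forall e (x : ch_dom A a) (y : ch_dom A b),
        val x = p e -> val y = q (g e) -> chart_pt x = chart_pt y].

(* A is an atlas of a symplectic quasifold of dimension k. *)
Definition symplectic_quasifold (k : nat) :=
  [/\ forall a, ch_dim A a = k /\ quasifold_model (ch_dom A a) (ch_grp A a),
      forall a, [/\ injective (ch_map A a), continuous (ch_map A a) &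
        forall O, open O -> open (ch_map A a @` O)],
      forall s, exists a, range (ch_map A a) s,
      forall a, symplectic_form (ch_dom A a) (ch_form A a) /\
        forall g x u v, ch_grp A a g -> ch_dom A a x ->
          ch_form A a (g x) ('d g x u) ('d g x v) = ch_form A a x u v &
      forall a b, overlap a b !=set0 ->
        exists (E E' : topologicalType) (p : E -> 'rV[R]_(ch_dim A a))
          (q : E' -> 'rV[R]_(ch_dim A b)) (g : E -> E'),
          chart_change p q g /\
          cover_symplectic p q g (ch_form A a) (ch_form A b)].

Variables (n : nat) (Q : set 'rV[R]_n).
Variables (act : quasitorus Q -> S -> S) (Phi : S -> 'cV[R]_n).

Definition effective_action :=
  [/\ forall s, act (expD Q 0) s = s,
      forall y y' s, act (expD Q (y + y')) s = act (expD Q y) (act (expD Q y') s),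
      continuous (fun p : quasitorus Q * S => act p.1 p.2) &
      forall y, (forall s, act (expD Q y) s = s) -> expD Q y = expD Q 0].

(* In every chart, each y in R^n = Lie(D^n) is represented by a smooth vector
   field ze whose local flow lifts the action of exp(t y), and
   d <Phi, y> = om(ze, _). *)
Definition hamiltonian_action :=
  (forall q s, Phi (act q s) = Phi s) /\
  forall a (y : 'rV[R]_n),
    exists (ze : 'rV[R]_(ch_dim A a) -> 'rV[R]_(ch_dim A a))
           (H : 'rV[R]_(ch_dim A a) -> R^o),
      [/\ smooth_on (ch_dom A a) ze, smooth_on (ch_dom A a) H,
          forall x : ch_dom A a, H (val x) = pairing (Phi (chart_pt x)) y,
          forall x, ch_dom A a x -> forall u, 'd H x u = ch_form A a x (ze x) u &
          forall x : ch_dom A a, exists2 de : R, 0 < de &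
            exists c : R -> ch_dom A a, c 0 = x /\
              forall t, `|t| < de ->
                is_derive (t : R^o) 1 (fun s : R^o => val (c s))
                  (ze (val (c t))) /\
                chart_pt (c t) = act (expD Q (t *: y)) (chart_pt x)].

(* A, act and Phi make S a symplectic toric quasifold. *)
Definition symplectic_toric_quasifold :=
  [/\ symplectic_quasifold (n + n)%N, effective_action & hamiltonian_action].

End Atlas.

Section ToricCharts.
Variables (R : realType) (n : nat) (Q : set 'rV[R]_n).
Variables (J : finType) (X : J -> 'rV[R]_n) (lam : J -> R).

(* C^m is identified with R^(m + m) by real parts and imaginary parts. *)
Definition cc m (v : 'rV[R]_(m + m)) (a : 'I_m) : R[i]^o :=
  v 0 (lshift m a) +i* v 0 (rshift m a).
Definition of_cc m (z : 'I_m -> R[i]^o) : 'rV[R]_(m + m) :=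
  row_mx (\row_a complex.Re (z a)) (\row_a complex.Im (z a)).

(* (2 pi i)^-1 sum_a dv_a /\ d(conj v_a) = - pi^-1 sum_a dRe(v_a) /\ dIm(v_a) *)
Definition std_form m (u v : 'rV[R]_(m + m)) : R :=
  pi^-1 * \sum_(a < m) (complex.Im (cc u a) * complex.Re (cc v a) -
                        complex.Re (cc u a) * complex.Im (cc v a)).

(* C^I has coordinates indexed by 'I_#|I|, through enum_val : 'I_#|I| -> I. *)
Variable I : {set J}.
Local Notation VI := 'rV[R]_(#|I| + #|I|).
Local Notation ix := (@enum_val _ (mem I)).

Definition xi_set (v : VI) : set 'cV[R]_n :=
  [set xi | forall a, pairing xi (X (ix a)) = sqmod (cc v a) + lam (ix a)].
Definition xi_of (v : VI) : 'cV[R]_n := xget 0 (xi_set v).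

(* When I = I_mu the X_i with i in I form a basis of R^n, so that the first
   condition (xi_v exists) always holds. *)
Definition toric_dom : set VI :=
  [set v | xi_set v (xi_of v) /\
           forall j, j \notin I -> lam j < pairing (xi_of v) (X j)].

(* Gamma_mu, as a group of transformations of C^I. *)
Definition toric_grp : set (VI -> VI) :=
  [set g | exists2 x : 'I_#|I| -> R, Q (\sum_a x a *: X (ix a)) &
             g = fun v => of_cc (fun a => expi (x a) * cc v a)].

(* j is in I if and only if j = ix a for some a. *)
Definition toric_u (v : VI) : CJ R J := fun j =>
  if [pick a | ix a == j] is Some a then cc v a
  else (Num.sqrt (pairing (xi_of v) (X j) - lam j))%:C.

Lemma toric_u_level (v : toric_dom) : toric_u (val v) \in level_set X lam.
Proof.
have /set_mem [xiE xiI] := valP v; apply/mem_set => x x0.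
have uE j : sqmod (toric_u (val v) j) + lam j = pairing (xi_of (val v)) (X j).
  rewrite /toric_u; case: pickP => [a /eqP <-|noj]; first by rewrite xiE.
  have jI : j \notin I.
    apply/negP => jI; have := noj (enum_rank_in jI j).
    by rewrite enum_rankK_in ?eqxx.
  rewrite /sqmod /= expr0n addr0 sqr_sqrtr ?subrK// subr_ge0.
  exact: ltW (xiI _ jI).
under eq_bigr do rewrite uE mulrC.
transitivity (pairing (xi_of (val v)) (piX X x)); last first.
  by rewrite x0 /pairing mul0mx mxE.
rewrite /pairing /piX mulmx_suml summxE; apply: eq_bigr => j _.
by rewrite -scalemxAl [RHS]mxE.
Qed.

Definition toric_uL (v : toric_dom) : level_set X lam :=
  exist (fun z => z \in level_set X lam) _ (toric_u_level v).

Definition toric_chart (v : model toric_dom toric_grp) : toric_space Q X lam :=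
  cls _ (toric_uL (rep v)).

End ToricCharts.

Arguments toric_dom {R n J} X lam I.
Arguments toric_grp {R n} Q {J} X I.

Definition active (R : realType) (n : nat) (J : finType) (X : J -> 'rV[R]_n)
    (lam : J -> R) (mu : 'cV[R]_n) : {set J} :=
  [set j | pairing mu (X j) == lam j]%SET.

(* The atlas of the toric quasifold of (P, Q, X), indexed by the vertices. *)
Definition toric_charts (R : realType) (n : nat) (Q : set 'rV[R]_n)
    (P : set 'cV[R]_n) (J : finType) (X : J -> 'rV[R]_n) (lam : J -> R) :
    charts R (toric_space Q X lam) :=
  let I (mu : {mu | vertex P mu}) := active X lam (sval mu) in
  @Charts R (toric_space Q X lam) {mu | vertex P mu}
    (fun mu => #|I mu| + #|I mu|)%N
    (fun mu => toric_dom X lam (I mu))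
    (fun mu => toric_grp Q X (I mu))
    (fun mu => @toric_chart R n Q J X lam (I mu))
    (fun mu _ => @std_form R #|I mu|).

Section CutPolyhedron.
Variables (R : realType) (n : nat) (P : set 'cV[R]_n).
Variables (J : finType) (X : J -> 'rV[R]_n) (lam : J -> R).

(* None is the index of the new facet, with normal Z and constant c; Some j
   ranges over the old indices that still give a facet of P. *)
Definition cut_idx : finType :=
  option {j : J | `[< facet P (P `&` [set mu | pairing mu (X j) = lam j]) >]}.

Definition cut_normal (Z : 'rV[R]_n) (j : cut_idx) : 'rV[R]_n :=
  if j is Some j' then X (val j') else Z.

Definition cut_const (c : R) (j : cut_idx) : R :=
  if j is Some j' then lam (val j') else c.

End CutPolyhedron.

Arguments cut_normal {R n} P {J} X lam Z j.
Arguments cut_const {R n} P {J} X lam c j.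

(* Main.v *)
(* Both spaces are quotients of level sets in a complex vector space, with
   coordinates indexed by facets. A point z' of the level set of the cut
   polyhedron P gives a pair (z, w): w is the coordinate of the new facet, the
   coordinates of z that still define facets of P are copied, and the redundant
   ones are the nonnegative roots of <xi, X_j> - lam_j, where xi is the moment of
   z'. Rotating w is the same as acting by D^1, so this induces an equivariant map
   f into the cut space. Conversely, the phases of the redundant coordinates of z
   are removed by the torus. They are undetermined where such a coordinate
   vanishes, but there its normal lies in the span of the active normals of P, so
   that the ambiguity only rotates coordinates that vanish. Hence f is bijective
   with continuous inverse, and the structure is transported along f.

   For the toric quasifold itself, the overlap of the charts at two vertices with
   common facets K is covered by the points of the level set together with
   arguments of the coordinates outside K. This cover contracts to a point of the
   face K, and the change of charts lifts to a rotation by an element of ker pi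
   that depends linearly on the arguments. It preserves the form because the
   differentials of the |z_j|^2 come from the moment, which annihilates ker pi. *)
Require Import Defs.
From HB Require Import structures.
From mathcomp Require Import all_boot all_order all_algebra complex.
From mathcomp Require Import generic_quotient.
From mathcomp Require Import all_classical all_reals all_analysis ring lra zify.
Import numFieldNormedType.Exports.
Import Order.TTheory GRing.Theory Num.Theory.
Set Implicit Arguments.
Unset Strict Implicit.
Unset Printing Implicit Defensive.
Local Open Scope classical_set_scope.
Local Open Scope ring_scope.

(** * Polyhedra *)

(** The obstacle is the continuity of the inverse of [cut_f]. Near a zero of a redundant coordinate
    its phase has no continuous choice, and a lift of the inverse built from one fixed vertex need
    not be continuous. The lift is therefore built separately at each point. A vertex of [P] is
    chosen whose facets include every facet through the moment of that point, and the removed phases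
    are compensated along the basis of normals at this vertex. A phase that jumps then meets either
    a coefficient equal to 0 or a coordinate that tends to 0, and both are harmless for convergence.
    Almost everything is computed through a [corner], a vertex with the basis dual to its normals:
    it gives a linear section of pi and a closed formula for the moment. Both cut spaces are handled
    at once by a sign [sg], with [Z = sg *: Y] and [c = sg * eps]. That both halves of the
    polyhedron have full dimension yields a point of the wall strictly inside all old half-spaces;
    hence the wall is a facet, and a new one. *)

Section Pairing.
Variables (R : realType) (n : nat).
Implicit Types (mu nu : 'cV[R]_n) (X Y : 'rV[R]_n).

Lemma pairingDl mu nu X : pairing (mu + nu) X = pairing mu X + pairing nu X.
Proof. by rewrite /pairing mulmxDr mxE. Qed.

Lemma pairingZl a mu X : pairing (a *: mu) X = a * pairing mu X.
Proof. by rewrite /pairing -scalemxAr mxE. Qed.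

Lemma pairingBl mu nu X : pairing (mu - nu) X = pairing mu X - pairing nu X.
Proof. by rewrite /pairing mulmxBr !mxE. Qed.

Lemma pairingDr mu X Y : pairing mu (X + Y) = pairing mu X + pairing mu Y.
Proof. by rewrite /pairing mulmxDl mxE. Qed.

Lemma pairingZr a mu X : pairing mu (a *: X) = a * pairing mu X.
Proof. by rewrite /pairing -scalemxAl mxE. Qed.

Lemma pairingNr mu X : pairing mu (- X) = - pairing mu X.
Proof. by rewrite /pairing mulNmx mxE. Qed.

Lemma pairing0r mu : pairing mu 0 = 0.
Proof. by rewrite /pairing mul0mx mxE. Qed.

Lemma pairing_suml (I : Type) (r : seq I) (P : pred I) (F : I -> 'cV[R]_n) X :
  pairing (\sum_(i <- r | P i) F i) X = \sum_(i <- r | P i) pairing (F i) X.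
Proof. by rewrite /pairing mulmx_sumr summxE. Qed.

Lemma pairing_sumr (I : Type) (r : seq I) (P : pred I) mu (F : I -> 'rV[R]_n) :
  pairing mu (\sum_(i <- r | P i) F i) = \sum_(i <- r | P i) pairing mu (F i).
Proof. by rewrite /pairing mulmx_suml summxE. Qed.

Lemma pairing_inj_r X Y : (forall mu, pairing mu X = pairing mu Y) -> X = Y.
Proof.
move=> h; apply/rowP => i; have := h (delta_mx i 0).
by rewrite /pairing -!colE !mxE.
Qed.

Lemma pairing_piX (J : finType) (X : J -> 'rV[R]_n) (x : J -> R) mu :
  pairing mu (piX X x) = \sum_j x j * pairing mu (X j).
Proof. by rewrite /piX pairing_sumr; apply: eq_bigr => j _; rewrite pairingZr. Qed.

End Pairing.

Section Polyhedra.
Variables (R : realType) (n : nat).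
Implicit Types (mu nu v : 'cV[R]_n).

(** The radius is [s^-1], where [s] exceeds every ratio [|b j| / a j] with [j] in [S]; a change
    [t * b j] then stays below the slack [a j]. *)
Lemma small_perturbation (J : finType) (S : pred J) (a b : J -> R) :
  (forall j, S j -> 0 < a j) ->
  exists2 e : R, 0 < e & forall j t, S j -> `|t| <= e -> 0 < a j + t * b j.
Proof.
move=> a0; pose s := 1 + \sum_(j | S j) `|b j| / a j.
have q0 j : S j -> 0 <= `|b j| / a j by move=> Sj; rewrite divr_ge0// ltW ?a0.
have s0 : 0 < s by rewrite ltr_pwDl// sumr_ge0.
exists s^-1; first by rewrite invr_gt0.
move=> j t Sj te; have aj := a0 _ Sj.
have bs : `|b j| < s * a j.
  rewrite -ltr_pdivrMr// /s (bigD1 j)//= addrCA ltrDl ltr_pwDl// sumr_ge0// => i.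
  by move=> /andP[/q0].
have : `|t * b j| < a j.
  rewrite normrM; apply: le_lt_trans (_ : s^-1 * `|b j| < _).
    by rewrite ler_wpM2r.
  by rewrite mulrC ltr_pdivrMr// mulrC.
by rewrite ltr_norml => /andP[h _]; rewrite -subr_gt0 opprK addrC in h *; lra.
Qed.

Section Halfspaces.
Variables (J : finType) (X : J -> 'rV[R]_n) (lam : J -> R).
Let P := halfspaces X lam.

Lemma activeE mu j : (j \in active X lam mu) = (pairing mu (X j) == lam j).
Proof. by rewrite inE. Qed.

(** Tight constraints do not change along [v], and the others have slack. Both signs of [t] are
    allowed, which later forces functionals to vanish on [v]. *)
Lemma halfspaces_perturbation mu v :
  P mu -> (forall j, j \in active X lam mu -> pairing v (X j) = 0) ->
  exists2 e : R, 0 < e & forall t, `|t| <= e -> P (mu + t *: v).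
Proof.
move=> Pmu v0.
have [j|e e0 eP] := @small_perturbation J (fun j => j \notin active X lam mu)
    (fun j => pairing mu (X j) - lam j) (fun j => pairing v (X j)).
  by rewrite activeE subr_gt0 lt_neqAle eq_sym => ->/=; exact: Pmu.
exists e => // t te j; rewrite pairingDl pairingZl.
have [/[dup] + /v0 ->|jA] := boolP (j \in active X lam mu).
  by rewrite activeE => /eqP ->; rewrite mulr0 addr0.
by have := eP _ _ jA te; lra.
Qed.

Lemma vertex_in (S : set 'cV[R]_n) mu : vertex S mu -> S mu.
Proof.
by move=> [_ [A [b [_ e]]]]; have : [set mu] mu by []; rewrite e => -[].
Qed.

Lemma vertex_active_span mu : vertex P mu ->
  forall v, (forall j, j \in active X lam mu -> pairing v (X j) = 0) -> v = 0.
Proof.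
move=> vmu; have Pmu := vertex_in vmu; case: vmu => _ [A [b [PA FE]]] v v0.
have [e e0 eP] := halfspaces_perturbation Pmu v0.
have muA : pairing mu A = b by have : [set mu] mu by []; rewrite FE => -[].
have ee : `|e| <= e by rewrite gtr0_norm.
have ene : `|- e| <= e by rewrite normrN gtr0_norm.
(* The points [mu + e v] and [mu - e v] both lie in [P], so the supporting functional [A], minimal
   at their midpoint, is constant along [v]. *)
have h1 := PA _ (eP _ ee); have h2 := PA _ (eP _ ene).
rewrite /= !pairingDl !pairingZl muA in h1 h2.
have evA : e * pairing v A = 0 by lra.
have : [set mu] (mu + e *: v).
  by rewrite FE; split; [exact: eP|rewrite /= pairingDl pairingZl evA addr0].
move=> /= /eqP; rewrite -subr_eq0 addrAC subrr add0r scaler_eq0 gt_eqF//=.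
by move/eqP.
Qed.

(** The sum of the tight inequalities supports [P] at [mu]: equality in the sum forces equality in
    each term, and the spanning condition leaves only [mu]. *)
Lemma vertex_of_active_span mu : P mu ->
  (forall v, (forall j, j \in active X lam mu -> pairing v (X j) = 0) -> v = 0) ->
  vertex P mu.
Proof.
move=> Pmu sp; split; first by exists mu.
exists (\sum_(j in active X lam mu) X j), (\sum_(j in active X lam mu) lam j).
split=> [nu Pnu /=|]; first by rewrite pairing_sumr ler_sum// => j _; exact: Pnu.
apply/seteqP; split=> [_ -> /=|nu /= [Pnu]].
  split=> //; rewrite pairing_sumr; apply: eq_bigr => j.
  by rewrite activeE => /eqP.
rewrite pairing_sumr => /eqP; rewrite -subr_eq0 -sumrB psumr_eq0; last first.
  by move=> j _; rewrite subr_ge0.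
move=> /allP h; apply/eqP; rewrite -subr_eq0; apply/eqP/sp => j jA.
have := h j (mem_index_enum _); rewrite jA/= subr_eq0 => /eqP nuj.
by move: jA; rewrite activeE => /eqP muj; rewrite pairingBl nuj muj subrr.
Qed.

(** As long as the tight normals do not span, some direction leaves them constant; moving along it
    until a further constraint becomes tight enlarges the active set. The induction is on the number
    of constraints that are not tight. *)
Lemma exists_vertex_active mu : P mu ->
  (forall v, (forall j, pairing v (X j) = 0) -> v = 0) ->
  exists2 nu, vertex P nu & active X lam mu \subset active X lam nu.
Proof.
move=> + sp; have [m] := ubnP (#|J| - #|active X lam mu|).
elim: m mu => // m IH mu; rewrite ltnS => lem Pmu.
have [h|] := pselect (forall v,
  (forall j, j \in active X lam mu -> pairing v (X j) = 0) -> v = 0).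
  by exists mu => //; exact: vertex_of_active_span.
move=> /existsNP[v /not_implyP[v0 vn0]].
have [j0 j0P] : exists j, pairing v (X j) != 0.
  apply: contrapT => /forallNP h; apply/vn0/sp => j; apply/eqP.
  by apply: contrapT => /negP; exact: h.
have [w w0 [j1 j1P]] : exists2 w,
   (forall j, j \in active X lam mu -> pairing w (X j) = 0) &
   exists j, pairing w (X j) < 0.
  have [h|h] := ltrP (pairing v (X j0)) 0; first by exists v => //; exists j0.
  exists ((-1) *: v) => [j /v0 e|]; first by rewrite pairingZl e mulr0.
  by exists j0; rewrite pairingZl mulN1r oppr_lt0 lt_def j0P.
(* [tt j] is the time at which the ray from [mu] in direction [w] reaches the hyperplane of [j]; up
   to the smallest such time the ray stays in [P]. *)
pose tt j := (pairing mu (X j) - lam j) / - pairing w (X j).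
case: (@arg_minP _ _ _ j1 (fun j => pairing w (X j) < 0) tt j1P) => j jP jmin.
have [Pt act'] : P (mu + tt j *: w) /\ j \in active X lam (mu + tt j *: w).
  split=> [i|]; last first.
    rewrite activeE pairingDl pairingZl /tt; apply/eqP.
    by field; rewrite lt_eqF.
  rewrite pairingDl pairingZl.
  have tj0 : 0 <= tt j.
    by rewrite divr_ge0// ?subr_ge0 ?oppr_ge0; [exact: Pmu|exact: ltW].
  have [wi|wi] := ltrP (pairing w (X i)) 0; last first.
    by have := Pmu i; have := mulr_ge0 tj0 wi; lra.
  have := jmin _ wi; rewrite {2}/tt ler_pdivlMr ?oppr_gt0//; lra.
have sub : active X lam mu \subset active X lam (mu + tt j *: w).
  apply/fintype.subsetP => i iA; rewrite activeE pairingDl pairingZl w0// mulr0 addr0.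
  by rewrite -activeE.
have jA : j \notin active X lam mu.
  by apply/negP => /w0 e; move: jP; rewrite e ltxx.
have pr : active X lam mu \proper active X lam (mu + tt j *: w).
  by rewrite properE sub; apply/fintype.subsetPn; exists j.
have [|//|nu vnu nuP] := IH (mu + tt j *: w).
  apply: leq_trans lem; apply: ltn_sub2l (proper_card pr).
  exact: leq_trans (proper_card pr) (max_card _).
by exists nu => //; exact: fintype.subset_trans nuP.
Qed.

End Halfspaces.

Local Notation dirs s0 s := (\matrix_i (s i - s0)^T).

Lemma mul_dirs l s0 (s : 'I_l -> 'cV[R]_n) (X : 'rV[R]_n) :
  (dirs s0 s *m X^T == 0) = [forall i, pairing (s i) X == pairing s0 X].
Proof.
have E i : (dirs s0 s *m X^T) i 0 = pairing (s i) X - pairing s0 X.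
  rewrite -pairingBl /pairing [LHS]mxE [RHS]mxE.
  by apply: eq_bigr => k _; rewrite !mxE mulrC.
apply/eqP/forallP => [h i|h].
  by rewrite -subr_eq0 -E h mxE.
by apply/colP => i; rewrite E mxE; apply/eqP; rewrite subr_eq0.
Qed.

(** The barycentre of a frame serves as a relative interior point: an inequality valid on the frame
    and tight here is tight on the whole frame. *)
Definition average l s0 (s : 'I_l -> 'cV[R]_n) : 'cV[R]_n :=
  l.+1%:R^-1 *: (s0 + \sum_i s i).

Lemma pairing_average l s0 (s : 'I_l -> 'cV[R]_n) X (c : R) :
  pairing (average s0 s) X - c =
  l.+1%:R^-1 * ((pairing s0 X - c) + \sum_i (pairing (s i) X - c)).
Proof.
rewrite pairingZl pairingDl pairing_suml sumrB sumr_const card_ord -mulr_natr.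
by rewrite -natr1; field; rewrite natr1 pnatr_eq0.
Qed.

Lemma average_ge l s0 (s : 'I_l -> 'cV[R]_n) X c : c <= pairing s0 X ->
  (forall i, c <= pairing (s i) X) -> c <= pairing (average s0 s) X.
Proof.
move=> h0 h; rewrite -subr_ge0 pairing_average mulr_ge0// addr_ge0 ?subr_ge0//.
by apply: sumr_ge0 => i _; rewrite subr_ge0.
Qed.

Lemma average_eq l s0 (s : 'I_l -> 'cV[R]_n) X c : c <= pairing s0 X ->
  (forall i, c <= pairing (s i) X) -> pairing (average s0 s) X = c ->
  pairing s0 X = c /\ forall i, pairing (s i) X = c.
Proof.
move=> h0 h /eqP; rewrite -subr_eq0 pairing_average mulf_eq0 invr_eq0 pnatr_eq0/=.
have h' i : 0 <= pairing (s i) X - c by rewrite subr_ge0.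
rewrite paddr_eq0 ?sumr_ge0// ?subr_ge0// psumr_eq0// subr_eq0.
move=> /andP[/eqP -> /allP a]; split=> // i; apply/eqP.
by have := a i (mem_index_enum _); rewrite subr_eq0.
Qed.

(** Were constraint [j] tight at the barycentre, it would be tight on the frame, and the invertible
    matrix of directions would kill [X j]. *)
Lemma has_dim_interior (J : finType) (X : J -> 'rV[R]_n) lam :
  (forall j, X j != 0) -> has_dim (halfspaces X lam) n ->
  exists mu, forall j, lam j < pairing mu (X j).
Proof.
move=> X0 [[s0 [s [Ss0 Ss rk]]] _]; exists (average s0 s) => j.
have ge : lam j <= pairing (average s0 s) (X j).
  by apply: average_ge => [|i]; [exact: Ss0|exact: Ss].
rewrite lt_def ge andbT.
apply/eqP => /average_eq[||e0 e]; [exact: Ss0|by move=> i; exact: Ss|].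
have : dirs s0 s *m (X j)^T == 0.
  by rewrite mul_dirs; apply/forallP => i; rewrite e e0.
have u : dirs s0 s \in unitmx by rewrite -row_free_unit /row_free rk.
move=> /eqP /(congr1 (mulmx (invmx (dirs s0 s)))).
rewrite mulKmx// mulmx0 => /(congr1 trmx); rewrite trmxK trmx0 => /eqP.
exact/negP.
Qed.

(** One point from which [P] extends in every direction of the hyperplane produces a facet: a basis
    of the directions, each vector scaled by its own small [e i], gives the frame. *)
Lemma facet_of_point (P : set 'cV[R]_n) (X : 'rV[R]_n) c q :
  X != 0 -> P `<=` [set mu | c <= pairing mu X] ->
  P q -> pairing q X = c ->
  (forall v, pairing v X = 0 -> exists2 e : R, 0 < e & P (q + e *: v)) ->
  facet P (P `&` [set mu | pairing mu X = c]).
Proof.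
move=> X0 PX Pq qX near.
have rX : \rank X^T = 1%N by rewrite mxrank_tr rank_rV X0.
have [k nk] : exists k, n = k.+1.
  case: (posnP n) => [n0|n0]; last by exists n.-1; rewrite prednK.
  by have := rank_leq_row X^T; rewrite rX n0.
split; first by split; [exists q|exists X, c].
exists k => //; split; last first.
  move=> l s0 s [_ s0X] sX.
  have : (dirs s0 s <= kermx X^T)%MS.
    apply/sub_kermxP/eqP; rewrite mul_dirs; apply/forallP => i.
    by have [_ ->] := sX i; rewrite s0X.
  move=> /mxrankS; rewrite mxrank_ker rX => rle.
  by apply: leq_trans rle _; rewrite nk subn1.
have [B fB BX] : exists2 B : 'M[R]_(k, n), row_free B & B *m X^T = 0.
  have <- : \rank (kermx X^T) = k by rewrite mxrank_ker rX nk subn1.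
  exists (row_base (kermx X^T)); first by rewrite row_base_free.
  by apply/sub_kermxP; rewrite eq_row_base.
have BE i : pairing (row i B)^T X = 0.
  move/matrixP: BX => /(_ i 0); rewrite [RHS]mxE => <-.
  by rewrite /pairing !mxE; apply: eq_bigr => j _; rewrite !mxE mulrC.
have [e eP] := @choice _ _ (fun i e => 0 < e /\ P (q + e *: (row i B)^T))
  (fun i => let: ex_intro2 e e0 Pe := near _ (BE i) in ex_intro _ e (conj e0 Pe)).
exists q, (fun i => q + e i *: (row i B)^T); split=> //.
  move=> i; have [_ ?] := eP i; split=> //=.
  by rewrite pairingDl pairingZl BE mulr0 addr0.
have -> : \matrix_(i < k) (q + e i *: (row i B)^T - q)^T =
    diag_mx (\row_i e i) *m B.
  apply/row_matrixP => i; rewrite rowK addrAC subrr add0r linearZ/= trmxK.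
  by rewrite row_mul row_diag_mx -scalemxAl -rowE mxE.
rewrite mxrankMfree// mxrank_unit// unitmxE det_diag unitfE prodf_seq_neq0.
by apply/allP => i _; rewrite mxE/= gt_eqF//; have [] := eP i.
Qed.

(** The normals that are constant on a frame of dimension [n - 1] form a line, so a hyperplane
    spanned by the set fixes its equation up to a factor. *)
Lemma has_dim_hyperplane k (F : set 'cV[R]_n) (X X' : 'rV[R]_n) c c' :
  n = k.+1 -> has_dim F k -> X != 0 ->
  F `<=` [set mu | pairing mu X = c] -> F `<=` [set mu | pairing mu X' = c'] ->
  exists a, X' = a *: X /\ c' = a * c.
Proof.
move=> nk [[s0 [s [Fs0 Fs rk]]] _] X0 FX FX'.
have K (Z : 'rV[R]_n) b : F `<=` [set mu | pairing mu Z = b] ->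
    (Z <= kermx (dirs s0 s)^T)%MS.
  move=> FZ; apply/sub_kermxP/trmx_inj; rewrite trmx_mul trmxK trmx0; apply/eqP.
  by rewrite mul_dirs; apply/forallP => i; rewrite (FZ _ (Fs i)) (FZ _ Fs0).
have rK : \rank (kermx (dirs s0 s)^T) = 1%N.
  by rewrite mxrank_ker mxrank_tr rk nk subSnn.
have XK := K _ _ FX; have XK' := K _ _ FX'.
have /sub_rVP[a aE] : (X' <= X)%MS.
  apply: submx_trans XK' _; rewrite -(mxrank_leqif_sup XK).2.
  by rewrite rK rank_rV X0.
exists a; split=> //; rewrite -(FX _ Fs0) -(FX' _ Fs0) aE.
by rewrite pairingZr.
Qed.

Lemma facet_halfspaces (J : finType) (X : J -> 'rV[R]_n) lam F :
  let P := halfspaces X lam in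
  (forall j, X j != 0) -> has_dim P n -> facet P F ->
  exists j, F = P `&` [set mu | pairing mu (X j) = lam j].
Proof.
move=> P X0 dP [[_ [A [b [PA FE]]]] [k nk dF]].
have [[s0 [s [Fs0 Fs rk]]] _] := dF.
set p := average s0 s.
have FP mu : F mu -> P mu by rewrite FE => -[].
have Pp : P p.
  by move=> j; apply: average_ge; [exact: FP Fs0 j|move=> i; exact: FP (Fs i) j].
have Fp : F p.
  have FA mu : F mu -> pairing mu A = b by rewrite FE => -[].
  rewrite FE; split=> //=; apply/eqP; rewrite -subr_eq0 pairing_average.
  by rewrite FA// big1 ?subrr ?addr0 ?mulr0// => i _; rewrite FA// subrr.
(* If no constraint were tight at [p], then [p] would be interior, [A] would vanish and the facet
   would be all of [P], against the dimensions. *)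
have [j jp] : exists j, pairing p (X j) = lam j.
  apply: contrapT => /forallNP h.
  have A0 : A = 0.
    apply: pairing_inj_r => v; rewrite pairing0r.
    have [j|e e0 eP] := @halfspaces_perturbation _ X lam p v Pp.
      by rewrite activeE => /eqP /h.
    have pA : pairing p A = b by move: Fp; rewrite FE => -[].
    have ee : `|e| <= e by rewrite gtr0_norm.
    have ene : `|- e| <= e by rewrite normrN gtr0_norm.
    have h1 := PA _ (eP _ ee); have h2 := PA _ (eP _ ene).
    rewrite /= !pairingDl pA !(pairingZl _ v) in h1 h2.
    have : e * pairing v A == 0 by apply/eqP; lra.
    by rewrite mulf_eq0 gt_eqF//= => /eqP.
  have FPE : F = P.
    apply/seteqP; split=> [mu /FP//|mu Pmu]; rewrite FE; split=> //=.
    by move: Fp; rewrite FE A0 /= !pairing0r => -[].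
  move: dP => [[t0 [t [Pt0 Pt rt]]] _].
  have [_ /(_ n t0 t)] := dF; rewrite FPE => /(_ Pt0 Pt).
  by rewrite rt nk ltnn.
exists j.
have [e0 e] := average_eq (FP _ Fs0 j) (fun i => FP _ (Fs i) j) jp.
have FX : F `<=` [set mu | pairing mu (X j) = lam j].
  (* Appending [mu] to the frame cannot raise the rank, so [mu - s0] is a combination of the frame
     directions, on which [X j] vanishes. *)
  move=> mu Fmu /=; have [_ /(_ k.+1 s0 (fun i => oapp s mu (unlift ord_max i)))] := dF.
  move=> /(_ Fs0) rkle.
  have {}rkle : (\rank (dirs s0 (fun i : 'I_k.+1 => oapp s mu (unlift ord_max i))) <= k)%N.
    by apply: rkle => i; case: unlift.
  set D := \matrix_i (_ : 'rV[R]_n) in rkle.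
  have DD : (dirs s0 s <= D)%MS.
    apply/row_subP => i; have -> : row i (dirs s0 s) = row (lift ord_max i) D.
      by apply/rowP => l; rewrite !mxE liftK.
    exact: row_sub.
  have muD : ((mu - s0)^T <= dirs s0 s)%MS.
    apply: submx_trans (_ : D <= _)%MS; last first.
      by rewrite -(mxrank_leqif_sup DD).2 rk eqn_leq rkle andbT -{1}rk mxrankS.
    have -> : (mu - s0)^T = row ord_max D by apply/rowP => l; rewrite !mxE unlift_none.
    exact: row_sub.
  have [C CE] := submxP muD.
  have : dirs s0 s *m (X j)^T = 0.
    by apply/eqP; rewrite mul_dirs; apply/forallP => i; rewrite e e0.
  move=> /(congr1 (mulmx C)); rewrite mulmxA -CE mulmx0 -trmx_mul => /matrixP/(_ 0 0).
  rewrite !mxE -/(_ *m _) => h; rewrite -e0; apply/eqP; rewrite -subr_eq0 -pairingBl.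
  by rewrite /pairing mxE h.
apply/seteqP; split=> [mu Fmu|mu [Pmu /= muX]]; first by split; [exact: FP|exact: FX].
have FA : F `<=` [set mu | pairing mu A = b] by rewrite FE => ? [].
have [a [AE bE]] := has_dim_hyperplane nk dF (X0 j) FX FA.
by rewrite FE; split=> //=; rewrite AE bE pairingZr muX.
Qed.

(** In a minimal subset of constraints that still cuts out [P], each member [j] defines a facet:
    some point violates [j] alone within the subset, and the segment from it to an interior point
    crosses the hyperplane of [j] strictly inside the remaining constraints of the subset. *)
Lemma facets_irredundant (J : finType) (X : J -> 'rV[R]_n) lam mu :
  let P := halfspaces X lam in
  (forall j, X j != 0) -> has_dim P n ->
  (forall j, facet P (P `&` [set mu | pairing mu (X j) = lam j]) ->
     lam j <= pairing mu (X j)) -> P mu.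
Proof.
move=> P X0 dP; have [p pP] := has_dim_interior X0 dP.
pose enough (S : {set J}) :=
  `[< forall mu, (forall j, j \in S -> lam j <= pairing mu (X j)) -> P mu >].
have [|S /minsetP[/asboolP SP Smin]] := @ex_minset _ enough.
  by exists [set: J]%SET; apply/asboolP => nu h j; apply: h; rewrite inE.
move=> h; apply: (SP) => j jS; apply: h.
have [nu [nuS nuj]] : exists nu, (forall i, i \in S -> i != j ->
    lam i <= pairing nu (X i)) /\ pairing nu (X j) < lam j.
  apply: contrapT => /forallNP h.
  suff e : S :\ j = S by move: jS; rewrite -e !inE eqxx.
  apply: Smin; last exact: subD1set.
  apply/asboolP => nu nuS; apply: (SP) => i iS.
  have nuS' k : k \in S -> k != j -> lam k <= pairing nu (X k).
    by move=> kS kj; apply: nuS; rewrite !inE kj.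
  have [->|/nuS'] := eqVneq i j; last exact.
  by rewrite leNgt; apply/negP => ?; apply: (h nu).
set u := pairing p (X j) - lam j; set w := lam j - pairing nu (X j).
have u0 : 0 < u by rewrite subr_gt0.
have w0 : 0 < w by rewrite subr_gt0.
(* The slack [u] of [p] and the violation [w] of [nu] are the weights that put [q] on the hyperplane
   of [j]. *)
pose q := (u + w)^-1 *: (w *: p + u *: nu).
have uw : 0 < u + w by rewrite addr_gt0.
have qE i : pairing q (X i) - lam i =
  (u + w)^-1 * (w * (pairing p (X i) - lam i) + u * (pairing nu (X i) - lam i)).
  rewrite /q !(pairingZl, pairingDl); field; exact: lt0r_neq0.
have qj : pairing q (X j) = lam j.
  apply/eqP; rewrite -subr_eq0 qE -/u -(opprB (lam j)) -/w.
  by rewrite mulrN mulrC (mulrC u) subrr mul0r.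
have qi i : i \in S -> i != j -> 0 < pairing q (X i) - lam i.
  move=> iS ij; rewrite qE mulr_gt0 ?invr_gt0// ltr_pwDl//.
    by rewrite mulr_gt0// subr_gt0.
  by rewrite mulr_ge0 ?(ltW u0)// subr_ge0 nuS.
apply: (@facet_of_point _ _ _ q) => //.
- by move=> ? /(_ j).
- apply: (SP) => i iS; have [->|/(qi _ iS)] := eqVneq i j; first by rewrite qj.
  by rewrite subr_gt0 => /ltW.
- move=> v vj.
  have [i|e e0 eP] := @small_perturbation J (fun i => (i \in S) && (i != j))
    (fun i => pairing q (X i) - lam i) (fun i => pairing v (X i)).
    by move=> /andP[]; exact: qi.
  exists e => //; apply: SP => i iS; rewrite pairingDl pairingZl.
  have [->|ij] := eqVneq i j; first by rewrite vj mulr0 addr0 qj.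
  have := eP i e; rewrite iS ij gtr0_norm// lexx => /(_ erefl erefl); lra.
Qed.

(** With [X = 0] the equation holds on all of [P] once it holds at one point, and the facet would
    have dimension [n]. *)
Lemma facet_nonzero (P : set 'cV[R]_n) X c : has_dim P n ->
  facet P (P `&` [set mu | pairing mu X = c]) -> X != 0.
Proof.
move=> [[s0 [s [Ps0 Ps rk]]] _] [[[mu [Pmu /= muX]] _] [k nk [_ kP]]].
apply/eqP => X0; move: muX; rewrite X0 pairing0r => c0.
suff : (\rank (\matrix_(i < n) (s i - s0)^T) <= k)%N by rewrite rk nk ltnn.
by apply: kP => [|i]; split=> //=; rewrite X0 pairing0r.
Qed.

End Polyhedra.

(** * Dual bases at a vertex *)

Section DualBasis.
Variables (R : realType) (n : nat) (J : finType) (X : J -> 'rV[R]_n).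

(** Indexed by all of [J] to avoid dependent types; the values of [e] off [I] are unconstrained. *)
Definition dual_basis (I : {set J}) (e : J -> 'cV[R]_n) :=
  (forall i j, i \in I -> j \in I -> pairing (e i) (X j) = (i == j)%:R) /\
  (forall y, y = \sum_(i in I) pairing (e i) y *: X i).

Lemma exists_dual_basis (I : {set J}) : #|I| = n ->
  (forall v, (forall j, j \in I -> pairing v (X j) = 0) -> v = 0) ->
  exists e, dual_basis I e.
Proof.
move=> cI sp; pose B : 'M[R]_(#|I|, n) := \matrix_a X (enum_val a).
have fB : row_free B^T.
  rewrite -kermx_eq0; apply/eqP/row_matrixP => i; rewrite row0.
  set r := row i _; have rB : r *m B^T = 0 by apply/sub_kermxP; exact: row_sub.
  apply: trmx_inj; rewrite trmx0; apply: sp => j jI.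
  move/matrixP: rB => /(_ 0 (enum_rank_in jI j)); rewrite [RHS]mxE => <-.
  by rewrite /pairing !mxE; apply: eq_bigr => k _; rewrite !mxE enum_rankK_in// mulrC.
have rkB : \rank B = n by rewrite -mxrank_tr; exact/eqP.
(* [B] is square only through the equation [#|I| = n], so its two-sided inverse is taken as a
   pseudo-inverse. *)
pose C := pinvmx B.
have BC : B *m C = 1%:M by apply: mulmxVp; rewrite /row_free rkB cI.
have CB : C *m B = 1%:M by apply: mulVpmx; rewrite /row_full rkB.
pose e i := \sum_(a | enum_val a == i :> J) col a C.
have eE (a : 'I_#|I|) Z : pairing (e (enum_val a)) Z = (Z *m C) 0 a.
  rewrite /e (big_pred1 a) => [|b]; last by rewrite (inj_eq enum_val_inj).
  by rewrite /pairing !mxE; apply: eq_bigr => k _; rewrite !mxE.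
exists e; split=> [i j iI jI|y].
  rewrite -(enum_rankK_in iI iI) eE -{2}(enum_rankK_in iI jI) (inj_eq enum_val_inj).
  have -> : X j = row (enum_rank_in iI j) B by rewrite rowK enum_rankK_in.
  by rewrite -row_mul BC !mxE eq_sym.
rewrite -{1}[y]mulmx1 -CB mulmxA big_enum_val.
rewrite [LHS]mulmx_sum_row; apply: eq_bigr => a _.
by rewrite eE rowK.
Qed.

End DualBasis.

Section Quasirational.
Variables (R : realType) (n : nat) (Q : set 'rV[R]_n).
Variables (J : finType) (X : J -> 'rV[R]_n) (lam : J -> R) (P : set 'cV[R]_n).
Hypothesis qP : quasirational Q P X lam.

Lemma quasirational_nonzero : has_dim P n -> forall j, X j != 0.
Proof.
by case: qP => _ _ [fP _ _] dP j; apply: (facet_nonzero dP); exact: fP.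
Qed.

(** The indexing of facets by normals restricts to a bijection between the active indices and the
    facets through [mu], and simplicity counts the latter. *)
Lemma card_active_vertex mu : simple_pointed P -> vertex P mu ->
  #|active X lam mu| = n.
Proof.
case: qP => PE _ [fP injF surjF] [_ _ _ +] vmu.
have Pmu := vertex_in vmu.
pose F j := P `&` [set mu | pairing mu (X j) = lam j].
pose A := active X lam mu.
move=> /(_ _ vmu).
have <- : [set F (enum_val a) | a in [set: 'I_#|A|]] = [set F | facet P F /\ F mu].
  apply/seteqP; split=> [_ [a _ <-]|G [fG Gmu]].
    split; first exact: fP.
    by split=> //=; have := enum_valP a; rewrite activeE => /eqP.
  have [j _ jE] := surjF _ fG; have jA : j \in A.
    by move: Gmu; rewrite -jE activeE => -[_ /eqP].
  by exists (enum_rank_in jA j) => //; rewrite enum_rankK_in.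
move=> cn; apply/card_eq_II.
apply: card_eq_trans cn; rewrite card_eq_sym.
have cA : (`I_#|A| #= [set: 'I_#|A|])%card by exact: card_II.
apply: card_eq_trans; last by rewrite card_eq_sym; exact: cA.
apply: inj_card_eq => a b _ _ /injF; rewrite !inE => /(_ I I).
exact: enum_val_inj.
Qed.

End Quasirational.

(** * The polyhedron cut by a hyperplane *)

Section CutPolyhedron.
Variables (R : realType) (n : nat) (Q : set 'rV[R]_n).
Variables (J : finType) (X : J -> 'rV[R]_n) (lam : J -> R) (D P : set 'cV[R]_n).
Variables (Z : 'rV[R]_n) (c : R).
Hypotheses (qD : quasirational Q D X lam) (dD : has_dim D n).
Hypotheses (QZ : Q Z) (Z0 : Z != 0).
Hypothesis PE : P = D `&` [set mu | c <= pairing mu Z].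
Hypotheses (dP : has_dim P n) (dN : has_dim (D `&` [set mu | pairing mu Z <= c]) n).

(** The redundant description of [P]: all old inequalities are kept, and the new one sits at [None].
    The general facts on half-spaces apply to it before any inequality is dropped. *)
Let X1 (j : option J) := oapp X Z j.
Let lam1 (j : option J) := oapp lam c j.

Let X10 j : X1 j != 0.
Proof. by case: j => //= j; exact: quasirational_nonzero qD dD j. Qed.

Let P1 : P = halfspaces X1 lam1.
Proof.
case: qD => DE _ _; rewrite PE DE; apply/seteqP; split=> mu /= h.
  by case: h => h1 h2 [j|] /=; [exact: h1|].
by split; [move=> j; exact: (h (Some j))|exact: (h None)].
Qed.

Let P1i mu j : P mu -> lam1 j <= pairing mu (X1 j).
Proof. by rewrite P1; exact. Qed.

Let P1e mu : (forall j, lam1 j <= pairing mu (X1 j)) -> P mu.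
Proof. by rewrite P1. Qed.

Lemma cut_interior_point : exists mu,
  (forall j, lam j < pairing mu (X j)) /\ c < pairing mu Z.
Proof.
have [|mu h] := has_dim_interior X10 (lam := lam1); first by rewrite -P1.
by exists mu; split=> [j|]; [exact: (h (Some j))|exact: (h None)].
Qed.

(** Both halves of [D] have interior points, and the segment joining two of them meets the wall
    inside all old half-spaces. *)
Lemma cut_wall_point : exists mu,
  (forall j, lam j < pairing mu (X j)) /\ pairing mu Z = c.
Proof.
have [p [pX pZ]] := cut_interior_point.
have [q [qX qZ]] : exists mu,
    (forall j, lam j < pairing mu (X j)) /\ pairing mu Z < c.
  have X20 (j : option J) : oapp X (- Z) j != 0.
    by case: j => [j|] /=; [exact: (X10 (Some j))|rewrite oppr_eq0].
  have [|mu h] := has_dim_interior X20 (lam := fun j : option J => oapp lam (- c) j).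
    suff <- : D `&` [set mu | pairing mu Z <= c] =
      halfspaces (oapp X (- Z)) (oapp lam (- c)) by [].
    case: qD => DE _ _; rewrite DE; apply/seteqP; split=> mu /= h.
      by case: h => h1 h2 [j|] /=; [exact: h1|rewrite pairingNr lerN2].
    by split; [move=> j; exact: (h (Some j))
              |have := h None; rewrite /= pairingNr lerN2].
  by exists mu; split=> [j|]; [exact: (h (Some j))
    |have := h None; rewrite /= pairingNr ltrN2].
set u := pairing p Z - c; set w := c - pairing q Z.
have u0 : 0 < u by rewrite subr_gt0.
have w0 : 0 < w by rewrite subr_gt0.
have uw : 0 < u + w by rewrite addr_gt0.
exists ((u + w)^-1 *: (w *: p + u *: q)); split=> [j|].
  rewrite -subr_gt0 (_ : _ - _ = (u + w)^-1 * (w * (pairing p (X j) - lam j) +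
    u * (pairing q (X j) - lam j))).
    by rewrite mulr_gt0 ?invr_gt0// addr_gt0// mulr_gt0// subr_gt0.
  by rewrite !(pairingZl, pairingDl); field; exact: lt0r_neq0.
rewrite !(pairingZl, pairingDl).
have -> : pairing p Z = u + c by rewrite subrK.
have -> : pairing q Z = c - w by rewrite /w; ring.
by field; exact: lt0r_neq0.
Qed.

Lemma cut_quasirational :
  quasirational Q P (cut_normal P X lam Z) (cut_const P X lam c).
Proof.
have [DE QX [fD injD _]] := qD.
have [p [pX pZ]] := cut_interior_point; have [q [qX qZ]] := cut_wall_point.
have Pq : P q by apply: P1e; case=> [j|] /=; [exact: ltW|rewrite qZ].
have DP mu : P mu -> D mu by rewrite PE => -[].
split=> [|[j|]|]; [|exact: QX|by []|split].
- apply/seteqP; split=> [mu Pmu [j|]|mu h] /=.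
  + exact: (P1i (Some (val j)) Pmu).
  + exact: (P1i None Pmu).
  apply: P1e; apply: facets_irredundant => //; rewrite -P1//.
  case=> [j /= fj|_]; last exact: (h None).
  by apply: (h (Some (exist _ j _))); apply/asboolP.
- move=> [[j /asboolP//]|] _ /=.
  apply: (@facet_of_point _ _ _ _ _ q) => //; first by rewrite PE => ? [].
  move=> v vZ.
  have [j _|e e0 eP] := @small_perturbation _ J predT (fun j => pairing q (X j) - lam j)
    (fun j => pairing v (X j)); first by rewrite subr_gt0.
  exists e => //; apply: P1e => -[j|] /=; rewrite pairingDl pairingZl.
    by have := eP j e; rewrite gtr0_norm// lexx => /(_ erefl erefl); lra.
  by rewrite vZ mulr0 addr0 qZ.
(* The wall point [q] lies on the new facet and on no old hyperplane, so the new facet differs from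
   all old ones. *)
- have NS j : P `&` [set mu | pairing mu Z = c] <>
      P `&` [set mu | pairing mu (X j) = lam j].
    move=> e; have : (P `&` [set mu | pairing mu Z = c]) q by [].
    by rewrite e => -[_ /= qj]; have := qX j; rewrite qj ltxx.
  move=> [[j jP]|] [[k kP]|] _ _ //= FE; last 2 first.
  + by have := NS j; rewrite FE.
  + by have := NS k.
  suff jk : j = k by move: kP; rewrite -jk => kP; congr (Some (exist _ _ _)); exact: bool_irrelevance.
  (* Two indices with the same facet of [P] have proportional equations, hence the same facet of
     [D], where normals and facets are in bijection. *)
  have [_ [l nl dF]] := asboolP _ jP.
  have [|||a [aE laE]] := @has_dim_hyperplane _ _ l _ (X j) (X k) (lam j) (lam k) nl dF.
  - exact: (X10 (Some j)).
  - by move=> ? [].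
  - by rewrite FE => ? [].
  apply: injD; rewrite ?inE//; apply/seteqP; split=> mu [Dmu /= h]; split=> //=.
    by rewrite aE laE pairingZr h.
  have a0 : a != 0.
    by apply/eqP => a0; have := X10 (Some k); rewrite /= aE a0 scale0r eqxx.
  by apply: (mulfI a0); rewrite -laE -h aE pairingZr.
- move=> F fF; have [|||j jE] := @facet_halfspaces _ _ _ X1 lam1 F.
  + exact: X10.
  + by rewrite -P1.
  + by rewrite -P1.
  rewrite -P1 in jE; case: j jE => [j|] jE; last by exists None.
  have fj : facet P (P `&` [set mu | pairing mu (X j) = lam j]) by rewrite -jE.
  by exists (Some (exist _ j (asboolT fj))).
Qed.

(* Moving from [mu] by a small multiple of [v] or [- v] stays in [P], whereas the
   constraint [j] is tight at [mu]. *)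
Lemma cut_redundant_span mu j : P mu -> pairing mu (X j) = lam j ->
  forall v, (forall k, k \in active (cut_normal P X lam Z) (cut_const P X lam c) mu ->
    pairing v (cut_normal P X lam Z k) = 0) -> pairing v (X j) = 0.
Proof.
move=> Pmu muj v v0.
have [PE' _ _] := cut_quasirational; rewrite PE' in Pmu.
have [e e0 eP] := halfspaces_perturbation Pmu v0.
have h t : `|t| <= e -> 0 <= t * pairing v (X j).
  move=> /eP; rewrite -PE' => /(P1i (Some j)) /=.
  by rewrite pairingDl pairingZl muj lerDl.
have h1 := h e; have h2 := h (- e).
rewrite normrN gtr0_norm// lexx in h1 h2.
have : e * pairing v (X j) == 0.
  by rewrite eq_le h1// andbT; have := h2 erefl; rewrite mulNr oppr_ge0.
by rewrite mulf_eq0 gt_eqF//= => /eqP.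
Qed.

End CutPolyhedron.

(** * Topology of quotients, products and subspaces *)

Section Quotients.
Variables (T : topologicalType) (r : T -> T -> Prop).

Lemma cls_eqP x y : cls r x = cls r y <-> eqv_gen r x y.
Proof.
split=> [xy|xy].
  have h := rep_cls (r := r) x; have h' := rep_cls (r := r) y.
  move=> e e1 e2 e3 e4; apply: (e3) (h e e1 e2 e3 e4) _.
  by rewrite xy; apply: (e2); exact: (h' e e1 e2 e3 e4).
by apply/eqquotP/asboolP.
Qed.

Lemma cls_rep q : cls r (rep q) = q.
Proof. by rewrite /cls /rep reprK. Qed.

Lemma cls_continuous : continuous (cls r).
Proof. exact: pi_continuous. Qed.

Lemma quot_continuous (Z : topologicalType) (f : quot_space r -> Z) :
  continuous (f \o cls r) -> continuous f.
Proof. by move=> cf; exact/quotient_continuous. Qed.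

Lemma open_quotE (A : set (quot_space r)) : open (cls r @^-1` A) -> open A.
Proof. by []. Qed.

Hypotheses (rxx : forall x, r x x) (rsym : forall x y, r x y -> r y x).
Hypothesis rtrans : forall x y z, r x y -> r y z -> r x z.

Lemma eqv_genP x y : eqv_gen r x y <-> r x y.
Proof. by split=> [|xy e _ _ _]; [apply; move=> *; eauto|exact]. Qed.

Lemma cls_eq x y : cls r x = cls r y <-> r x y.
Proof. by split=> [/cls_eqP/eqv_genP|/eqv_genP/cls_eqP]. Qed.

Lemma rep_rel x : r x (rep (cls r x)).
Proof. by apply/eqv_genP; exact: rep_cls. Qed.

(** Openness of the quotient by a group action. The group enters only through maps [h] that move
    each point within its class and are continuous at [y]; the preimage of [A] under [h] is then a
    neighbourhood of [y] inside the saturation of [A]. *)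
Lemma cls_open (A : set T) :
  (forall x y, r x y -> exists h : T -> T,
    [/\ {for y, continuous h}, h y = x & forall t, r t (h t)]) ->
  open A -> open (cls r @` A).
Proof.
move=> hom oA; apply: open_quotE; rewrite openE => y [x Ax /cls_eq xy].
have [h [ch hy rh]] := hom _ _ xy.
have : nbhs (h y) A by rewrite hy; exact: open_nbhs_nbhs.
move=> nA; apply: (@filterS _ (nbhs y) _ (h @^-1` A)); last exact: ch.
by move=> t Aht; exists (h t) => //; apply/cls_eq/rsym.
Qed.

End Quotients.

Section Topology.

Lemma cvg_prod_topology (I S : Type) (K : I -> topologicalType)
    (F : set_system S) (f : S -> prod_topology K) (l : prod_topology K) :
  Filter F -> (forall i, (fun s => f s i) @ F --> l i) -> f @ F --> l.
Proof.
move=> FF h; apply/(@cvg_sup _ I (fun i => Topological.class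
  (initial_topology (fun f : (forall i, K i) => f i)))).
move=> i A [_ [[B Bop <-] Bl sBA]].
have nB : nbhs (l i) B by exact: open_nbhs_nbhs.
by apply: (@filterS _ F _ (fun s => B (f s i))) (h i _ nB) => s; exact: sBA.
Qed.

Lemma proj_continuous_at (I : eqType) (K : I -> topologicalType) i :
  continuous (fun f : prod_topology K => f i).
Proof. exact: proj_continuous. Qed.

Lemma cvg_mx (T : topologicalType) m k (S : Type) (F : set_system S)
    (f : S -> 'M[T]_(m, k)) (l : 'M[T]_(m, k)) : Filter F ->
  (forall i j, (fun s => f s i j) @ F --> l i j) -> f @ F --> l.
Proof.
move=> FF h A [P lP sPA]; rewrite nbhs_simpl /=.
have : \forall s \near F, forall ij : 'I_m * 'I_k, P ij.1 ij.2 (f s ij.1 ij.2).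
  by apply: filter_forall => -[i j]; exact: (h i j _ (lP i j)).
by apply: filterS => s Ps; apply: sPA => i j; exact: (Ps (i, j)).
Qed.

Section CvgPair.
Variables (S : Type) (T U : topologicalType) (F : set_system S).
Context {FF : Filter F}.

Lemma cvg_pr (f : S -> T) (g : S -> U) (a : T) (b : U) : f @ F --> a -> g @ F --> b ->
  (fun s => (f s, g s)) @ F --> (a, b).
Proof.
move=> fa gb A [[B C] /= [nB nC] sA]; rewrite nbhs_simpl /=.
have h1 := fa _ nB; have h2 := gb _ nC; rewrite /= nbhs_simpl /= in h1 h2.
by apply: filterS2 h1 h2 => s Bs Cs; apply: sA.
Qed.

Lemma cvg_pr1 (f : S -> T * U) (p : T * U) : f @ F --> p -> (fun s => (f s).1) @ F --> p.1.
Proof.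
by move=> fp A nA; apply: (fp (fst @^-1` A)); exists (A, setT) => [|q []//];
  split=> //; exact: filterT.
Qed.

Lemma cvg_pr2 (f : S -> T * U) (p : T * U) : f @ F --> p -> (fun s => (f s).2) @ F --> p.2.
Proof.
by move=> fp A nA; apply: (fp (snd @^-1` A)); exists (setT, A) => [|q []//];
  split=> //; exact: filterT.
Qed.

End CvgPair.

Definition mk_sub (T : Type) (A : set T) x (Ax : A x) : A :=
  exist (fun x => x \in A) x (mem_set Ax).

(** Passing to an arbitrary filter that converges to [s] lets the convergence lemmas below, all
    stated for any filter, be chained. *)
Lemma for_cvg (S T : topologicalType) (f : S -> T) s :
  (forall F : set_system S, Filter F -> (fun t => t) @ F --> s -> f @ F --> f s) ->
  {for s, continuous f}.
Proof. by move=> /(_ (nbhs s) (nbhs_filter s)); apply; exact: cvg_id. Qed.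

Section Subtype.
Variables (T S : topologicalType) (A : set T).

Lemma val_continuous : continuous (val : A -> T).
Proof. exact: initial_continuous. Qed.

Lemma cvg_sval (S' : Type) (F : set_system S') (f : S' -> A) (s : A) :
  Filter F -> f @ F --> s -> (fun t => val (f t)) @ F --> val s.
Proof. by move=> FF fs; apply: cvg_comp fs _; exact: val_continuous. Qed.

Lemma sub_continuous_at (f : S -> A) s :
  {for s, continuous (fun s => val (f s))} -> {for s, continuous f}.
Proof.
move=> cf U [_ [[W oW <-]] Wsfz sWU]; apply: filterS sWU _; apply: cf.
exact: open_nbhs_nbhs.
Qed.

Lemma open_sub (U : set A) : open U <-> exists2 V, open V & U = val @^-1` V.
Proof. by split=> [[V oV <-]|[V oV ->]]; exists V. Qed.

Lemma nbhs_sub (x : A) (U : set A) :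
  nbhs x U <-> exists2 V, nbhs (val x) V & val @^-1` V `<=` U.
Proof.
split=> [[_ [[W oW <-]] Wx sWU]|[V nV sVU]].
  by exists W => //; exact: open_nbhs_nbhs.
by apply: filterS sVU _; exact: val_continuous.
Qed.

End Subtype.

End Topology.

(** * Complex numbers and arguments *)

Section ComplexTopology.
Variable R : realType.
Implicit Types (z w : R[i]^o) (x y : R).
Local Notation Re := (@complex.Re R).
Local Notation Im := (@complex.Im R).

Lemma complex_eq z w : Re z = Re w -> Im z = Im w -> z = w.
Proof. by case: z w => [a b] [c d] /= -> ->. Qed.

Lemma normc_ge_Im z : (`|Im z|%:C <= `|z|)%C.
Proof.
by case: z => a b; rewrite normc_def lecR -sqrtr_sqr ler_wsqrtr// lerDr sqr_ge0.
Qed.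

Section Cvg.
Variables (S : Type) (F : set_system S).
Context {FF : Filter F}.
Implicit Types f g : S -> R[i]^o.

Lemma cvg_Re f z : f @ F --> z -> (fun s => Re (f s) : R^o) @ F --> (Re z : R^o).
Proof.
move=> /cvgrPdist_lt fz; apply/cvgrPdist_lt => e e0.
have e0' : (0 : R[i]) < (e%:C)%C by rewrite ltcR.
near=> s; rewrite -ltcR.
apply: le_lt_trans (_ : `|z - f s| < _).
  by have := normc_ge_Re (z - f s); case: (z) (f s) => [a b] [c d].
by near: s; exact: fz.
Unshelve. all: by end_near. Qed.

Lemma cvg_Im f z : f @ F --> z -> (fun s => Im (f s) : R^o) @ F --> (Im z : R^o).
Proof.
move=> /cvgrPdist_lt fz; apply/cvgrPdist_lt => e e0.
have e0' : (0 : R[i]) < (e%:C)%C by rewrite ltcR.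
near=> s; rewrite -ltcR.
apply: le_lt_trans (_ : `|z - f s| < _).
  by have := normc_ge_Im (z - f s); case: (z) (f s) => [a b] [c d].
by near: s; exact: fz.
Unshelve. all: by end_near. Qed.

Lemma cvg_complex f z :
  (fun s => Re (f s) : R^o) @ F --> (Re z : R^o) ->
  (fun s => Im (f s) : R^o) @ F --> (Im z : R^o) -> f @ F --> z.
Proof.
move=> /cvgrPdist_lt hr /cvgrPdist_lt hi; apply/cvgrPdist_lt => e.
(* Positivity in [R[i]] means that [e] is real and positive. *)
rewrite ltcE/= => /andP[/eqP ei er].
have e2 : 0 < Re e / 2 by rewrite divr_gt0.
have -> : e = ((Re e)%:C)%C by case: e ei {er e2} => a b /= ->.
near=> s.
have h1 : `|Re z - Re (f s)| < Re e / 2 by near: s; exact: hr.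
have h2 : `|Im z - Im (f s)| < Re e / 2 by near: s; exact: hi.
rewrite normc_def ltcR.
have -> : Re (z - f s) = Re z - Re (f s) by case: (z) (f s) => [a b] [c d].
have -> : Im (z - f s) = Im z - Im (f s) by case: (z) (f s) => [a b] [c d].
set a := Re z - _ in h1 *; set b := Im z - _ in h2 *.
rewrite [ltRHS](_ : _ = Num.sqrt (Re e ^+ 2)); last by rewrite sqrtr_sqr gtr0_norm.
rewrite ltr_sqrt ?exprn_gt0//.
rewrite -(real_normK (num_real a)) -(real_normK (num_real b)).
have := normr_ge0 a; have := normr_ge0 b; nra.
Unshelve. all: by end_near. Qed.

Lemma cvg_cstc z : (fun=> z : R[i]^o) @ F --> z.
Proof. by apply: cvg_complex; exact: cvg_cst. Qed.

Lemma Re_mul z w : Re (z * w) = Re z * Re w - Im z * Im w.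
Proof. by case: z w => [a b] [c d]. Qed.

Lemma Im_mul z w : Im (z * w) = Re z * Im w + Im z * Re w.
Proof. by case: z w => [a b] [c d]. Qed.

Lemma cvg_mulc f g z w :
  f @ F --> z -> g @ F --> w -> (fun s => f s * g s) @ F --> z * w.
Proof.
move=> fz gw; have fr := cvg_Re fz; have fi := cvg_Im fz.
have gr := cvg_Re gw; have gi := cvg_Im gw; apply: cvg_complex.
  rewrite Re_mul; under eq_fun do rewrite Re_mul.
  by apply: cvgB; apply: cvgM.
rewrite Im_mul; under eq_fun do rewrite Im_mul.
by apply: cvgD; apply: cvgM.
Qed.

Lemma cvg_sqmod f z :
  f @ F --> z -> (fun s => sqmod (f s) : R^o) @ F --> (sqmod z : R^o).
Proof.
move=> fz; have fr := cvg_Re fz; have fi := cvg_Im fz.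
by rewrite /sqmod; apply: cvgD;
  rewrite expr2; under eq_fun do rewrite expr2; apply: cvgM.
Qed.

Lemma cvg_expi (f : S -> R^o) x :
  f @ F --> (x : R^o) -> (fun s => expi (f s)) @ F --> expi x.
Proof.
move=> fx; have c2 : (fun s => 2 * pi * f s : R^o) @ F --> (2 * pi * x : R^o).
  by apply: cvgM => //; exact: cvg_cst.
by apply: cvg_complex => /=; apply: cvg_comp c2 _;
  [exact: continuous_cos|exact: continuous_sin].
Qed.

Lemma cvg_realc (f : S -> R^o) x : f @ F --> (x : R^o) ->
  (fun s => ((f s)%:C)%C : R[i]^o) @ F --> ((x%:C)%C : R[i]^o).
Proof. by move=> fx; apply: cvg_complex => //=; exact: cvg_cst. Qed.

Lemma cvg_sqrt (f : S -> R^o) (x : R^o) : f @ F --> x ->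
  (fun s => Num.sqrt (f s) : R^o) @ F --> (Num.sqrt x : R^o).
Proof. by move=> fz; apply: cvg_comp fz _; exact: sqrt_continuous. Qed.

End Cvg.

Lemma sqmodM z w : sqmod (z * w) = sqmod z * sqmod w.
Proof. by rewrite /sqmod Re_mul Im_mul; ring. Qed.

Lemma sqmod_ge0 z : 0 <= sqmod z.
Proof. by rewrite addr_ge0 ?sqr_ge0. Qed.

Lemma sqmod_eq0 z : (sqmod z == 0) = (z == 0).
Proof.
rewrite paddr_eq0 ?sqr_ge0// !sqrf_eq0; case: z => a b.
by apply/andP/eqP => /= [[/eqP -> /eqP ->]|[-> ->]]; rewrite ?eqxx.
Qed.

Lemma sqmod_gt0 z : (0 < sqmod z) = (z != 0).
Proof. by rewrite lt_def sqmod_ge0 andbT sqmod_eq0. Qed.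

Lemma sqmod_real x : sqmod (x%:C)%C = x ^+ 2.
Proof. by rewrite /sqmod /= expr0n addr0. Qed.

Lemma sqmod0 : sqmod (0 : R[i]^o) = 0.
Proof. by rewrite /sqmod /= expr0n addr0. Qed.

Lemma expiD x y : expi (x + y) = expi x * expi y.
Proof.
by apply: complex_eq; rewrite ?Re_mul ?Im_mul /= mulrDr ?cosD ?sinD; ring.
Qed.

Lemma expi0 : expi 0 = 1 :> R[i]^o.
Proof. by apply: complex_eq; rewrite /= mulr0 ?cos0 ?sin0. Qed.

Lemma expiNK x z : expi (- x) * (expi x * z) = z.
Proof. by rewrite mulrA -expiD addNr expi0 mul1r. Qed.

Lemma expiKN x z : expi x * (expi (- x) * z) = z.
Proof. by rewrite mulrA -expiD subrr expi0 mul1r. Qed.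

Lemma sqmod_expi1 x : sqmod (expi x) = 1.
Proof. by rewrite /sqmod /= cos2Dsin2. Qed.

Lemma expi_neq0 x : expi x != 0.
Proof. by rewrite -sqmod_eq0 sqmod_expi1 oner_eq0. Qed.

Lemma expi_nat (k : nat) : expi k%:R = 1 :> R[i]^o.
Proof.
elim: k => [|k IH]; first exact: expi0.
rewrite -natr1 expiD IH mul1r; apply: complex_eq; rewrite /= mulr1 mulr_natl.
  exact: cos2pi.
exact: sin2pi.
Qed.

Lemma expi_int (k : int) : expi k%:~R = 1 :> R[i]^o.
Proof.
case: (intP k) => [|m|m]; [exact: expi0|exact: expi_nat|].
by rewrite -[LHS]mulr1 -[X in _ * X](expi_nat m.+1) -expiD rmorphN/= addNr expi0.
Qed.

Lemma two_pi_gt0 : 0 < 2 * pi :> R.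
Proof. by rewrite mulr_gt0// pi_gt0. Qed.

(** After subtraction of the integer part, [cos] is injective on the first half of the period, and
    the second half is reflected into the first. *)
Lemma expi_eq1 x : expi x = 1 -> exists k : int, x = k%:~R.
Proof.
move=> ex; exists (Num.floor x); set k := Num.floor x.
have /andP[kx xk] := floor_itv x; rewrite -/k in kx xk.
have : expi (x - k%:~R) = 1 by rewrite expiD ex mul1r -rmorphN expi_int.
set f := x - _ => -[cf _]; rewrite intrD in xk.
have f0 : 0 <= f by rewrite subr_ge0.
have f1 : f < 1 by rewrite /f; lra.
suff : f = 0 by move=> /eqP; rewrite subr_eq0 => /eqP.
have p0 := pi_gt0 R.
have [f2|f2] := lerP f (1/2).
  have : 2 * pi * f = 0.
    apply: cos_inj; rewrite ?in_itv/= ?lexx ?cos0//; last exact: ltW.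
    by rewrite mulr_ge0// ?mulr_ge0 ?(ltW p0)//=; nra.
  by move=> /eqP; rewrite mulf_eq0 gt_eqF ?two_pi_gt0//= => /eqP.
have : pi *+ 2 - 2 * pi * f = 0.
  apply: cos_inj; rewrite ?in_itv/= ?lexx ?cos0//; last 2 first.
  - exact: ltW.
  - by rewrite -addrC cosD2pi cosN cf.
  by rewrite -mulr_natl; nra.
by rewrite -mulr_natl; nra.
Qed.

Lemma polar z : exists t, z = ((Num.sqrt (sqmod z))%:C)%C * expi t.
Proof.
have [->|z0] := eqVneq z 0; first by exists 0; rewrite sqmod0 sqrtr0 mul0r.
have s0 : 0 < sqmod z by rewrite sqmod_gt0.
set r := Num.sqrt _; have r0 : 0 < r by rewrite sqrtr_gt0.
have r2 : r ^+ 2 = Re z ^+ 2 + Im z ^+ 2 by rewrite sqr_sqrtr// ltW.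
set a := Re z / r; set b := Im z / r.
have ab : a ^+ 2 + b ^+ 2 = 1.
  by rewrite !expr_div_n -mulrDl -r2 divff// expf_neq0// gt_eqF.
have a1 : -1 <= a <= 1 by nra.
have aE : Re z = r * a by rewrite mulrC divfK// gt_eqF.
have bE : Im z = r * b by rewrite mulrC divfK// gt_eqF.
have p2 := two_pi_gt0.
have ca : cos (acos a) = a by apply: acosK; rewrite in_itv/=.
have sa : sin (acos a) = `|b|.
  by rewrite sin_acos// -sqrtr_sqr; congr Num.sqrt; lra.
(* [acos] returns the angle in the upper half-plane; its sign is corrected by that of the imaginary
   part. *)
exists ((if 0 <= b then acos a else - acos a) / (2 * pi)).
set th := _ / _; have thE : 2 * pi * th = if 0 <= b then acos a else - acos a.
  by rewrite mulrC divfK// gt_eqF.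
apply: complex_eq; rewrite ?Re_mul ?Im_mul /= thE mul0r ?subr0 ?addr0.
  by case: ifP; rewrite ?cosN ca.
case: ifP => b0; rewrite ?sinN sa bE; first by rewrite ger0_norm.
by rewrite ltr0_norm ?opprK// ltNge b0.
Qed.

(** The branch of the argument, measured in turns, on the open half-plane centred at the direction
    [expi t0]. Its values lie within a quarter turn of [t0], which is the origin of the constant
    [4^-1] below. *)
Definition thloc (t0 : R) z : R :=
  t0 + atan (Im (z * expi (- t0)) / Re (z * expi (- t0))) / (2 * pi).

Lemma thlocE t0 z : 0 < Re (z * expi (- t0)) ->
  z = ((Num.sqrt (sqmod z))%:C)%C * expi (thloc t0 z).
Proof.
set w := z * expi (- t0) => a0.
have zE : z = w * expi t0 by rewrite /w -mulrA -expiD addNr expi0 mulr1.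
have -> : sqmod z = sqmod w by rewrite /w sqmodM sqmod_expi1 mulr1.
rewrite /thloc -/w expiD mulrCA mulrC {1}zE; congr (_ * _).
move: w a0 {zE} => w a0.
set u := Im w / Re w.
have p2 : 2 * pi != 0 :> R by rewrite gt_eqF// two_pi_gt0.
have u2 : 0 < 1 + u ^+ 2 by rewrite ltr_pwDl// sqr_ge0.
have s0 : 0 < Num.sqrt (1 + u ^+ 2) by rewrite sqrtr_gt0.
have rE : Num.sqrt (sqmod w) = Re w * Num.sqrt (1 + u ^+ 2).
  rewrite -[Re w in RHS]gtr0_norm// -sqrtr_sqr -sqrtrM ?sqr_ge0//; congr Num.sqrt.
  by rewrite /u /sqmod; field; exact: lt0r_neq0.
have cE : cos (atan u) = (Num.sqrt (1 + u ^+ 2))^-1 by exact: cos_atan.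
have sE : sin (atan u) = u * (Num.sqrt (1 + u ^+ 2))^-1.
  rewrite -cE -{2}[u]atanK /tan divfK// cE invr_eq0 gt_eqF//.
have aE : 2 * pi * (atan u / (2 * pi)) = atan u by rewrite mulrC divfK.
apply: complex_eq; rewrite ?Re_mul ?Im_mul /= aE mul0r ?subr0 ?addr0 rE ?cE ?sE.
  by rewrite -mulrA divff ?mulr1// gt_eqF.
by rewrite /u; field; rewrite !gt_eqF.
Qed.

Lemma thloc_unique t0 t r : 0 < r -> `|t - t0| < 4^-1 ->
  thloc t0 ((r%:C)%C * expi t) = t.
Proof.
move=> r0 tt; rewrite /thloc -mulrA -expiD !Re_mul !Im_mul /= !mul0r subr0 addr0.
set x := 2 * pi * (t - t0).
rewrite -[_ / (r * _)](_ : tan x = _); last first.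
  rewrite /tan invfM mulrACA divff ?mul1r// gt_eqF//.
have p0 := pi_gt0 R.
rewrite tanK; first by rewrite /x mulrAC divff ?mul1r ?subrKC// gt_eqF// two_pi_gt0.
rewrite in_itv/= -ltr_norml /x normrM gtr0_norm ?two_pi_gt0//.
by have := normr_ge0 (t - t0); nra.
Qed.

Lemma Re_expi_gt0 t0 t r : 0 < r -> `|t - t0| < 4^-1 ->
  0 < Re (((r%:C)%C * expi t : R[i]^o) * expi (- t0)).
Proof.
move=> r0 tt; rewrite -mulrA -expiD Re_mul /= mul0r subr0 mulr_gt0//.
have p0 := pi_gt0 R.
apply: cos_gt0_pihalf; rewrite -ltr_norml normrM gtr0_norm ?two_pi_gt0//.
by have := normr_ge0 (t - t0); nra.
Qed.

(** A positive cosine puts [t - t0] within a quarter turn of an integer; this integer later names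
    the sheet of a covering. *)
Lemma Re_expi_near t0 t r : 0 < r ->
  0 < Re (((r%:C)%C * expi t : R[i]^o) * expi (- t0)) ->
  exists k : int, `|t - t0 - k%:~R| < 4^-1.
Proof.
move=> r0; rewrite -mulrA -expiD Re_mul /= mul0r subr0 pmulr_rgt0//.
set y := t - t0 => cy; exists (Num.floor (y + 1/2)); move: cy; set k := Num.floor _.
have /andP[ky yk] := floor_itv (y + 1/2); rewrite -/k ?intrD in ky yk.
have -> : cos (2 * pi * y) = cos (2 * pi * (y - k%:~R)).
  by have := congr1 Re (expiD (y - k%:~R) k%:~R); rewrite expi_int mulr1 subrK.
rewrite -cos_norm normrM (gtr0_norm two_pi_gt0).
set f := y - k%:~R => cf; rewrite ltNge; apply/negP => f4.
have p0 := pi_gt0 R.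
have f2 : `|f| <= 1/2 by rewrite ler_norml /f; apply/andP; split; lra.
suff : cos (2 * pi * `|f|) <= cos (pi / 2) by rewrite cos_pihalf leNgt cf.
rewrite leNgt ltr_cos ?in_itv/= -?leNgt; first nra.
  by apply/andP; split; nra.
by apply/andP; split; lra.
Qed.

Lemma cvg_thloc (S : Type) (F : set_system S) (f : S -> R[i]^o) t0 z :
  Filter F -> 0 < Re (z * expi (- t0)) -> f @ F --> z ->
  (fun s => thloc t0 (f s) : R^o) @ F --> (thloc t0 z : R^o).
Proof.
move=> FF a0 fz; rewrite /thloc.
have c : (fun s => f s * expi (- t0)) @ F --> z * expi (- t0).
  by apply: cvg_mulc; [exact: fz|exact: cvg_cstc].
apply: cvgD; first exact: cvg_cst.
apply: cvgM; last exact: cvg_cst.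
have /(_ FF) ci := cvg_Im c; have /(_ FF) cr := cvg_Re c.
have cq : (fun s => Im (f s * expi (- t0)) / Re (f s * expi (- t0)) : R^o) @ F -->
    (Im (z * expi (- t0)) / Re (z * expi (- t0)) : R^o).
  by apply: cvgM ci (cvgV _ cr); rewrite gt_eqF.
by apply: cvg_comp cq _; exact: continuous_atan.
Qed.

End ComplexTopology.

(** * Smooth functions *)

Section Differential.
Variables (R : realType) (U V : normedModType R).

Lemma diff_near_eq (f g : U -> V) x :
  (\forall y \near x, f y = g y) -> differentiable f x ->
  differentiable g x /\ 'd g x = 'd f x :> (U -> V).
Proof.
move=> fg df; have [cf ef] := (diff_locallyP _ _).1 df.
have gx : g x = f x by rewrite (nbhs_singleton fg).
have eg : g \o shift x = cst (g x) + 'd f x +o_ 0 id.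
  apply/eqaddoP => e e0; move/eqaddoP: ef => /(_ e e0).
  have : \forall h \near 0, f (h + x) = g (h + x).
    have : (fun h : U => h + x) @ (0 : U) --> x.
      by rewrite -[X in _ --> X]add0r; apply: cvgD; [exact: cvg_id|exact: cvg_cst].
    by move=> /(_ _ fg).
  apply: filterS2 => h /= fgh.
  by rewrite gx /= !fctE /= fgh.
have dg := diff_unique cf eg; split; last exact: dg.
by apply/diff_locallyP; rewrite dg; split; [exact: cf|exact: eg].
Qed.

End Differential.

Section DifferentialReal.
Variables (R : realType) (U : normedModType R).
Implicit Types (f g : U -> R^o) (x u : U).

Lemma diffM_val f g x u : differentiable f x -> differentiable g x ->
  'd (fun y => f y * g y : R^o) x u = f x * 'd g x u + g x * 'd f x u.
Proof. by move=> df dg; exact: (congr1 (fun h : U -> R^o => h u) (diffM df dg)). Qed.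

Lemma diffD_val (V : normedModType R) (f g : U -> V) x u :
  differentiable f x -> differentiable g x ->
  'd (fun y => f y + g y) x u = 'd f x u + 'd g x u.
Proof. by move=> df dg; exact: (congr1 (fun h : U -> V => h u) (diffD df dg)). Qed.

Lemma diffB_val (V : normedModType R) (f g : U -> V) x u :
  differentiable f x -> differentiable g x ->
  'd (fun y => f y - g y) x u = 'd f x u - 'd g x u.
Proof. by move=> df dg; exact: (congr1 (fun h : U -> V => h u) (diffB df dg)). Qed.

Lemma diff_cst_val (V : normedModType R) (c : V) x u : 'd (fun _ : U => c) x u = 0.
Proof. exact: (congr1 (fun h : U -> V => h u) (diff_cst (V := U) c x)). Qed.

Lemma diff_comp_val (V W : normedModType R) (f : U -> V) (g : V -> W) x u :
  differentiable f x -> differentiable g (f x) ->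
  'd (fun y => g (f y)) x u = 'd g (f x) ('d f x u).
Proof. by move=> df dg; exact: (congr1 (fun h : U -> W => h u) (diff_comp df dg)). Qed.

Lemma diff_scalar (phi : R^o -> R^o) (t d : R) : is_derive (t : R^o) 1 phi d ->
  differentiable phi t /\ forall h, 'd phi t h = h * d.
Proof.
move=> dphi; have df : differentiable phi t by apply/derivable1_diffP.
by split=> // h; rewrite diff1E// derive1E derive_val.
Qed.

Lemma diff_comp_scalar (phi : R^o -> R^o) f (d : R) x :
  differentiable f x -> is_derive (f x : R^o) 1 phi d ->
  differentiable (fun y => phi (f y) : R^o) x /\
  forall u, 'd (fun y => phi (f y) : R^o) x u = 'd f x u * d.
Proof.
move=> df /diff_scalar[dphi dE]; split; first exact: differentiable_comp.
by move=> u; rewrite (diff_comp_val u df dphi) dE.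
Qed.

Lemma diff_linear (V : normedModType R) (f : U -> V) x u :
  linear f -> continuous f -> differentiable f x /\ 'd f x u = f u.
Proof.
move=> lf cf; pose mf := GRing.isLinear.Build _ _ _ _ _ lf.
pose fl : {linear U -> V} := HB.pack f mf.
have cfl : continuous fl by [].
split; first exact: (@linear_differentiable _ _ _ fl x cfl).
exact: (congr1 (fun h : U -> V => h u) (diff_lin x cfl)).
Qed.

Lemma diff_sum_val (I : finType) (f : I -> U -> R^o) x :
  (forall i, differentiable (f i) x) ->
  differentiable (fun y => \sum_i f i y : R^o) x /\
  forall u, 'd (fun y => \sum_i f i y : R^o) x u = \sum_i 'd (f i) x u.
Proof.
move=> df; pose D := fun (s : seq I) => differentiable (fun y => \sum_(i <- s) f i y : R^o) x /\
  forall u, 'd (fun y => \sum_(i <- s) f i y : R^o) x u = \sum_(i <- s) 'd (f i) x u.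
suff : D (index_enum I) by [].
elim: (index_enum I) => [|i s [ds es]].
  split=> [|u]; last by under eq_fun do rewrite big_nil; rewrite big_nil diff_cst_val.
  by under eq_fun do rewrite big_nil; exact: differentiable_cst.
split=> [|u]; under eq_fun do rewrite big_cons.
  by apply: differentiableD; [exact: df|exact: ds].
by rewrite (diffD_val u (df i) ds) es big_cons.
Qed.

End DifferentialReal.

Lemma coord_linear (R : realType) m (j : 'I_m) :
  linear (fun v : 'rV[R]_m => v 0 j : R^o).
Proof. by move=> a u v; rewrite !mxE. Qed.

Lemma coord_cont (R : realType) m (j : 'I_m) :
  continuous (fun v : 'rV[R]_m => v 0 j : R^o).
Proof. exact: coord_continuous. Qed.

Lemma diff_coord (R : realType) (U : normedModType R) m (f : U -> 'rV[R]_m) x j u :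
  differentiable f x ->
  ('d f x u) 0 j = 'd (fun y => f y 0 j : R^o) x u.
Proof.
move=> df; have [dc dE] := diff_linear (f x) ('d f x u) (@coord_linear R m j) (@coord_cont R m j).
by rewrite (diff_comp_val u df dc) dE.
Qed.

Section Ck.
Variables (R : realType) (U : normedModType R) (W : set U).
Hypothesis oW : open W.

(** [Ck] speaks of differentials of functions defined everywhere, whereas the formulas for these
    differentials hold on [W] only. Openness of [W] lets a formula valid on [W] replace the
    differential at every order. *)
Lemma Ck_eq (V : normedModType R) k (f g : U -> V) :
  (forall x, W x -> f x = g x) -> Ck k W f -> Ck k W g.
Proof.
have near_eq f' g' x : (forall x, W x -> f' x = g' x :> V) -> W x ->
    \forall y \near x, f' y = g' y.
  move=> fg Wx; have : nbhs x W by exact: open_nbhs_nbhs.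
  by apply: filterS => y; exact: fg.
elim: k f g => [|k IH] f g fg.
  move=> cf x Wx; have fgx := near_eq f g x fg Wx.
  rewrite /prop_for /continuous_at -(fg _ Wx); apply: cvg_trans (cf x Wx).
  by apply: near_eq_cvg; apply: filterS fgx => y ->.
move=> [df cf]; split=> [x Wx|u].
  by have [] := diff_near_eq (near_eq f g x fg Wx) (df _ Wx).
apply: IH (cf u) => x Wx.
by have [_ ->] := diff_near_eq (near_eq f g x fg Wx) (df _ Wx).
Qed.

Lemma CkW (V : normedModType R) k (f : U -> V) : Ck k.+1 W f -> Ck k W f.
Proof.
elim: k f => [|k IH] f [df cf].
  by move=> x Wx; apply: differentiable_continuous; exact: df.
by split=> // u; apply: IH; exact: cf.
Qed.

Lemma Ck_cst (V : normedModType R) k (c : V) : Ck k W (fun=> c).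
Proof.
elim: k c => [|k IH] c; first by move=> x _; exact: cst_continuous.
split=> [x _|u]; first exact: differentiable_cst.
by apply: Ck_eq (IH 0) => x _; rewrite diff_cst_val.
Qed.

Lemma CkD (V : normedModType R) k (f g : U -> V) :
  Ck k W f -> Ck k W g -> Ck k W (fun x => f x + g x).
Proof.
elim: k f g => [|k IH] f g; first by move=> cf cg x Wx; apply: cvgD; [exact: cf|exact: cg].
move=> [df cf] [dg cg]; split=> [x Wx|u].
  by apply: differentiableD; [exact: df|exact: dg].
apply: Ck_eq (IH _ _ (cf u) (cg u)) => x Wx.
by rewrite (diffD_val u (df _ Wx) (dg _ Wx)).
Qed.

Lemma CkM k (f g : U -> R^o) :
  Ck k W f -> Ck k W g -> Ck k W (fun x => f x * g x : R^o).
Proof.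
elim: k f g => [|k IH] f g; first by move=> cf cg x Wx; apply: cvgM; [exact: cf|exact: cg].
move=> /[dup] /CkW ckf [df cf] /[dup] /CkW ckg [dg cg]; split=> [x Wx|u].
  by apply: differentiableM; [exact: df|exact: dg].
apply: Ck_eq (CkD (IH _ _ ckf (cg u)) (IH _ _ ckg (cf u))) => x Wx.
by rewrite (diffM_val u (df _ Wx) (dg _ Wx)).
Qed.

Lemma Ck_linear (V : normedModType R) k (f : U -> V) :
  linear f -> continuous f -> Ck k W f.
Proof.
move=> lf cf; case: k => [|k]; first by move=> x _; exact: cf.
split=> [x _|u]; first by have [] := diff_linear x 0 lf cf.
apply: Ck_eq (Ck_cst k (f u)) => x _.
by have [_ ->] := diff_linear x u lf cf.
Qed.

Lemma Ck_sum (V : normedModType R) k (I : Type) (s : seq I) (P : pred I) (f : I -> U -> V) :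
  (forall i, Ck k W (f i)) -> Ck k W (fun x => \sum_(i <- s | P i) f i x).
Proof.
move=> cf; elim: s => [|i s IH].
  by under eq_fun do rewrite big_nil; exact: Ck_cst.
under eq_fun do rewrite big_cons.
by case: (P i) => //; apply: CkD.
Qed.

Lemma Ck_scalel (V : normedModType R) k (f : U -> R^o) (v : V) :
  Ck k W f -> Ck k W (fun x => f x *: v).
Proof.
elim: k f => [|k IH] f; first by move=> cf x Wx; apply: cvgZr_tmp; exact: cf.
move=> [df cf]; split=> [x Wx|u]; first by apply: differentiableZl; exact: df.
apply: Ck_eq (IH _ (cf u)) => x Wx.
by rewrite (congr1 (fun h : U -> V => h u) (diffZl v (df _ Wx))).
Qed.

Lemma Ck_row k m (f : U -> 'rV[R]_m) :
  (forall j, Ck k W (fun x => f x 0 j : R^o)) -> Ck k W f.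
Proof.
move=> cf; apply: (@Ck_eq _ k (fun x => \sum_j f x 0 j *: delta_mx 0 j)).
  by move=> x _; rewrite -row_sum_delta.
by apply: Ck_sum => j; apply: Ck_scalel.
Qed.

End Ck.

Section CkComp.
Variables (R : realType) (U : normedModType R) (W : set U).
Hypothesis oW : open W.

(** With an outer function of one real variable the differential of the composite is a product of
    scalar functions, so [CkM] closes the induction on [k]. *)
Lemma Ck_comp k (D : set R^o) (phi : R^o -> R^o) (f : U -> R^o) :
  open D -> (forall x, W x -> D (f x)) -> Ck k D phi -> Ck k W f ->
  Ck k W (fun x => phi (f x) : R^o).
Proof.
move=> oD WD; elim: k phi f WD => [|k IH] phi f WD.
  by move=> cphi cf x Wx; apply: continuous_comp (cf x Wx) (cphi _ (WD _ Wx)).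
move=> [dphi cphi] /[dup] /CkW ckf [df cf]; split=> [x Wx|u].
  by apply: differentiable_comp; [exact: df|exact: dphi (WD _ Wx)].
apply: Ck_eq (CkM oW (cf u) (IH _ _ WD (cphi 1) ckf)) => // x Wx.
rewrite (diff_comp_val u (df _ Wx) (dphi _ (WD _ Wx))).
by rewrite (diff1E (dphi _ (WD _ Wx))) scale1r.
Qed.

End CkComp.

Section ScalarSmooth.
Variable R : realType.

(** Reduces the smoothness of [phi] to that of a formula for its derivative; for [cos], [sin], the
    inverse, [sqrt] and [atan] this formula is built from functions already under control. *)
Lemma Ck_scalarS k (D : set R^o) (phi dphi : R^o -> R^o) : open D ->
  (forall t, D t -> is_derive t 1 phi (dphi t)) -> Ck k D dphi -> Ck k.+1 D phi.
Proof.
move=> oD dE cd; split=> [t Dt|h]; first by have [] := diff_scalar (dE _ Dt).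
apply: Ck_eq (CkM oD (Ck_cst oD k (h : R^o)) cd) => // t Dt.
by have [_ ->] := diff_scalar (dE _ Dt).
Qed.

Lemma Ck_scalar0 (D : set R^o) (phi : R^o -> R^o) (dphi : R^o -> R^o) :
  (forall t, D t -> is_derive t 1 phi (dphi t)) -> Ck 0 D phi.
Proof.
move=> dE t Dt; apply: differentiable_continuous.
by have [] := diff_scalar (dE _ Dt).
Qed.

Lemma Ck_trig k : Ck k setT (@cos R : R^o -> R^o) /\ Ck k setT (@sin R : R^o -> R^o).
Proof.
elim: k => [|k [IHc IHs]].
  split; first by apply: (@Ck_scalar0 _ _ (fun t => - sin t)) => t _; exact: is_derive_cos.
  by apply: (@Ck_scalar0 _ _ (@cos R)) => t _; exact: is_derive_sin.
split; last by apply: (@Ck_scalarS _ _ _ (@cos R)) => //; exact: openT.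
apply: (@Ck_scalarS _ _ _ (fun t => - sin t)) => //; first exact: openT.
apply: Ck_eq (CkM (@openT _) (Ck_cst (@openT _) k (-1 : R^o)) IHs) => //; first exact: openT.
by move=> t _; rewrite mulN1r.
Qed.

Lemma open_neq0 : open [set t : R^o | t != 0].
Proof.
rewrite (_ : [set t : R^o | t != 0] = ~` [set 0]).
  by apply: closed_openC; exact: closed_eq.
by apply/seteqP; split=> t /= /eqP.
Qed.

Lemma Ck_inv k : Ck k [set t : R^o | t != 0] (GRing.inv : R^o -> R^o).
Proof.
have oD := open_neq0.
have dE (t : R^o) : [set t : R^o | t != 0] t ->
    is_derive t 1 (GRing.inv : R^o -> R^o) ((-1) * (t^-1 * t^-1)).
  move=> /= t0; apply: DeriveDef; first exact: (@derivableV _ _ id).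
  rewrite (@deriveV _ _ id)//; rewrite derive_id mulN1r -exprVn expr2.
  exact: mulr1.
elim: k => [|k IH]; first exact: Ck_scalar0 dE.
by apply: Ck_scalarS dE _ => //; apply: CkM => //; [exact: Ck_cst|apply: CkM].
Qed.

Lemma open_pos : open [set t : R^o | 0 < t].
Proof. exact: open_gt. Qed.

Lemma Ck_sqrt k : Ck k [set t : R^o | 0 < t] (@Num.sqrt R : R^o -> R^o).
Proof.
have oD := open_pos.
have dE (t : R^o) : [set t : R^o | 0 < t] t ->
    is_derive t 1 (@Num.sqrt R : R^o -> R^o) (2 * Num.sqrt t)^-1.
  by move=> /= t0; exact: is_derive1_sqrt.
elim: k => [|k IH]; first exact: Ck_scalar0 dE.
apply: Ck_scalarS dE _ => //; apply: Ck_comp open_neq0 _ (Ck_inv k) _ => //.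
- by move=> x /= x0; rewrite mulf_neq0// gt_eqF// sqrtr_gt0.
- by apply: CkM => //; exact: Ck_cst.
Qed.

Lemma Ck_atan k : Ck k setT (@atan R : R^o -> R^o).
Proof.
have dE (t : R^o) : setT t -> is_derive t 1 (@atan R : R^o -> R^o) (1 + t * t)^-1.
  by move=> _; rewrite -expr2; exact: is_derive1_atan.
case: k => [|k]; first exact: Ck_scalar0 dE.
have oT : open [set: R^o] by exact: openT.
apply: Ck_scalarS dE _ => //; apply: Ck_comp open_neq0 _ (Ck_inv k) _ => //.
- by move=> x _ /=; rewrite gt_eqF// ltr_pwDl// -expr2 sqr_ge0.
- apply: CkD => //; first exact: Ck_cst.
  by apply: CkM => //; apply: Ck_linear => //; move=> ?; exact: cvg_id.
Qed.

End ScalarSmooth.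

(** * Charts at the vertices *)

Section CoordinateSpace.
Variables (R : realType) (m : nat).
Implicit Types (v : 'rV[R]_(m + m)) (f : 'I_m -> R[i]^o).

Lemma cc_of_cc f a : cc (of_cc f) a = f a.
Proof.
by rewrite /cc /of_cc row_mxEl row_mxEr !mxE; case: (f a).
Qed.

Lemma of_cc_cc v : of_cc (cc v) = v.
Proof.
apply/rowP => i; rewrite /of_cc mxE.
by case: splitP => a e; rewrite mxE /=; congr (v _ _); apply: val_inj.
Qed.

Lemma cc_inj v w : (forall a, cc v a = cc w a) -> v = w.
Proof. by move=> h; rewrite -(of_cc_cc v) -(of_cc_cc w); congr of_cc; apply/funext. Qed.

Lemma of_cc_ext f g : (forall a, f a = g a) -> of_cc f = of_cc g.
Proof. by move=> h; congr of_cc; apply/funext. Qed.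

Lemma cvg_of_cc (S : Type) (F : set_system S) (f : S -> 'I_m -> R[i]^o) g :
  Filter F -> (forall a, (fun s => f s a) @ F --> g a) ->
  (fun s => of_cc (f s)) @ F --> of_cc g.
Proof.
move=> FF h; apply: cvg_mx => i j; rewrite /of_cc.
under eq_fun do rewrite mxE; rewrite mxE.
case: splitP => a _; rewrite mxE; under eq_fun do rewrite mxE.
  exact: cvg_Re.
exact: cvg_Im.
Qed.

Lemma cvg_cc (S : Type) (F : set_system S) (f : S -> 'rV[R]_(m + m)) v a :
  Filter F -> f @ F --> v -> (fun s => cc (f s) a) @ F --> cc v a.
Proof.
move=> FF fv; apply: cvg_complex => /=.
  by apply: (cvg_comp _ (fun w : 'rV[R]_(m + m) => w 0 (lshift m a) : R^o) fv); exact: coord_cont.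
by apply: (cvg_comp _ (fun w : 'rV[R]_(m + m) => w 0 (rshift m a) : R^o) fv); exact: coord_cont.
Qed.

End CoordinateSpace.

Lemma cvg_sumr (R : realType) (S : Type) (F : set_system S) (I : finType) (P : pred I)
    (f : I -> S -> R^o) (l : I -> R^o) : Filter F ->
  (forall i, P i -> f i @ F --> l i) ->
  (fun s => \sum_(i | P i) f i s : R^o) @ F --> (\sum_(i | P i) l i : R^o).
Proof.
move=> FF h; elim: (index_enum I) => [|i r IH].
  by rewrite big_nil; under eq_fun do rewrite big_nil; exact: cvg_cst.
rewrite big_cons; under eq_fun do rewrite big_cons.
by case: ifP => // Pi; apply: cvgD => //; exact: h.
Qed.

Lemma sum_enum_val (V : nmodType) (J : finType) (I : {set J}) (F : J -> V) :
  \sum_(j in I) F j = \sum_(a < #|I|) F (enum_val a).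
Proof. exact: big_enum_val. Qed.

Lemma convex_lt (R : realType) (s l a b : R) : 0 <= s <= 1 -> l < a -> l < b ->
  l < (1 - s) * a + s * b.
Proof.
move=> /andP[s0 s1] la lb; rewrite -subr_gt0.
have -> : (1 - s) * a + s * b - l = (1 - s) * (a - l) + s * (b - l) by ring.
have [->|sn0] := eqVneq s 0; first by rewrite subr0 mul1r mul0r addr0 subr_gt0.
apply: ltr_wpDl; first by rewrite mulr_ge0 ?subr_ge0// ltW.
by rewrite mulr_gt0 ?subr_gt0// lt_def sn0.
Qed.

Section Corner.
Variables (R : realType) (n : nat) (J : finType) (X : J -> 'rV[R]_n) (lam : J -> R).
Local Notation CJ := (CJ R J).
Implicit Types (z : CJ) (xi mu : 'cV[R]_n) (th : J -> R).

Lemma level_of_moment z xi : moment_set X lam z xi -> level_set X lam z.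
Proof.
move=> h x x0; under eq_bigr do rewrite -h mulrC.
by rewrite -pairing_piX x0 pairing0r.
Qed.

Lemma sqmod_rotJ x z j : sqmod (rotJ x z j) = sqmod (z j).
Proof. exact: sqmod_expi. Qed.

Lemma rotJD x y z : rotJ (fun j => x j + y j) z = rotJ x (rotJ y z).
Proof. by apply/funext => j; rewrite /rotJ expiD mulrA. Qed.

(* A vertex [mu] of a simple polyhedron, with [e] dual to its normals. *)
Definition corner (I : {set J}) mu (e : J -> 'cV[R]_n) :=
  [/\ dual_basis X I e, forall j, j \in I -> pairing mu (X j) = lam j &
      forall j, j \notin I -> lam j < pairing mu (X j)].

Variables (I : {set J}) (mu : 'cV[R]_n) (e : J -> 'cV[R]_n).
Hypothesis cI : corner I mu e.
Local Notation VI := 'rV[R]_(#|I| + #|I|).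
Local Notation ix := (@enum_val _ (mem I)).
Implicit Types v : VI.

Lemma corner_pairing xi y :
  pairing xi y = \sum_(i in I) pairing (e i) y * pairing xi (X i).
Proof.
have [[_ sp] _ _] := cI; rewrite {1}(sp y) pairing_sumr.
by apply: eq_bigr => i _; rewrite pairingZr.
Qed.

Lemma corner_inj xi xi' : (forall i, i \in I -> pairing xi (X i) = pairing xi' (X i)) ->
  xi = xi'.
Proof.
move=> h; apply/colP => k; have := corner_pairing xi (delta_mx 0 k).
have := corner_pairing xi' (delta_mx 0 k).
rewrite /pairing -!rowE !mxE => -> ->; apply: eq_bigr => i iI.
by have := h i iI; rewrite /pairing => ->.
Qed.

Lemma moment_set_inj z xi xi' :
  moment_set X lam z xi -> moment_set X lam z xi' -> xi = xi'.
Proof. by move=> h h'; apply: corner_inj => i _; rewrite h h'. Qed.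

(** A linear section of [piX X] supported on [I]; it turns torus elements into explicit phases. *)
Definition lift_basis (y : 'rV[R]_n) (j : J) : R :=
  if j \in I then pairing (e j) y else 0.

Lemma piX_lift_basis y : piX X (lift_basis y) = y.
Proof.
have [[_ sp] _ _] := cI; rewrite [RHS]sp /piX [RHS]big_mkcond/=.
by apply: eq_bigr => j _; rewrite /lift_basis; case: ifP => // _; rewrite scale0r.
Qed.

Lemma piXD x y : piX X (fun j => x j + y j) = piX X x + piX X y.
Proof. by rewrite /piX -big_split/=; apply: eq_bigr => j _; rewrite scalerDl. Qed.

Lemma piXB x y : piX X (fun j => x j - y j) = piX X x - piX X y.
Proof. by rewrite /piX -sumrB; apply: eq_bigr => j _; rewrite scalerBl. Qed.

Lemma piXN x : piX X (fun j => - x j) = - piX X x.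
Proof. by rewrite /piX -sumrN; apply: eq_bigr => j _; rewrite scaleNr. Qed.

Lemma lift_basis_supp (w : J -> R) : (forall j, j \notin I -> w j = 0) ->
  lift_basis (piX X w) = w.
Proof.
have [[du _] _ _] := cI; move=> w0; apply/funext => j; rewrite /lift_basis.
case: ifP => [jI|/negbT/w0//]; rewrite pairing_piX (bigD1 j)//= du// eqxx mulr1.
rewrite big1 ?addr0// => k kj; have [kI|/w0 ->] := boolP (k \in I); last by rewrite mul0r.
by rewrite du// eq_sym (negbTE kj) mulr0.
Qed.

(** The element of the kernel of pi whose coordinates off [I] are those of [- th]: rotating by it
    removes the phases [th] off [I] without leaving the orbit of [N]. *)
Definition gauge th (j : J) : R := lift_basis (piX X th) j - th j.

Lemma piX_gauge th : piX X (gauge th) = 0.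
Proof. by rewrite piXB piX_lift_basis subrr. Qed.

Lemma gauge_out th j : j \notin I -> gauge th j = - th j.
Proof. by move=> jI; rewrite /gauge /lift_basis (negbTE jI) sub0r. Qed.

Lemma level_moment z : level_set X lam z -> exists xi, moment_set X lam z xi.
Proof.
move=> zl; exists (\sum_(i in I) (sqmod (z i) + lam i) *: e i) => j.
(* The basis vector at [j] minus the lift of [X j] lies in the kernel of pi; testing the level
   condition on it expresses the value at [j] through the values on [I]. *)
have := zl (fun k => (k == j)%:R - lift_basis (X j) k).
rewrite piXB piX_lift_basis (_ : piX X _ = X j); last first.
  rewrite /piX (bigD1 j)//= eqxx scale1r big1 ?addr0// => k /negbTE ->.
  by rewrite scale0r.
rewrite subrr => /(_ erefl); under eq_bigr do rewrite mulrBr.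
rewrite sumrB (bigD1 j)//= eqxx mulr1 big1; last by move=> k /negbTE ->; rewrite mulr0.
rewrite addr0 => /eqP; rewrite subr_eq0 => /eqP ->.
rewrite pairing_suml [LHS]big_mkcond/=; apply: eq_bigr => k _.
by rewrite /lift_basis; case: ifP; rewrite ?mulr0// pairingZl.
Qed.

(** The moment in closed form, affine in the squared moduli and equal to [mu] at the origin; its
    continuity and smoothness are read off from this formula. *)
Definition xi_fun v : 'cV[R]_n := mu + \sum_a sqmod (cc v a) *: e (ix a).

Lemma xi_funE v y :
  pairing (xi_fun v) y = pairing mu y + \sum_a sqmod (cc v a) * pairing (e (ix a)) y.
Proof.
rewrite pairingDl pairing_suml; congr (_ + _).
by apply: eq_bigr => a _; rewrite pairingZl.
Qed.

Lemma xi_setP v : xi_set X lam v (xi_fun v).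
Proof.
have [[du _] mI _] := cI; move=> a; rewrite xi_funE mI ?enum_valP// addrC.
congr (_ + _); rewrite (bigD1 a)//= du ?enum_valP// eqxx mulr1 big1 ?addr0//.
by move=> b ba; rewrite du ?enum_valP// (inj_eq enum_val_inj) (negbTE ba) mulr0.
Qed.

Lemma xi_ofE v : xi_of X lam v = xi_fun v.
Proof.
rewrite /xi_of; case: xgetP => [xi _ h|/(_ (xi_fun v)) h]; last by case: h; exact: xi_setP.
apply: corner_inj => i iI; rewrite -(enum_rankK_in iI iI).
by rewrite h xi_setP.
Qed.

Lemma toric_domP v :
  toric_dom X lam I v <-> forall j, j \notin I -> lam j < pairing (xi_fun v) (X j).
Proof.
split=> [[_ h] j /h|h]; first by rewrite xi_ofE.
by split=> [|j /h]; rewrite xi_ofE//; exact: xi_setP.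
Qed.

Lemma toric_u_in v i (iI : i \in I) : toric_u X lam v i = cc v (enum_rank_in iI i).
Proof.
rewrite /toric_u; case: pickP => [a /eqP ai|/(_ (enum_rank_in iI i))].
  by congr cc; apply: enum_val_inj; rewrite enum_rankK_in.
by rewrite enum_rankK_in// eqxx.
Qed.

Lemma toric_u_ix v a : toric_u X lam v (ix a) = cc v a.
Proof.
rewrite /toric_u; case: pickP => [b /eqP /enum_val_inj ->//|/(_ a)].
by rewrite eqxx.
Qed.

Lemma toric_u_out v j : j \notin I ->
  toric_u X lam v j = ((Num.sqrt (pairing (xi_fun v) (X j) - lam j))%:C)%C.
Proof.
move=> jI; rewrite /toric_u xi_ofE; case: pickP => // a /eqP aj.
by move: jI; rewrite -aj enum_valP.
Qed.

Lemma sqmod_toric_u v j : toric_dom X lam I v ->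
  sqmod (toric_u X lam v j) = pairing (xi_fun v) (X j) - lam j.
Proof.
move=> /toric_domP vd; have [jI|jI] := boolP (j \in I).
  rewrite toric_u_in -[in RHS](enum_rankK_in jI jI) xi_setP.
  by rewrite addrK.
by rewrite toric_u_out// sqmod_real sqr_sqrtr// subr_ge0 ltW// vd.
Qed.

Lemma toric_u_moment v : toric_dom X lam I v ->
  moment_set X lam (toric_u X lam v) (xi_fun v).
Proof. by move=> vd j; rewrite sqmod_toric_u// subrK. Qed.

Lemma toric_u_pos v j : toric_dom X lam I v -> j \notin I ->
  0 < Num.sqrt (pairing (xi_fun v) (X j) - lam j).
Proof. by move=> /toric_domP vd jI; rewrite sqrtr_gt0 subr_gt0 vd. Qed.

Definition res z : VI := of_cc (fun a => z (ix a)).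

Lemma cc_res z a : cc (res z) a = z (ix a).
Proof. exact: cc_of_cc. Qed.

Lemma xi_fun_res z xi : moment_set X lam z xi -> xi_fun (res z) = xi.
Proof.
move=> h; apply: corner_inj => i iI; rewrite -(enum_rankK_in iI iI).
by rewrite xi_setP cc_res h.
Qed.

(** The slice in which the chart takes its values: off [I] every coordinate is a positive real
    number. On its part in the level set, [res] inverts [toric_u]. *)
Definition positive_off z := forall j, j \notin I ->
  z j != 0 /\ z j = ((Num.sqrt (sqmod (z j)))%:C)%C.

Lemma toric_dom_res z : level_set X lam z -> positive_off z ->
  toric_dom X lam I (res z).
Proof.
move=> /level_moment[xi h] pz; apply/toric_domP => j jI.
rewrite (xi_fun_res h) h ltrDr sqmod_gt0; by have [] := pz _ jI.
Qed.

Lemma toric_u_res z : level_set X lam z -> positive_off z ->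
  toric_u X lam (res z) = z.
Proof.
move=> /level_moment[xi h] pz; apply/funext => j.
have [jI|jI] := boolP (j \in I).
  by rewrite -(enum_rankK_in jI jI) toric_u_ix cc_res.
rewrite toric_u_out// (xi_fun_res h) h addrK.
by have [_ <-] := pz _ jI.
Qed.

Lemma res_toric_u v : res (toric_u X lam v) = v.
Proof. by apply: cc_inj => a; rewrite cc_res toric_u_ix. Qed.

Lemma toric_u_positive_off v : toric_dom X lam I v -> positive_off (toric_u X lam v).
Proof.
move=> vd j jI; rewrite toric_u_out//; split.
  by rewrite -sqmod_gt0 sqmod_real exprn_gt0// toric_u_pos.
rewrite sqmod_real sqrtr_sqr ger0_norm// ltW// toric_u_pos//.
Qed.

Lemma cvg_xi_fun (S : Type) (F : set_system S) (f : S -> VI) v y :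
  Filter F -> f @ F --> v ->
  (fun s => pairing (xi_fun (f s)) y : R^o) @ F --> (pairing (xi_fun v) y : R^o).
Proof.
move=> FF fv; rewrite xi_funE; under eq_fun do rewrite xi_funE.
apply: cvgD; first exact: cvg_cst.
apply: cvg_sumr => a _; apply: cvgM; last exact: cvg_cst.
by apply: cvg_sqmod; exact: cvg_cc.
Qed.

Lemma cvg_toric_u (S : Type) (F : set_system S) (f : S -> VI) v :
  Filter F -> f @ F --> v ->
  (fun s => toric_u X lam (f s) : CJ) @ F --> (toric_u X lam v : CJ).
Proof.
move=> FF fv; apply: cvg_prod_topology => j.
have [jI|jI] := boolP (j \in I).
  by rewrite toric_u_in; under eq_fun do rewrite toric_u_in; exact: cvg_cc.
rewrite toric_u_out//; under eq_fun do rewrite toric_u_out//.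
apply: cvg_realc; apply: cvg_sqrt; apply: cvgB; last exact: cvg_cst.
exact: cvg_xi_fun.
Qed.

Lemma cvg_res (S : Type) (F : set_system S) (f : S -> CJ) z :
  Filter F -> (forall i, i \in I -> (fun s => f s i) @ F --> z i) ->
  (fun s => res (f s)) @ F --> res z.
Proof. by move=> FF fz; apply: cvg_of_cc => a; apply: fz; exact: enum_valP. Qed.

End Corner.

Lemma expD_eq (R : realType) n (Q : set 'rV[R]_n) : Q 0 ->
  (forall a b, Q a -> Q b -> Q (a + b)) -> (forall a, Q a -> Q (- a)) ->
  forall y y', expD Q y = expD Q y' <-> Q (y' - y).
Proof.
move=> Q0 QD QN y y'; apply: cls_eq => [x|x z h|x z w h h'].
- by rewrite subrr.
- by rewrite -opprB; exact: QN.
- by have := QD _ _ h' h; rewrite subrKA.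
Qed.

(** * Orbits, the torus action and the charts *)

Section ToricSpace.
Variables (R : realType) (n : nat) (Q : set 'rV[R]_n).
Hypotheses (Q0 : Q 0) (QD : forall a b, Q a -> Q b -> Q (a + b)).
Hypothesis QN : forall a, Q a -> Q (- a).
Variables (J : finType) (X : J -> 'rV[R]_n) (lam : J -> R).
Local Notation CJ := (CJ R J).
Local Notation L := (level_set X lam).
Local Notation N := (N_rel Q (X := X) (lam := lam)).
Implicit Types (z w : L) (x y : J -> R).

Lemma QB a b : Q a -> Q b -> Q (a - b).
Proof. by move=> Qa Qb; apply: QD => //; exact: QN. Qed.

Lemma Qint (m : int) v : Q v -> Q (m%:~R *: v).
Proof.
move=> Qv; have Qn k : Q (v *+ k).
  by elim: k => [|k IH]; rewrite ?mulr0n ?mulrS//; exact: QD.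
by rewrite scaler_int; case: m => m; [exact: Qn|apply: QN; exact: Qn].
Qed.

Lemma rotL_eq x z w : (forall j, val w j = expi (x j) * val z j) -> w = rotL x z.
Proof. by move=> h; apply: val_inj; apply/funext => j; rewrite h. Qed.

Lemma rotL0 z : rotL (fun=> 0) z = z.
Proof. by apply/esym/rotL_eq => j; rewrite expi0 mul1r. Qed.

Lemma rotLD x y z : rotL (fun j => x j + y j) z = rotL x (rotL y z).
Proof. by apply: val_inj; exact: rotJD. Qed.

Lemma piX0 : piX X (fun=> 0) = 0.
Proof. by rewrite /piX big1// => j _; rewrite scale0r. Qed.

Lemma N_refl z : N z z.
Proof. by exists (fun=> 0); rewrite ?piX0 ?rotL0. Qed.

Lemma N_sym z w : N z w -> N w z.
Proof.
move=> [x Qx ->]; exists (fun j => - x j); first by rewrite piXN; exact: QN.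
by apply: rotL_eq => j /=; rewrite expiNK.
Qed.

Lemma N_trans z w t : N z w -> N w t -> N z t.
Proof.
move=> [x Qx ->] [y Qy ->]; exists (fun j => y j + x j); last by rewrite rotLD.
by rewrite piXD; exact: QD.
Qed.

Definition toric_cls_eq := cls_eq N_refl N_sym N_trans.

Lemma cvg_rotJ (S : Type) (F : set_system S) (f : S -> CJ) (g : S -> J -> R) (l : CJ) m :
  Filter F -> (forall j, (fun s => f s j) @ F --> l j) ->
  (forall j, (fun s => g s j : R^o) @ F --> (m j : R^o)) ->
  (fun s => rotJ (g s) (f s)) @ F --> rotJ m l.
Proof.
move=> FF fl gm; apply: cvg_prod_topology => j; apply: cvg_mulc; last exact: fl.
exact: cvg_expi.
Qed.

Lemma cvg_val (S : Type) (F : set_system S) (f : S -> L) z j :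
  Filter F -> f @ F --> z -> (fun s => val (f s) j) @ F --> val z j.
Proof.
move=> FF fz; apply: (cvg_comp _ (fun u : CJ => u j) (cvg_comp _ val fz _)).
  exact: val_continuous.
exact: proj_continuous_at.
Qed.

Lemma rotL_continuous x : continuous (rotL x : L -> L).
Proof.
move=> z; apply: sub_continuous_at; apply: for_cvg => F FF Fz /=.
by apply: cvg_rotJ => j; [exact: cvg_val|exact: cvg_cst].
Qed.

Lemma toric_cls_open (A : set L) : open A -> open (cls N @` A).
Proof.
apply: cls_open; [exact: N_refl|exact: N_sym|exact: N_trans|].
move=> z _ [x Qx ->]; exists (rotL (fun j => - x j)); split.
- exact: rotL_continuous.
- by apply/esym/rotL_eq => j /=; rewrite expiNK.
- by move=> t; exists (fun j => - x j) => //; rewrite piXN; exact: QN.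
Qed.

Section WithCorner.
Variables (I0 : {set J}) (mu0 : 'cV[R]_n) (e0 : J -> 'cV[R]_n).
Hypothesis c0 : corner X lam I0 mu0 e0.

Lemma lift_torusP (y : 'rV[R]_n) : Q (piX X (lift_torus X (expD Q y)) - y).
Proof.
rewrite /lift_torus; case: xgetP => [x _ /(expD_eq Q0 QD QN) h|h].
  by rewrite -opprB; exact: QN.
by case: (h (lift_basis I0 e0 y)); rewrite /= (piX_lift_basis c0).
Qed.

(** The action is defined by a chosen lift of the torus element and a chosen representative of the
    orbit; either choice changes the phases by a vector that pi sends into [Q]. *)
Lemma toric_actE (y : 'rV[R]_n) x z : Q (piX X x - y) ->
  toric_act (expD Q y) (cls N z) = cls N (rotL x z).
Proof.
move=> Qy; apply/toric_cls_eq.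
have [t Qt tE] := rep_rel N_refl N_sym N_trans z; rewrite tE.
set s := lift_torus X _; exists (fun j => x j - (s j + t j)); last first.
  apply: rotL_eq => j /=; rewrite /rotJ mulrA -expiD mulrA -expiD.
  by congr (expi _ * _); ring.
rewrite piXB piXD (_ : _ - _ = (piX X x - y) - (piX X s - y) - piX X t).
  by apply: QB => //; apply: QB => //; exact: lift_torusP.
by rewrite opprD addrA; congr (_ + _); rewrite opprB addrA subrK.
Qed.

Lemma moment_clsE z xi : moment_set X lam (val z) xi -> moment (cls N z) = xi.
Proof.
move=> h; rewrite /moment moment_cls_rep; case: xgetP => [xi' _ h'|/(_ xi)//].
exact: (moment_set_inj c0 h' h).
Qed.

End WithCorner.

Section Chart.
Variables (I : {set J}) (mu : 'cV[R]_n) (e : J -> 'cV[R]_n).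
Hypothesis cI : corner X lam I mu e.
Hypothesis QX : forall j, Q (X j).
Local Notation VI := 'rV[R]_(#|I| + #|I|).
Local Notation ix := (@enum_val _ (mem I)).
Local Notation W := (toric_dom X lam I).
Local Notation G := (toric_grp Q X I).
Local Notation chart := (@toric_chart R n Q J X lam I).

Definition ext (t : 'I_#|I| -> R) (j : J) : R :=
  if [pick a | ix a == j] is Some a then t a else 0.

Lemma ext_ix t a : ext t (ix a) = t a.
Proof.
rewrite /ext; case: pickP => [b /eqP /enum_val_inj ->//|/(_ a)].
by rewrite eqxx.
Qed.

Lemma ext_out t j : j \notin I -> ext t j = 0.
Proof.
by move=> jI; rewrite /ext; case: pickP => // a /eqP aj; move: jI; rewrite -aj enum_valP.
Qed.

Lemma piX_ext t : piX X (ext t) = \sum_a t a *: X (ix a).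
Proof.
rewrite /piX (bigID (mem I))/= [X in _ + X]big1 ?addr0; last first.
  by move=> j jI; rewrite ext_out// scale0r.
by rewrite big_enum_val; apply: eq_bigr => a _; rewrite ext_ix.
Qed.

Lemma xi_fun_rot t (v : VI) :
  xi_fun mu e (of_cc (fun a => expi (t a) * cc v a)) = xi_fun mu e v.
Proof.
congr (_ + _); apply: eq_bigr => a _; rewrite cc_of_cc sqmod_expi//.
Qed.

Lemma toric_u_rot t (v : VI) :
  toric_u X lam (of_cc (fun a => expi (t a) * cc v a)) = rotJ (ext t) (toric_u X lam v).
Proof.
apply/funext => j; rewrite /rotJ; have [jI|jI] := boolP (j \in I).
  by rewrite -(enum_rankK_in jI jI) !(toric_u_ix _ lam) ext_ix cc_of_cc.
by rewrite ext_out// expi0 mul1r !(toric_u_out cI)// xi_fun_rot.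
Qed.

Lemma toric_dom_rot t (v : VI) : W v -> W (of_cc (fun a => expi (t a) * cc v a)).
Proof. by move=> /(toric_domP cI) h; apply/(toric_domP cI); rewrite xi_fun_rot. Qed.

Lemma orbit_refl (v : W) : orbit_rel G v v.
Proof.
exists id => //; exists (fun=> 0); first by rewrite big1// => a _; rewrite scale0r.
apply/funext => w; rewrite -[LHS]of_cc_cc; apply: of_cc_ext => a.
by rewrite expi0 mul1r.
Qed.

Lemma orbit_relP (v w : W) : orbit_rel G v w <-> exists2 t : 'I_#|I| -> R,
  Q (\sum_a t a *: X (ix a)) & forall a, cc (val w) a = expi (t a) * cc (val v) a.
Proof.
split=> [[g [t Qt ->] wE]|[t Qt wE]].
  by exists t => // a; rewrite wE cc_of_cc.
exists (fun v => of_cc (fun a => expi (t a) * cc v a)); first by exists t.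
by rewrite -[LHS]of_cc_cc; apply: of_cc_ext.
Qed.

Lemma orbit_sym (v w : W) : orbit_rel G v w -> orbit_rel G w v.
Proof.
move=> /orbit_relP[t Qt wE]; apply/orbit_relP; exists (fun a => - t a).
  by under eq_bigr do rewrite scaleNr; rewrite sumrN; exact: QN.
by move=> a; rewrite wE expiNK.
Qed.

Lemma orbit_trans (u v w : W) : orbit_rel G u v -> orbit_rel G v w -> orbit_rel G u w.
Proof.
move=> /orbit_relP[t Qt vE] /orbit_relP[s Qs wE]; apply/orbit_relP.
exists (fun a => s a + t a).
  by under eq_bigr do rewrite scalerDl; rewrite big_split; exact: QD.
by move=> a; rewrite wE vE expiD mulrA.
Qed.

Definition model_cls_eq := cls_eq orbit_refl orbit_sym orbit_trans.

Lemma orbit_N (v w : W) : orbit_rel G v w -> N (toric_uL v) (toric_uL w).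
Proof.
move=> /orbit_relP[t Qt wE]; exists (ext t); first by rewrite piX_ext.
apply: val_inj => /=; rewrite -toric_u_rot; congr (toric_u X lam).
by rewrite -[LHS]of_cc_cc; apply: of_cc_ext.
Qed.

Lemma chartE (v : W) : chart (cls _ v) = cls N (toric_uL v).
Proof.
apply/toric_cls_eq/N_sym/orbit_N.
exact: (rep_rel orbit_refl orbit_sym orbit_trans).
Qed.

Lemma toric_uL_continuous : continuous (@toric_uL R n J X lam I).
Proof.
move=> v; apply: sub_continuous_at; apply: for_cvg => F FF Fv /=.
by apply: (cvg_toric_u cI); exact: cvg_sval.
Qed.

Lemma chart_continuous : continuous chart.
Proof.
apply: quot_continuous => v.
rewrite (_ : chart \o cls _ = cls N \o @toric_uL R n J X lam I); last first.
  by apply/funext => w /=; rewrite chartE.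
apply: continuous_comp; first exact: toric_uL_continuous.
exact: cls_continuous.
Qed.

Lemma chart_injective : injective chart.
Proof.
move=> p q; rewrite -(cls_rep p) -(cls_rep q) !chartE.
move: (rep p) (rep q) => v w /toric_cls_eq[x Qx /(congr1 val) /= uE].
apply/model_cls_eq/orbit_relP; exists (fun a => x (ix a)); last first.
  move=> a.
  by have := congr1 (fun f => f (ix a)) uE; rewrite /rotJ !(toric_u_ix _ lam).
have vd := set_mem (valP v); have wd := set_mem (valP w).
(* Off [I] both points have positive coordinates of equal modulus, so the phases there are integers
   and contribute an element of [Q]; the phases on [I] then form an element of the chart group. *)
suff Qo : Q (\sum_(j | j \notin I) x j *: X j).
  have -> : \sum_a x (ix a) *: X (ix a) = piX X x - \sum_(j | j \notin I) x j *: X j.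
    transitivity (\sum_(j in I) x j *: X j); first by rewrite sum_enum_val.
    by rewrite /piX [in RHS](bigID (mem I))/= addrK.
  exact: QB.
apply: (big_ind Q) => // j jI.
have xu : expi (x j) = 1.
  have := congr1 (fun f => f j) uE; rewrite /rotJ.
  have [u0 uv] := toric_u_positive_off cI vd jI.
  have [w0 uw] := toric_u_positive_off cI wd jI.
  move=> wv; have sq : sqmod (toric_u X lam (val w) j) = sqmod (toric_u X lam (val v) j).
    by rewrite wv sqmod_expi.
  rewrite uw sq -uv -[LHS]mul1r in wv.
  by apply: (mulIf u0); rewrite -wv.
by have [k ->] := expi_eq1 xu; exact: Qint.
Qed.

Lemma gauge_positive_off (z : CJ) (th : J -> R) :
  (forall j, j \in I -> th j = 0) ->
  (forall j, j \notin I -> z j != 0 /\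
     z j = ((Num.sqrt (sqmod (z j)))%:C)%C * expi (th j)) ->
  positive_off I (rotJ (gauge X I e th) z).
Proof.
move=> th0 zth j jI; have [z0 zE] := zth _ jI.
rewrite /rotJ gauge_out//; split; first by rewrite mulf_neq0// expi_neq0.
rewrite sqmod_expi {1}zE mulrCA -expiD addNr expi0 mulr1//.
Qed.

Lemma chart_gauge (z : L) th (zp : positive_off I (rotJ (gauge X I e th) (val z))) :
  exists v : W, val v = res I (rotJ (gauge X I e th) (val z)) /\
    chart (cls _ v) = cls N z.
Proof.
have zl : L (rotJ (gauge X I e th) (val z)) by apply/set_mem/rot_level_set/valP.
have vd := toric_dom_res cI zl zp.
exists (exist _ (res I (rotJ (gauge X I e th) (val z))) (mem_set vd)); split=> //.
rewrite chartE; apply/toric_cls_eq/N_sym; exists (gauge X I e th).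
  by rewrite (piX_gauge cI).
by apply: val_inj => /=; rewrite (toric_u_res cI).
Qed.

Lemma polar_fun (S : {set J}) (z : CJ) : exists th : J -> R,
  (forall j, j \in S -> th j = 0) /\
  (forall j, j \notin S -> z j = ((Num.sqrt (sqmod (z j)))%:C)%C * expi (th j)).
Proof.
have [th thP] := choice (fun j => polar (z j)).
exists (fun j => if j \in S then 0 else th j); split=> j; first by move=> ->.
by move=> /negbTE ->.
Qed.

(** Nonvanishing off [I] suffices because the gauge removes the phases there within one orbit. *)
Lemma range_chart (z : L) :
  range chart (cls N z) <-> forall j, j \notin I -> val z j != 0.
Proof.
split=> [[p _]|z0].
  rewrite -(cls_rep p) chartE => /toric_cls_eq[x _ ->] j jI /=.
  rewrite mulf_neq0 ?expi_neq0//.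
  by have [] := toric_u_positive_off cI (set_mem (valP (rep p))) jI.
have [th [th0 thP]] := polar_fun I (val z).
have [|v [_ vE]] := @chart_gauge z th; last by exists (cls _ v).
by apply: gauge_positive_off => // k kI; split; [exact: z0|exact: thP].
Qed.

Lemma near_half_plane (S : Type) (F : set_system S) (f : S -> CJ) (z : CJ) (A : {set J})
    (t0 : J -> R) : Filter F -> (forall j, (fun s => f s j) @ F --> z j) ->
  (forall j, j \in A -> 0 < complex.Re (z j * expi (- t0 j))) ->
  \forall s \near F, forall j, j \in A -> 0 < complex.Re (f s j * expi (- t0 j)).
Proof.
move=> FF fz h; apply: filter_forall => j.
have [jA|jA] := boolP (j \in A); last by apply: filterE.
have c : (fun s => complex.Re (f s j * expi (- t0 j)) : R^o) @ F -->
    (complex.Re (z j * expi (- t0 j)) : R^o).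
  by apply: cvg_Re; apply: cvg_mulc; [exact: fz|exact: cvg_cstc].
have h' := cvgr_gt _ c _ (h j jA) : \forall s \near F, 0 < complex.Re (f s j * expi (- t0 j)).
by near=> s => _; near: s; exact: h'.
Unshelve. all: by end_near.
Qed.

Lemma cvg_piX (S : Type) (F : set_system S) (f : S -> J -> R) (g : J -> R) xi :
  Filter F -> (forall j, (fun s => f s j : R^o) @ F --> (g j : R^o)) ->
  (fun s => pairing xi (piX X (f s)) : R^o) @ F --> (pairing xi (piX X g) : R^o).
Proof.
move=> FF fg; rewrite pairing_piX; under eq_fun do rewrite pairing_piX.
by apply: cvg_sumr => j _; apply: cvgM; [exact: fg|exact: cvg_cst].
Qed.

Lemma cvg_gauge (S : Type) (F : set_system S) (f : S -> J -> R) (g : J -> R) j :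
  Filter F -> (forall j, (fun s => f s j : R^o) @ F --> (g j : R^o)) ->
  (fun s => gauge X I e (f s) j : R^o) @ F --> (gauge X I e g j : R^o).
Proof.
move=> FF fg; rewrite /gauge /lift_basis; apply: cvgB; last exact: fg.
by case: ifP => _; [exact: cvg_piX|exact: cvg_cst].
Qed.

(** Near a point of the level set the chart has a continuous inverse up to the group actions: the
    arguments off [I] follow continuous branches, the gauge makes these coordinates positive, and
    [res] reads off the chart coordinates. *)
Lemma chart_open (O : set (model W G)) : open O -> open (chart @` O).
Proof.
move=> oO; apply: open_quotE; rewrite openE => z0 [p Op pE].
have z00 j : j \notin I -> val z0 j != 0.
  by apply: (iffLR (range_chart z0)); exists p.
have [t0 [t00 t0P]] := polar_fun I (val z0).
pose th (z : CJ) (j : J) : R := if j \in I then 0 else thloc (t0 j) (z j).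
have hp0 j : j \in ~: I -> 0 < complex.Re (val z0 j * expi (- t0 j)).
  rewrite inE => jI; rewrite (t0P _ jI); apply: Re_expi_gt0; last by rewrite subrr normr0 invr_gt0.
  by rewrite sqrtr_gt0 sqmod_gt0 z00.
have cz j : (fun z : L => val z j) @ z0 --> val z0 j.
  by apply: for_cvg => F FF Fz; exact: cvg_val.
have near_hp := near_half_plane _ cz hp0.
have gp (z : CJ) : (forall j, j \in ~: I -> 0 < complex.Re (z j * expi (- t0 j))) ->
    positive_off I (rotJ (gauge X I e (th z)) z).
  move=> hp; apply: gauge_positive_off => j jI; rewrite /th; first by rewrite jI.
  have hpj : 0 < complex.Re (z j * expi (- t0 j)) by apply: hp; rewrite inE.
  rewrite (negbTE jI); split; last exact: thlocE.
  by apply/eqP => z0'; move: hpj; rewrite z0' mul0r ltxx.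
have [v0 [v0E v0c]] := chart_gauge (gp _ hp0).
have : O (cls _ v0) by rewrite (@chart_injective (cls _ v0) p)// v0c pE.
have /open_sub[V oV VE] : open (cls (@orbit_rel R _ W G) @^-1` O).
  by move/continuousP: (@cls_continuous _ (@orbit_rel R _ W G)); exact.
move=> Ov0; have Vv0 : V (val v0) by have : (cls (@orbit_rel R _ W G) @^-1` O) v0 by []; rewrite VE.
have cv : {for z0, continuous
    (fun z : L => res I (rotJ (gauge X I e (th (val z))) (val z)))}.
  apply: for_cvg => F FF Fz; apply: cvg_res => i iI.
  apply: cvg_mulc; last exact: cvg_val.
  apply: cvg_expi; apply: cvg_gauge => j; rewrite /th.
  have [jI|jI] := boolP (j \in I); first exact: cvg_cst.
  by apply: cvg_thloc; [apply: hp0; rewrite inE|exact: cvg_val].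
have nV : \forall z \near z0, V (res I (rotJ (gauge X I e (th (val z))) (val z))).
  by apply: cv; rewrite -v0E; exact: open_nbhs_nbhs.
apply: filterS2 nV (near_hp _) => z Vz hp.
have [v [vE vc]] := chart_gauge (gp _ hp).
exists (cls _ v) => //; rewrite -vE in Vz.
by have : (val @^-1` V) v by []; rewrite -VE.
Qed.

End Chart.
End ToricSpace.

Lemma star_connected (R : realType) (V : normedModType R) (C : set V) c0 :
  (forall c (t : R), C c -> 0 <= t <= 1 -> C (c0 + t *: (c - c0))) -> connected C.
Proof.
move=> star; have [C0|/set0P[c1 Cc1]] := eqVneq C set0.
  by rewrite C0; exact: connected0.
have Cc0 : C c0 by have := star c1 0 Cc1; rewrite scale0r addr0 lexx ler01; exact.
pose seg c := [set c0 + t *: (c - c0) | t in `[0%R, 1%R]%classic].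
have -> : C = \bigcup_(c in C) seg c.
  apply/seteqP; split=> [c Cc|y [c Cc [t + <-]]].
    exists c => //; exists 1; rewrite /= ?in_itv/= ?ler01 ?lexx//.
    by rewrite scale1r addrC subrK.
  by rewrite /= in_itv/= => t01; exact: star.
apply: bigcup_connected.
  exists c0 => c _; exists 0; rewrite /= ?in_itv/= ?ler01 ?lexx//.
  by rewrite scale0r addr0.
move=> c _; apply: connected_continuous_connected; first exact: segment_connected.
apply: continuous_subspaceT => t.
by apply: cvgD; [exact: cvg_cst|apply: cvgZr_tmp; exact: cvg_id].
Qed.

(** * Local models *)

Section Model.
Variables (R : realType) (n : nat) (Q : set 'rV[R]_n).
Hypotheses (Q0 : Q 0) (QD : forall a b, Q a -> Q b -> Q (a + b)).
Hypotheses (QN : forall a, Q a -> Q (- a)) (Qcount : countable Q).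
Variables (J : finType) (X : J -> 'rV[R]_n) (lam : J -> R).
Variables (I : {set J}) (mu : 'cV[R]_n) (e : J -> 'cV[R]_n).
Hypothesis cI : corner X lam I mu e.
Hypothesis interior : exists xi, forall j, lam j < pairing xi (X j).
Local Notation m := (#|I|).
Local Notation VI := 'rV[R]_(m + m).
Local Notation ix := (@enum_val _ (mem I)).
Local Notation W := (toric_dom X lam I).
Local Notation G := (toric_grp Q X I).
Local Notation rotv t := (fun v : VI => of_cc (fun a : 'I_m => expi (t a) * cc v a)).

Lemma toric_dom_open : open W.
Proof.
rewrite openE => v /(toric_domP cI) vd.
have c j : {for v, continuous (fun w : VI => pairing (xi_fun mu e w) (X j) : R^o)}.
  by apply: for_cvg => F FF Fv; exact: cvg_xi_fun.
have : \forall w \near nbhs v, forall j, j \notin I -> lam j < pairing (xi_fun mu e w) (X j).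
  apply: (@filter_forall VI J (fun j w => j \notin I -> lam j < pairing (xi_fun mu e w) (X j))
    (nbhs v) (nbhs_filter v)) => j; have [jI|jI] := boolP (j \in I); first exact: nearW.
  by near=> w => _; near: w; exact: (cvgr_gt _ (c j) _ (vd _ jI)).
by apply: filterS => w; exact: (iffRL (toric_domP cI w)).
Unshelve. all: by end_near. Qed.

Lemma cc0 a : cc (0 : VI) a = 0.
Proof. by apply: complex_eq; rewrite /= mxE. Qed.

Lemma xi_fun0 : xi_fun mu e (0 : VI) = mu.
Proof. by rewrite /xi_fun big1 ?addr0// => a _; rewrite cc0 sqmod0 scale0r. Qed.

Lemma toric_dom0 : W (0 : VI).
Proof.
have [_ _ mo] := cI; apply/(toric_domP cI) => j jI.
by rewrite xi_fun0; exact: mo.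
Qed.

Lemma ccZ (t : R) (v : VI) a : cc (t *: v) a = ((t%:C)%C : R[i]^o) * cc v a.
Proof. by apply: complex_eq; rewrite ?Re_mul ?Im_mul /= !mxE; ring. Qed.

Lemma ccD (v w : VI) a : cc (v + w) a = cc v a + cc w a.
Proof. by apply: complex_eq; rewrite /= !mxE. Qed.

(** The domain is star-shaped at 0: the moment at [t *: v] is the convex combination of [mu] and the
    moment at [v] with weight [t ^+ 2]. *)
Lemma toric_dom_connected : connected W.
Proof.
apply: (@star_connected _ _ _ 0) => v t /(toric_domP cI) vd /andP[t0 t1].
rewrite add0r subr0; apply/(toric_domP cI) => j jI.
have [_ _ mo] := cI; have m0 := mo _ jI; have v0 := vd _ jI.
have -> : pairing (xi_fun mu e (t *: v)) (X j) =
    (1 - t ^+ 2) * pairing mu (X j) + t ^+ 2 * pairing (xi_fun mu e v) (X j).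
  rewrite !xi_funE mulrDr mulr_sumr addrA -mulrDl subrK mul1r; congr (_ + _).
  by apply: eq_bigr => a _; rewrite ccZ sqmodM sqmod_real mulrA.
by apply: convex_lt => //; rewrite sqr_ge0 expr_le1.
Qed.

Lemma rotv_linear (t : 'I_m -> R) : linear (rotv t).
Proof.
move=> a u v; apply: cc_inj => b; rewrite ccD ccZ !cc_of_cc ccD ccZ mulrDr.
by congr (_ + _); rewrite mulrCA.
Qed.

Lemma rotv_continuous (t : 'I_m -> R) : continuous (rotv t).
Proof.
move=> v; apply: for_cvg => F FF Fv; apply: cvg_of_cc => a.
by apply: cvg_mulc; [exact: cvg_cstc|exact: cvg_cc].
Qed.

(** The dense set on which the chart group acts freely. *)
Definition regular_dom : set VI := [set v | W v /\ forall a, cc v a != 0].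

Lemma regular_dom_connected : connected regular_dom.
Proof.
have [xi xiP] := interior.
(* Polar coordinates: the left half of [p] holds squared moduli, the right half arguments. The
   conditions become affine, so [C] is star-shaped. *)
pose C : set VI := [set p | (forall a, 0 < p 0 (lshift m a)) /\
  forall j, j \notin I -> lam j < pairing mu (X j) +
    \sum_a p 0 (lshift m a) * pairing (e (ix a)) (X j)].
pose psi (p : VI) : VI := of_cc (fun a =>
  ((Num.sqrt (p 0 (lshift m a)))%:C)%C * expi (p 0 (rshift m a))).
have sqpsi p a : C p -> sqmod (cc (psi p) a) = p 0 (lshift m a).
  move=> [p0 _]; rewrite cc_of_cc sqmodM sqmod_expi1 mulr1 sqmod_real sqr_sqrtr//.
  exact: ltW.
have -> : regular_dom = psi @` C.
  apply/seteqP; split=> [v [/(toric_domP cI) vd v0]|_ [p Cp <-]].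
    have [th thP] := choice (fun a => polar (cc v a)).
    pose p : VI := row_mx (\row_a sqmod (cc v a)) (\row_a th a).
    exists p; last first.
      apply: cc_inj => a; rewrite cc_of_cc row_mxEl row_mxEr !mxE.
      by rewrite -thP.
    split=> [a|j jI]; first by rewrite row_mxEl mxE sqmod_gt0.
    under eq_bigr do rewrite row_mxEl mxE.
    by rewrite -xi_funE; exact: vd.
  split; last by move=> a; rewrite -sqmod_gt0 sqpsi//; have [h _] := Cp; exact: h.
  apply/(toric_domP cI) => j jI; rewrite xi_funE.
  under eq_bigr do rewrite sqpsi//.
  by have [_ h] := Cp; exact: h.
apply: connected_continuous_connected; last first.
  apply: continuous_subspaceT => p; apply: for_cvg => F FF Fp; apply: cvg_of_cc => a.
  have cl i : (fun p : VI => p 0 i : R^o) @ F --> (p 0 i : R^o).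
    by apply: (cvg_comp _ (fun w : VI => w 0 i : R^o) Fp); exact: coord_cont.
  by apply: cvg_mulc; [apply: cvg_realc; exact: cvg_sqrt|exact: cvg_expi].
(* The centre has moment [xi] and all arguments 0; since [xi] is interior, every squared modulus is
   positive. *)
pose p0 : VI := row_mx (\row_a (pairing xi (X (ix a)) - lam (ix a))) 0.
have p0l a : 0 < p0 0 (lshift m a) by rewrite row_mxEl mxE subr_gt0.
have p0j j : lam j < pairing mu (X j) +
    \sum_a p0 0 (lshift m a) * pairing (e (ix a)) (X j).
  rewrite (_ : _ + _ = pairing xi (X j))//.
  rewrite (corner_pairing cI xi (X j)) (corner_pairing cI mu (X j)) !sum_enum_val.
  have [_ mI _] := cI; rewrite -big_split /=.
  apply: eq_bigr => a _; rewrite row_mxEl mxE (mI (ix a)) ?enum_valP//.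
  by ring.
apply: (@star_connected _ _ _ p0) => p t [pl pj] /andP[t0 t1].
have lE a : (p0 + t *: (p - p0)) 0 (lshift m a) =
    (1 - t) * p0 0 (lshift m a) + t * p 0 (lshift m a) by rewrite !mxE; ring.
split=> [a|j jI]; first by rewrite lE; apply: convex_lt; rewrite ?t0 ?t1.
have -> : pairing mu (X j) + \sum_a (p0 + t *: (p - p0)) 0 (lshift m a) *
    pairing (e (ix a)) (X j) =
  (1 - t) * (pairing mu (X j) + \sum_a p0 0 (lshift m a) * pairing (e (ix a)) (X j)) +
  t * (pairing mu (X j) + \sum_a p 0 (lshift m a) * pairing (e (ix a)) (X j)).
  under eq_bigr do rewrite lE mulrDl -!mulrA.
  by rewrite big_split /= -!mulr_sumr; ring.
by apply: convex_lt; [rewrite t0 t1|exact: p0j|exact: pj].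
Qed.

Lemma regular_dom_dense : W `<=` closure regular_dom.
Proof.
move=> v Wv B nB.
pose w : VI := of_cc (fun a => if cc v a == 0 then 1 else 0).
have nBW : nbhs v (B `&` W).
  by apply: filterI => //; apply: open_nbhs_nbhs; split=> //; exact: toric_dom_open.
have c : (fun t : R^o => v + t *: w) @ (0 : R^o) --> v.
  rewrite -[X in _ --> X]addr0 -(scale0r w).
  by apply: cvgD; [exact: cvg_cst|apply: cvgZr_tmp; exact: cvg_id].
have /nbhs_ballP[d /= d0 dP] := c _ nBW.
have [] := dP (d / 2).
  by rewrite -ball_normE /= sub0r normrN gtr0_norm ?divr_gt0// ltr_pdivrMr// ltr_pMr// ltr1n.
move=> Bv' Wv'; exists (v + (d / 2) *: w); split=> //; split=> // a.
rewrite ccD ccZ cc_of_cc; have [->|v0] := eqVneq (cc v a) 0; last by rewrite mulr0 addr0.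
by rewrite mulr1 add0r -sqmod_gt0 sqmod_real exprn_gt0// divr_gt0.
Qed.

Lemma toric_grp_countable : countable G.
Proof.
(* The dual basis recovers the phases of a group element from its vector in [Q], so [Q] maps onto
   the group. *)
pose F (q : 'rV[R]_n) : VI -> VI := rotv (fun a => pairing (e (ix a)) q).
have : countable (F @` Q) by apply: sub_countable Qcount; exact: card_image_le.
apply: sub_countable; apply: subset_card_le => g [x Qx ->].
exists (\sum_a x a *: X (ix a)) => //; apply/funext => v; apply: of_cc_ext => a.
congr (expi _ * _); rewrite pairing_sumr (bigD1 a)//= big1 ?addr0.
  by have [[du _] _ _] := cI; rewrite pairingZr du ?enum_valP// eqxx mulr1.
move=> b ba; have [[du _] _ _] := cI; rewrite pairingZr du ?enum_valP//.
by rewrite (inj_eq enum_val_inj) eq_sym (negbTE ba) mulr0.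
Qed.

Lemma toric_quasifold_model : quasifold_model W G.
Proof.
split.
- by split; [exact: toric_dom_open|exists 0; exact: toric_dom0|exact: toric_dom_connected].
- split; first exact: toric_grp_countable.
  + exists (fun=> 0); first by rewrite big1// => a _; rewrite scale0r.
    apply/funext => v; rewrite -[LHS]of_cc_cc; apply: of_cc_ext => a.
    by rewrite expi0 mul1r.
  + move=> g h [x Qx ->] [y Qy ->]; exists (fun a => x a + y a).
      by under eq_bigr do rewrite scalerDl; rewrite big_split; exact: QD.
    apply/funext => v /=; apply: of_cc_ext => a.
    by rewrite cc_of_cc expiD mulrA.
  + move=> g [x Qx ->]; exists (rotv (fun a => - x a)).
      exists (fun a => - x a) => //.
      by under eq_bigr do rewrite scaleNr; rewrite sumrN; exact: QN.
    move=> v _; split; apply: cc_inj => a; rewrite !cc_of_cc.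
      by rewrite expiNK.
    by rewrite expiKN.
- move=> g [x Qx ->]; split; last by move=> v; exact: (toric_dom_rot cI).
  move=> k; apply: Ck_linear; [exact: toric_dom_open|exact: rotv_linear|].
  exact: rotv_continuous.
- exists regular_dom; split.
  + by move=> v [].
  + exact: regular_dom_connected.
  + exact: regular_dom_dense.
  + move=> g v [x Qx ->] [Wv v0]; split; first exact: (toric_dom_rot cI).
    by move=> a; rewrite cc_of_cc mulf_neq0// expi_neq0.
  + move=> g v [x Qx ->] [Wv v0] gv w _.
    rewrite -[RHS]of_cc_cc; apply: of_cc_ext => a.
    have := congr1 (fun u => cc u a) gv; rewrite /= cc_of_cc => va.
    suff -> : expi (x a) = 1 by rewrite mul1r.
    by apply: (mulIf (v0 a)); rewrite va mul1r.
Qed.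

Lemma std_form_rotv (t : 'I_m -> R) u v :
  std_form (rotv t u) (rotv t v) = std_form u v.
Proof.
congr (_ * _); apply: eq_bigr => a _; rewrite !cc_of_cc !Re_mul !Im_mul /=.
set c := cos _; set s := sin _.
have cs : c ^+ 2 + s ^+ 2 = 1 by rewrite /c /s cos2Dsin2.
move: (u 0 _) (u 0 _) (v 0 _) (v 0 _) => q p p' q'.
transitivity ((c ^+ 2 + s ^+ 2) * (p * q' - q * p')); last by rewrite cs mul1r.
by ring.
Qed.

Lemma toric_symplectic_form : symplectic_form W (fun _ => @std_form R m).
Proof.
split.
- move=> _ _ a u v w; rewrite /std_form mulrCA -mulrDr [in RHS]mulr_sumr -big_split/=.
  congr (_ * _); apply: eq_bigr => b _.
  by rewrite !mxE; ring.
- move=> _ _ u v; rewrite /std_form -mulrN -sumrN; congr (_ * _).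
  by apply: eq_bigr => b _; ring.
- move=> _ _ u h; apply: cc_inj => a; rewrite cc0; apply/eqP; rewrite -sqmod_eq0.
  (* The test vector is [-i] times the coordinate [a] of [u], and 0 elsewhere; the form then yields
     the squared modulus times [pi^-1]. *)
  have := h (of_cc (fun b => if b == a then complex.Im (cc u a) +i* - complex.Re (cc u a) else 0)%C).
  rewrite /std_form (bigD1 a)// big1.
    rewrite cc_of_cc eqxx => /eqP; rewrite mulf_eq0 invr_eq0 gt_eqF ?pi_gt0//=.
    by rewrite addr0 mulrN opprK -!expr2 addrC.
  have R0 : complex.Re (0 : R[i]) = 0 by [].
  have I0 : complex.Im (0 : R[i]) = 0 by [].
  by move=> b /andP[_ /negbTE ba]; rewrite cc_of_cc ba R0 I0 !mulr0 subrr.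
- by move=> u v k; apply: Ck_cst; exact: toric_dom_open.
- move=> x _ u v w; rewrite (diff_cst_val (std_form v w : R^o) x u).
  rewrite (diff_cst_val (std_form w u : R^o) x v) (diff_cst_val (std_form u v : R^o) x w).
  by rewrite !addr0.
Qed.

Lemma toric_form_invariant g x u v : G g -> W x ->
  std_form ('d g x u) ('d g x v) = std_form u v.
Proof.
move=> [t _ ->] _.
have [_ ->] := diff_linear x u (rotv_linear t) (@rotv_continuous t).
have [_ ->] := diff_linear x v (rotv_linear t) (@rotv_continuous t).
exact: std_form_rotv.
Qed.

End Model.

(** * Universal covers of the overlaps *)

(** Loops are contracted freely, so it is enough to apply [h] to each point of the loop. The
    parameter of [h] runs over all of [R], as that of paths does. *)
Lemma contractible_simply_connected (R : realType) (E : topologicalType)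
    (h : E -> R -> E) e0 :
  continuous (fun p : E * R => h p.1 p.2) -> (forall e, h e 0 = e) ->
  (forall e, h e 1 = e0) -> simply_connected R E.
Proof.
move=> ch h0 h1; have chE e : continuous (h e).
  move=> t; apply: (@continuous_comp _ _ _ (fun t : R => (e, t)) (fun p : E * R => h p.1 p.2)).
    by apply: for_cvg => F FF Ft; apply: cvg_pr => //; exact: cvg_cst.
  exact: ch.
split; first by exists e0.
(* From [x] to [e0] at double speed, then backwards along the path that takes [y] to [e0]. *)
- move=> x y; pose c (t : R) := if t <= 2^-1 then h x (2 * t) else h y (2 - 2 * t).
  have c2 (f : R -> R) : continuous f -> continuous (fun t : R => h x (f t)) /\
      continuous (fun t : R => h y (f t)).
    by move=> cf; split=> t; apply: continuous_comp; [exact: cf|exact: chE|exact: cf|exact: chE].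
  exists c; split.
  + apply/continuous_subspace_setT.
    have -> : [set: R] = [set t | t <= 2^-1] `|` [set t | t >= 2^-1].
      apply/seteqP; split=> // t _ /=.
      by have [|/ltW] := lerP t 2^-1; [left|right].
    apply: withinU_continuous; [exact: closed_le|exact: closed_ge| |].
      apply: (@subspace_eq_continuous R [set t | t <= 2^-1] E (fun t => h x (2 * t)) c).
        by move=> t /set_mem /= t2; rewrite /c t2.
      apply: continuous_subspaceT; apply: (c2 (fun t => 2 * t) _).1 => t.
      by apply: cvgM; [exact: cvg_cst|exact: cvg_id].
    apply: (@subspace_eq_continuous R [set t | t >= 2^-1] E (fun t => h y (2 - 2 * t)) c).
      move=> t /set_mem /= t2; rewrite /c; case: ifP => // t2'.
      have -> : t = 2^-1 by apply/eqP; rewrite eq_le t2 t2'.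
      by rewrite mulfV// h1 (_ : 2 - 1 = 1) ?h1//; ring.
    apply: continuous_subspaceT; apply: (c2 (fun t => 2 - 2 * t) _).2 => t.
    apply: cvgB; first exact: cvg_cst.
    by apply: cvgM; [exact: cvg_cst|exact: cvg_id].
  + by rewrite /c invr_ge0 ler0n mulr0 h0.
  + by rewrite /c leNgt invf_lt1// ltr1n/= mulr1 subrr h0.
- move=> c cc c01; exists (fun p => h (c p.2) p.1), e0; split.
    move=> [s t]; apply: (@continuous_comp _ _ _ (fun p : R * R => (c p.2, p.1))
      (fun p : E * R => h p.1 p.2)); last exact: ch.
    apply: for_cvg => F FF Ft; apply: cvg_pr; last exact: cvg_pr1 Ft.
    by apply: cvg_comp (cvg_pr2 Ft) _; exact: cc.
  by move=> t _; split=> /=; rewrite ?h0 ?h1 ?c01.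
Qed.

Lemma thloc_near (R : realType) t0 (z : R[i]^o) : `|thloc t0 z - t0| < 4^-1.
Proof.
rewrite /thloc addrAC subrr add0r; set u := _ / complex.Re _.
have p0 := pi_gt0 R; have a1 := atan_ltpi2 u; have a2 := atan_gtNpi2 u.
rewrite normrM [`|(2 * pi)^-1|]gtr0_norm ?invr_gt0 ?two_pi_gt0// ltr_pdivrMr ?two_pi_gt0//.
by rewrite ltr_norml; apply/andP; split; lra.
Qed.

Definition TJ (R : realType) (J : finType) : topologicalType :=
  prod_topology (fun _ : J => R^o).

Lemma cvg_TJ (R : realType) (J : finType) (S : Type) (F : set_system S)
    (f : S -> TJ R J) (t : TJ R J) j : Filter F ->
  f @ F --> t -> (fun s => f s j : R^o) @ F --> (t j : R^o).
Proof.
move=> FF ft; apply: (cvg_comp f (fun u : TJ R J => u j) ft).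
exact: (@proj_continuous_at J (fun _ => R^o) j).
Qed.

Section Cover.
Variables (R : realType) (n : nat) (J : finType) (X : J -> 'rV[R]_n) (lam : J -> R).
Variables (I K : {set J}) (mu : 'cV[R]_n) (e : J -> 'cV[R]_n).
Hypothesis cI : corner X lam I mu e.
Hypothesis KI : K \subset I.
Local Notation CJ := (CJ R J).
Local Notation TJ := (TJ R J).
Local Notation VI := 'rV[R]_(#|I| + #|I|).
Local Notation ix := (@enum_val _ (mem I)).
Local Notation W := (toric_dom X lam I).
Implicit Types v : VI.

Definition has_angle (z : R[i]^o) (t : R) :=
  z != 0 /\ z = ((Num.sqrt (sqmod z))%:C)%C * expi t.

(* The universal cover of the locus [v_i != 0, i \notin K] of the chart: a
   point of the level set together with arguments of these coordinates. *)
Definition cover : set (CJ * TJ) := [set p | [/\ level_set X lam p.1,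
  forall j, j \notin K -> has_angle (p.1 j) (p.2 j) &
  forall j, j \notin I :\: K -> p.2 j = 0]].

Definition cover_proj (p : cover) : VI := res I (val p).1.

Definition locus : set VI := [set v | W v /\
  forall j, j \in I :\: K -> toric_u X lam v j != 0].

Lemma notin_K j : j \notin I -> j \notin K.
Proof. by apply: contra; move: j; exact/fintype.subsetP. Qed.

Lemma cover_positive p : cover p -> positive_off I p.1.
Proof.
move=> [_ ang th0] j jI; have [z0 zE] := ang _ (notin_K jI); split=> //.
by rewrite {1}zE th0 ?expi0 ?mulr1// inE negb_and jI orbT.
Qed.

Lemma cover_dom p : cover p -> W (res I p.1).
Proof. by move=> cp; apply: (toric_dom_res cI); [case: cp|exact: cover_positive]. Qed.

Lemma cover_u p : cover p -> toric_u X lam (res I p.1) = p.1.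
Proof. by move=> cp; apply: (toric_u_res cI); [case: cp|exact: cover_positive]. Qed.

Lemma cover_mk v (th : J -> R) : W v ->
  (forall j, j \in I :\: K -> has_angle (toric_u X lam v j) (th j)) ->
  (forall j, j \notin I :\: K -> th j = 0) -> cover (toric_u X lam v, th : TJ).
Proof.
move=> Wv ang th0; split=> //=.
  exact: level_of_moment (toric_u_moment cI Wv).
move=> j jK; have [jI|jI] := boolP (j \in I); first by apply: ang; rewrite inE jK.
have [u0 uE] := toric_u_positive_off cI Wv jI; split=> //.
by rewrite th0 ?expi0 ?mulr1// inE negb_and jI orbT.
Qed.

Lemma cvg_cover (S : Type) (F : set_system S) (f : S -> cover) (p : cover) :
  Filter F -> f @ F --> p ->
  (forall j, (fun s => (val (f s)).1 j) @ F --> (val p).1 j) /\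
  (forall j, (fun s => (val (f s)).2 j : R^o) @ F --> ((val p).2 j : R^o)).
Proof.
move=> FF fp; have /(_ FF) fv := cvg_sval _ fp; split=> j.
  by apply: (cvg_comp _ (fun u : CJ => u j) (cvg_pr1 fv)); exact: proj_continuous_at.
exact: cvg_TJ (cvg_pr2 fv).
Qed.

Lemma cvg_to_cover (S : Type) (F : set_system S) (f : S -> CJ * TJ) (p : CJ * TJ) :
  Filter F -> (forall j, (fun s => (f s).1 j) @ F --> p.1 j) ->
  (forall j, (fun s => (f s).2 j : R^o) @ F --> (p.2 j : R^o)) -> f @ F --> p.
Proof.
move=> FF h1 h2; rewrite (surjective_pairing p).
have -> : f = fun s => ((f s).1, (f s).2) by apply/funext => s; rewrite -surjective_pairing.
by apply: cvg_pr; apply: cvg_prod_topology.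
Qed.

Lemma cover_proj_continuous : continuous cover_proj.
Proof.
move=> p; apply: for_cvg => F FF Fp; apply: cvg_res => i iI.
by have [h _] := cvg_cover _ Fp; exact: h.
Qed.

Lemma cover_proj_range : range cover_proj = locus.
Proof.
apply/seteqP; split=> [_ [p _ <-]|v [Wv v0]].
  have cp := set_mem (valP p); split; first exact: cover_dom.
  move=> j; rewrite inE => /andP[jK _]; rewrite cover_u//.
  by case: cp => _ /(_ _ jK)[].
have [th [th0 thP]] := polar_fun (~: (I :\: K)) (toric_u X lam v).
have cp : cover (toric_u X lam v, th : TJ).
  apply: cover_mk => // j jIK; last by apply: th0; rewrite inE.
  by split; [exact: v0|apply: thP; rewrite inE negbK].
exists (mk_sub cp) => //=.
exact: res_toric_u.
Qed.

(** The evenly covered sets: each coordinate with a free argument stays in a half-plane on which a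
    continuous branch exists. *)
Definition half_planes (t0 : J -> R) : set VI := [set v | W v /\
  forall j, j \in I :\: K -> 0 < complex.Re (toric_u X lam v j * expi (- t0 j))].

Lemma half_planes_open t0 : open (half_planes t0).
Proof.
rewrite openE => v [Wv vt].
have nW : nbhs v W by apply: open_nbhs_nbhs; split=> //; exact: (toric_dom_open cI).
have c j : {for v, continuous (fun w : VI => toric_u X lam w j)}.
  apply: for_cvg => F FF Fv; apply: (cvg_comp _ (fun u : CJ => u j) (cvg_toric_u cI _ Fv)).
  exact: proj_continuous_at.
have := @near_half_plane R J _ (nbhs v) (@toric_u R n J X lam I) _ (I :\: K) t0 (nbhs_filter v) c vt.
by apply: filterS2 nW => w; split.
Qed.

Definition th_loc (t0 : J -> R) (z : CJ) (j : J) : R :=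
  if j \in I :\: K then thloc (t0 j) (z j) else 0.

(** These are the local sections of the covering, one for each integer shift [k] of the branches. *)
Lemma half_planes_cover t0 v (k : J -> int) : half_planes t0 v ->
  (forall j, j \notin I :\: K -> k j = 0) ->
  cover (toric_u X lam v, (fun j => th_loc t0 (toric_u X lam v) j + (k j)%:~R) : TJ).
Proof.
move=> [Wv vt] k0; apply: cover_mk => // j jIK; last first.
  by rewrite /th_loc (negbTE jIK) k0// addr0.
have := vt _ jIK; rewrite /th_loc jIK => vj; split.
  by apply/eqP => u0; move: vj; rewrite u0 mul0r ltxx.
by rewrite expiD expi_int mulr1; exact: thlocE.
Qed.

Lemma th_loc_unique (t0 : J -> R) p : cover p ->
  (forall j, j \in I :\: K -> `|p.2 j - t0 j| < 4^-1) -> th_loc t0 p.1 = p.2.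
Proof.
move=> [_ ang th0] near; apply/funext => j; rewrite /th_loc.
case: ifP => [jIK|/negbT jIK]; last by rewrite th0.
have [z0 zE] : has_angle (p.1 j) (p.2 j) by apply: ang; move: jIK; rewrite inE => /andP[].
rewrite zE thloc_unique//; last exact: near.
by rewrite sqrtr_gt0 sqmod_gt0.
Qed.

Lemma cover_half_planes (t0 : J -> R) p : cover p ->
  (forall j, j \in I :\: K -> `|p.2 j - t0 j| < 4^-1) -> half_planes t0 (res I p.1).
Proof.
move=> cp near; split; first exact: cover_dom.
move=> j jIK; rewrite cover_u//.
have [z0 zE] : has_angle (p.1 j) (p.2 j).
  by case: cp => _ ang _; apply: ang; move: jIK; rewrite inE => /andP[].
rewrite zE; apply: Re_expi_gt0; last exact: near.
by rewrite sqrtr_gt0 sqmod_gt0.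
Qed.

Lemma cvg_th_loc (S : Type) (F : set_system S) (f : S -> CJ) (z : CJ) t0 j :
  Filter F -> (forall j, (fun s => f s j) @ F --> z j) ->
  (j \in I :\: K -> 0 < complex.Re (z j * expi (- t0 j))) ->
  (fun s => th_loc t0 (f s) j : R^o) @ F --> (th_loc t0 z j : R^o).
Proof.
move=> FF fz h; rewrite /th_loc; case: ifP => jIK; last exact: cvg_cst.
by apply: cvg_thloc; [exact: h|exact: fz].
Qed.

Lemma cover_proj_open (A : set cover) : open A -> open (cover_proj @` A).
Proof.
move=> oA; rewrite openE => _ [p Ap <-].
have cp := set_mem (valP p); set t0 := (val p).2.
have near0 j : j \in I :\: K -> `|(val p).2 j - t0 j| < 4^-1.
  by move=> _; rewrite subrr normr0 invr_gt0.
have hp := cover_half_planes cp near0.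
have nhp : nbhs (cover_proj p) (half_planes t0).
  by apply: open_nbhs_nbhs; split=> //; exact: half_planes_open.
have /nbhs_sub[V nV VA] : nbhs p A by exact: open_nbhs_nbhs.
pose s v : CJ * TJ := (toric_u X lam v, (fun j => th_loc t0 (toric_u X lam v) j) : TJ).
have sp : s (cover_proj p) = val p.
  rewrite /s /cover_proj cover_u// [RHS]surjective_pairing; congr (_, _).
  exact: th_loc_unique.
have cs : {for cover_proj p, continuous s}.
  apply: for_cvg => F FF Fv.
  have cu j : (fun v => toric_u X lam v j) @ F --> toric_u X lam (cover_proj p) j.
    apply: (cvg_comp _ (fun u : CJ => u j) (cvg_toric_u cI _ Fv)).
    exact: proj_continuous_at.
  apply: cvg_to_cover => j /=; first exact: cu.
  by apply: cvg_th_loc => //; case: hp => _ /(_ j).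
have nsV : \forall v \near nbhs (cover_proj p), V (s v) by apply: cs; rewrite sp.
apply: filterS2 nhp nsV => v hv Vs.
have := @half_planes_cover t0 v (fun=> 0) hv (fun _ _ => erefl).
under [X in (_, X)]eq_fun do rewrite addr0; move=> cv.
exists (mk_sub cv); last exact: res_toric_u.
exact: VA.
Qed.

Lemma int_lt_half (a b : int) (x : R) : `|x - a%:~R| < 4^-1 -> `|x - b%:~R| < 4^-1 -> a = b.
Proof.
rewrite !ltr_norml => /andP[h1 h2] /andP[h3 h4].
have : (`|a - b| < 1)%R.
  rewrite -(ltr_int R) intr_norm ltr_norml rmorphB/=; apply/andP; split; lra.
by lia.
Qed.

Definition sheet (c : J -> R) : set cover :=
  [set p | forall j, j \in I :\: K -> `|(val p).2 j - c j| < 4^-1].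

Lemma sheet_open c : open (sheet c).
Proof.
rewrite openE => p sp; apply: (@filter_forall cover J (fun j q => j \in I :\: K ->
  `|(val q).2 j - c j| < 4^-1) (nbhs p) (nbhs_filter p)) => j.
have [jIK|jIK] := boolP (j \in I :\: K); last exact: nearW.
have cj : {for p, continuous (fun q : cover => `|(val q).2 j - c j| : R^o)}.
  apply: for_cvg => F FF Fp; apply: cvg_norm; apply: cvgB; last exact: cvg_cst.
  by have [_ h] := cvg_cover _ Fp; exact: h.
by near=> q => _; near: q; exact: (cvgr_lt _ cj _ (sp _ jIK)).
Unshelve. all: by end_near. Qed.

Lemma cover_covering : covering_map locus cover_proj.
Proof.
split; [exact: cover_proj_continuous|exact: cover_proj_range|].
move=> v0 lv0; have [p0 _ <-] : range cover_proj v0 by rewrite cover_proj_range.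
have cp0 := set_mem (valP p0); set t0 := (val p0).2.
exists (half_planes t0); split.
- exact: half_planes_open.
- by apply: cover_half_planes => // j _; rewrite subrr normr0 invr_gt0.
- move=> v [Wv vt]; split=> // j jIK.
  by apply/eqP => u0; have := vt _ jIK; rewrite u0 mul0r ltxx.
(* The sheets are the integer shifts of the arguments; fixing [k j = 0] where the argument is
   constantly 0 makes distinct indices give disjoint sheets. *)
pose Ix := {k : J -> int | forall j, j \notin I :\: K -> k j = 0}.
pose s (k : Ix) : set cover :=
  sheet (fun j => t0 j + (sval k j)%:~R).
have hpk (k : Ix) v : half_planes (fun j => t0 j + (sval k j)%:~R) v <-> half_planes t0 v.
  have E j : expi (- (t0 j + (sval k j)%:~R)) = expi (- t0 j).
    by rewrite opprD expiD -rmorphN expi_int mulr1.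
  by split=> -[Wv vt]; split=> // j jIK; have := vt _ jIK; rewrite E.
have os k : open (s k) by exact: sheet_open.
exists Ix, s; split.
- apply/seteqP; split=> [p [_ pt]|p [k _ sp]]; last first.
    by apply/(hpk k); apply: cover_half_planes => //; exact: set_mem (valP p).
  have cp := set_mem (valP p).
  have /choice[k kP] : forall j, exists k : int, (j \notin I :\: K -> k = 0) /\
      (j \in I :\: K -> `|(val p).2 j - (t0 j + k%:~R)| < 4^-1).
    move=> j; have [jIK|jIK] := boolP (j \in I :\: K); last by exists 0; split.
    have := pt _ jIK; rewrite /cover_proj cover_u//.
    have [z0 zE] : has_angle ((val p).1 j) ((val p).2 j).
      by case: cp => _ ang _; apply: ang; move: jIK; rewrite inE => /andP[].
    have r0 : 0 < Num.sqrt (sqmod ((val p).1 j)) by rewrite sqrtr_gt0 sqmod_gt0.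
    rewrite zE => /(Re_expi_near r0)[k kP].
    by exists k; split=> // _; rewrite opprD addrA.
  have k0 j : j \notin I :\: K -> k j = 0 by have [] := kP j.
  by exists (exist _ k k0) => // j jIK /=; have [_] := kP j; exact.
- move=> k k' _ _ [p [sp sp']]; apply: eq_sig_hprop => [x|]; first exact: Prop_irrelevance.
  apply/funext => j.
  have [jIK|jIK] := boolP (j \in I :\: K); last by rewrite (svalP k)// (svalP k').
  apply: (@int_lt_half _ _ ((val p).2 j - t0 j)).
    by have := sp _ jIK; rewrite opprD addrA.
  by have := sp' _ jIK; rewrite opprD addrA.
move=> k; split; [exact: os| |].
- split.
  + move=> p sp; apply/(hpk k); apply: cover_half_planes => //.
    exact: set_mem (valP p).
  + move=> p q /set_mem sp /set_mem sq pq; apply: val_inj.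
    have cp := set_mem (valP p); have cq := set_mem (valP q).
    have zE : (val p).1 = (val q).1.
      by rewrite -(cover_u cp) -(cover_u cq); congr (toric_u X lam).
    rewrite [LHS]surjective_pairing [RHS]surjective_pairing zE; congr (_, _).
    by rewrite -(th_loc_unique cp sp) -(th_loc_unique cq sq) zE.
  + move=> v hv; have cv := half_planes_cover hv (svalP k).
    exists (mk_sub cv); last exact: res_toric_u.
    move=> j jIK /=; rewrite /th_loc jIK.
    by rewrite opprD addrACA subrr addr0; exact: thloc_near.
- by move=> A oA _; exact: cover_proj_open.
Qed.

End Cover.

(** * Contraction of the covers *)

Section Contraction.
Variables (R : realType) (n : nat) (J : finType) (X : J -> 'rV[R]_n) (lam : J -> R).
Variables (I K : {set J}) (mu : 'cV[R]_n) (e : J -> 'cV[R]_n).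
Hypothesis cI : corner X lam I mu e.
Variable xi0 : 'cV[R]_n.
Hypothesis xi0K : forall j, j \in K -> pairing xi0 (X j) = lam j.
Hypothesis xi0N : forall j, j \notin K -> lam j < pairing xi0 (X j).
Local Notation CJ := (CJ R J).
Local Notation TJ := (TJ R J).
Local Notation cover := (cover X lam I K).

(** The homotopy has its parameter in all of [R], so the passage from 1 to 0 is made by a function
    with values in the unit interval everywhere. *)
Definition shrink (t : R) : R := cos (pi / 2 * t) ^+ 2.

Lemma shrink_bound t : 0 <= shrink t <= 1.
Proof. by rewrite sqr_ge0 -[leRHS](cos2Dsin2 (pi / 2 * t)) lerDl sqr_ge0. Qed.

Lemma shrink0 : shrink 0 = 1.
Proof. by rewrite /shrink mulr0 cos0 expr1n. Qed.

Lemma shrink1 : shrink 1 = 0.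
Proof. by rewrite /shrink mulr1 cos_pihalf expr0n. Qed.

(** The moment moves along the segment to [xi0] with weights [c ^+ 2] and [1 - c ^+ 2]. Coordinates
    in [K] are scaled by [c], since [xi0] is tight there; the others get the modulus that the new
    moment prescribes, and their arguments shrink to 0. *)
Definition contract_val (p : CJ * TJ) (c : R) : CJ * TJ :=
  ((fun j => if j \in K then ((c%:C)%C : R[i]^o) * p.1 j else
     ((Num.sqrt (c ^+ 2 * sqmod (p.1 j) + (1 - c ^+ 2) * (pairing xi0 (X j) - lam j)))%:C)%C *
     expi (c * p.2 j)) : CJ,
   (fun j => c * p.2 j) : TJ).

Lemma contract_radius (p : CJ * TJ) c j : cover p -> 0 <= c <= 1 -> j \notin K ->
  0 < c ^+ 2 * sqmod (p.1 j) + (1 - c ^+ 2) * (pairing xi0 (X j) - lam j).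
Proof.
move=> [_ ang _] /andP[c0 c1] jK; rewrite addrC; apply: convex_lt.
- by rewrite sqr_ge0 expr_le1.
- by rewrite subr_gt0 xi0N.
- by rewrite sqmod_gt0; have [] := ang _ jK.
Qed.

Lemma contract_cover (p : CJ * TJ) c : cover p -> 0 <= c <= 1 -> cover (contract_val p c).
Proof.
move=> cp c01; have [lp ang th0] := cp; have rad := contract_radius cp c01.
have [xi xiP] := level_moment cI lp; split=> /=.
- apply: (@level_of_moment _ _ _ _ _ _ (c ^+ 2 *: xi + (1 - c ^+ 2) *: xi0)) => j /=.
  rewrite pairingDl !pairingZl xiP; case: ifP => [jK|/negbT jK].
    by rewrite sqmodM sqmod_real xi0K//; ring.
  rewrite sqmodM sqmod_expi1 mulr1 sqmod_real sqr_sqrtr; last by rewrite ltW// rad.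
  by ring.
- move=> j jK; rewrite (negbTE jK); have r0 := rad j jK; split.
    by rewrite mulf_neq0 ?expi_neq0// -sqmod_gt0 sqmod_real exprn_gt0// sqrtr_gt0.
  by rewrite sqmodM sqmod_expi1 mulr1 sqmod_real sqrtr_sqr ger0_norm// sqrtr_ge0.
- by move=> j /th0 ->; rewrite mulr0.
Qed.

Definition contract (p : cover) (t : R) : cover :=
  mk_sub (contract_cover (set_mem (valP p)) (shrink_bound t)).

Lemma contract_continuous : continuous (fun q : cover * R => contract q.1 q.2).
Proof.
move=> [p t]; apply: sub_continuous_at; apply: for_cvg => F FF Fpt.
have [c1 c2] := cvg_cover _ (cvg_pr1 Fpt).
have ct := cvg_pr2 Fpt.
have cs : (fun q : cover * R => shrink q.2 : R^o) @ F --> (shrink t : R^o).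
  rewrite /shrink expr2; under eq_fun do rewrite expr2.
  have cc : (fun q : cover * R => cos (pi / 2 * q.2) : R^o) @ F -->
      (cos (pi / 2 * t) : R^o).
    apply: cvg_comp; last exact: continuous_cos.
    by apply: cvgM; [exact: cvg_cst|exact: ct].
  exact: cvgM.
have cs2 : (fun q : cover * R => shrink q.2 ^+ 2 : R^o) @ F --> (shrink t ^+ 2 : R^o).
  by rewrite expr2; under eq_fun do rewrite expr2; exact: cvgM.
apply: cvg_to_cover => j /=; last by apply: cvgM => //; exact: c2.
case: ifP => _; first by apply: cvg_mulc; [exact: cvg_realc|exact: c1].
apply: cvg_mulc; last by apply: cvg_expi; apply: cvgM => //; exact: c2.
apply: cvg_realc; apply: cvg_sqrt; apply: cvgD.
  by apply: cvgM => //; apply: cvg_sqmod; exact: c1.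
by apply: cvgM; [apply: cvgB => //; exact: cvg_cst|exact: cvg_cst].
Qed.

Lemma cover_simply_connected : simply_connected R cover.
Proof.
have c0 : cover ((fun j => ((Num.sqrt (pairing xi0 (X j) - lam j))%:C)%C) : CJ,
    (fun=> 0) : TJ).
  have s0 j : 0 <= pairing xi0 (X j) - lam j.
    have [/xi0K ->|/xi0N/ltW] := boolP (j \in K); rewrite ?subrr// subr_ge0//.
  split=> //= [|j jK].
    by apply: (level_of_moment (xi := xi0)) => j; rewrite sqmod_real sqr_sqrtr// subrK.
  have r0 : 0 < Num.sqrt (pairing xi0 (X j) - lam j) by rewrite sqrtr_gt0 subr_gt0 xi0N.
  split; first by rewrite -sqmod_gt0 sqmod_real exprn_gt0.
  by rewrite expi0 mulr1 sqmod_real sqrtr_sqr gtr0_norm.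
apply: (@contractible_simply_connected _ _ contract (mk_sub c0)).
- exact: contract_continuous.
- move=> p; apply: val_inj => /=; rewrite shrink0 [RHS]surjective_pairing.
  have [_ ang _] := set_mem (valP p); congr (_, _); apply/funext => j.
    case: ifP => [_|/negbT jK]; first by rewrite mul1r.
    rewrite expr1n mul1r subrr mul0r addr0 mul1r.
    by have [_ <-] := ang _ jK.
  by rewrite mul1r.
- move=> p; apply: val_inj => /=; rewrite shrink1.
  congr (_, _); apply/funext => j; last by rewrite mul0r.
  case: ifP => [jK|/negbT jK].
    by rewrite mul0r xi0K// subrr sqrtr0.
  by rewrite expr0n/= mul0r add0r subr0 mul1r mul0r expi0 mulr1.
Qed.

End Contraction.

(** * Changes of charts *)

Section ComplexSmooth.
Variables (R : realType) (U : normedModType R) (W : set U).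
Hypothesis oW : open W.
Implicit Types (f g : U -> R[i]^o) (x : U -> R^o).

(** Complex-valued maps are treated by real and imaginary parts, because [Ck] asks for a target
    normed over [R], while [R[i]^o] is normed over [R[i]]. *)
Definition Cck k f := Ck k W (fun y => complex.Re (f y) : R^o) /\
  Ck k W (fun y => complex.Im (f y) : R^o).

Lemma CkN k x : Ck k W x -> Ck k W (fun y => - x y : R^o).
Proof.
move=> cx; apply: Ck_eq (CkM oW (Ck_cst oW k (-1 : R^o)) cx) => // y _.
by rewrite mulN1r.
Qed.

Lemma CkB k x x' : Ck k W x -> Ck k W x' -> Ck k W (fun y => x y - x' y : R^o).
Proof. by move=> cx cx'; apply: (CkD oW cx); exact: CkN. Qed.

Lemma Cck_mul k f g : Cck k f -> Cck k g -> Cck k (fun y => f y * g y).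
Proof.
move=> [fr fi] [gr gi]; split.
  by under eq_fun do rewrite Re_mul; apply: CkB; apply: CkM.
by under eq_fun do rewrite Im_mul; apply: CkD => //; apply: CkM.
Qed.

Lemma Cck_expi k x : Ck k W x -> Cck k (fun y => expi (x y)).
Proof.
move=> cx; have c2 : Ck k W (fun y => 2 * pi * x y : R^o).
  by apply: CkM => //; exact: Ck_cst.
have [cc cs] := Ck_trig R k; split.
  exact: (@Ck_comp _ _ _ oW k setT (@cos R) (fun y => 2 * pi * x y) (@openT _)).
exact: (@Ck_comp _ _ _ oW k setT (@sin R) (fun y => 2 * pi * x y) (@openT _)).
Qed.

Lemma Cck_real k x : Ck k W x -> Cck k (fun y => ((x y)%:C)%C).
Proof. by move=> cx; split=> //; exact: (Ck_cst oW k (0 : R^o)). Qed.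

Lemma Cck_cst k z : Cck k (fun=> z).
Proof. by split; exact: Ck_cst. Qed.

Lemma Ck_sqmod k f : Cck k f -> Ck k W (fun y => sqmod (f y) : R^o).
Proof.
move=> [fr fi]; rewrite /sqmod; under eq_fun do rewrite !expr2.
by apply: CkD => //; apply: CkM.
Qed.

Lemma Ck_thloc k f t0 : (forall y, W y -> 0 < complex.Re (f y * expi (- t0))) ->
  Cck k f -> Ck k W (fun y => thloc t0 (f y) : R^o).
Proof.
move=> pos cf; have [wr wi] := Cck_mul cf (Cck_cst k (expi (- t0))).
apply: CkD => //; first exact: Ck_cst.
apply: CkM => //; last exact: Ck_cst.
apply: (@Ck_comp _ _ _ oW k setT (@atan R) _ (@openT _)) => //; first exact: Ck_atan.
apply: CkM => //; apply: (@Ck_comp _ _ _ oW k _ _ _ (@open_neq0 R) _ (Ck_inv R k)) => //.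
by move=> y Wy /=; rewrite gt_eqF// pos.
Qed.

Lemma Ck_of_cc k m (f : U -> 'I_m -> R[i]^o) :
  (forall a, Cck k (fun y => f y a)) -> Ck k W (fun y => of_cc (f y)).
Proof.
move=> cf; apply: Ck_row => // j; rewrite /of_cc.
under eq_fun do rewrite mxE.
by case: splitP => a _; under eq_fun do rewrite mxE; have [] := cf a.
Qed.

End ComplexSmooth.

Lemma CkS (R : realType) (U V : normedModType R) k (W W' : set U) (f : U -> V) :
  W' `<=` W -> Ck k W f -> Ck k W' f.
Proof.
move=> sW; elim: k f => [|k IH] f; first by move=> cf x /sW; exact: cf.
by move=> [df cf]; split=> [x /sW|u]; [exact: df|apply: IH; exact: cf].
Qed.

(** * Rotations by a variable phase and the symplectic form *)

Section Wedge.
Variables (R : realType) (U : normedModType R).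
Implicit Types (f g : U -> R[i]^o) (x : U -> R^o) (p u v w : U).

Definition Dr x p u : R := 'd x p u.

Lemma Dr_cst (c : R) p u : Dr (fun=> c) p u = 0.
Proof. exact: diff_cst_val. Qed.

Lemma DrD x x' p u : differentiable x p -> differentiable x' p ->
  Dr (fun q => x q + x' q) p u = Dr x p u + Dr x' p u.
Proof. exact: diffD_val. Qed.

Lemma DrB x x' p u : differentiable x p -> differentiable x' p ->
  Dr (fun q => x q - x' q) p u = Dr x p u - Dr x' p u.
Proof. exact: diffB_val. Qed.

Lemma DrM x x' p u : differentiable x p -> differentiable x' p ->
  Dr (fun q => x q * x' q) p u = x p * Dr x' p u + x' p * Dr x p u.
Proof. exact: diffM_val. Qed.

Lemma Dr_sum (I : finType) (x : I -> U -> R^o) p u :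
  (forall i, differentiable (x i) p) ->
  Dr (fun q => \sum_i x i q) p u = \sum_i Dr (x i) p u.
Proof. by move=> dx; have [_ h] := diff_sum_val dx; exact: h. Qed.

Lemma Dr_comp (phi : R^o -> R^o) x (d : R) p u : differentiable x p ->
  is_derive (x p : R^o) 1 phi d -> Dr (fun q => phi (x q)) p u = Dr x p u * d.
Proof. by move=> dx dphi; have [_ h] := diff_comp_scalar dx dphi; exact: h. Qed.

Lemma Dr_near x x' p u : (\forall q \near p, x q = x' q) -> differentiable x p ->
  Dr x p u = Dr x' p u.
Proof.
by move=> xy dx; have [_ h] := diff_near_eq xy dx; exact: (congr1 (fun f : U -> R^o => f u) (esym h)).
Qed.

Definition cdiff f p := differentiable (fun y => complex.Re (f y) : R^o) p /\
  differentiable (fun y => complex.Im (f y) : R^o) p.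

(** The 2-form [d(Im f) /\ d(Re f)], which is pi times the pull-back by [f] of the standard form of
    one complex coordinate. *)
Definition wedge f p u v : R :=
  Dr (fun y => complex.Im (f y)) p u * Dr (fun y => complex.Re (f y)) p v -
  Dr (fun y => complex.Re (f y)) p u * Dr (fun y => complex.Im (f y)) p v.

Lemma wedge_real x p u v : wedge (fun q => ((x q)%:C)%C) p u v = 0.
Proof. by rewrite /wedge /= !Dr_cst mul0r mulr0 subrr. Qed.

Lemma wedge_near f g p u v : (\forall y \near p, f y = g y) -> cdiff f p ->
  wedge f p u v = wedge g p u v.
Proof.
move=> fg [dr di].
have er w : Dr (fun y => complex.Re (f y)) p w = Dr (fun y => complex.Re (g y)) p w.
  by apply: Dr_near dr; apply: filterS fg => y ->.
have ei w : Dr (fun y => complex.Im (f y)) p w = Dr (fun y => complex.Im (g y)) p w.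
  by apply: Dr_near di; apply: filterS fg => y ->.
by rewrite /wedge !er !ei.
Qed.

Lemma Dr_rot f x p w : cdiff f p -> differentiable x p ->
  Dr (fun y => complex.Re (expi (x y) * f y)) p w =
    cos (2 * pi * x p) * Dr (fun y => complex.Re (f y)) p w -
    sin (2 * pi * x p) * Dr (fun y => complex.Im (f y)) p w -
    2 * pi * Dr x p w * (sin (2 * pi * x p) * complex.Re (f p) +
      cos (2 * pi * x p) * complex.Im (f p)) /\
  Dr (fun y => complex.Im (expi (x y) * f y)) p w =
    cos (2 * pi * x p) * Dr (fun y => complex.Im (f y)) p w +
    sin (2 * pi * x p) * Dr (fun y => complex.Re (f y)) p w +
    2 * pi * Dr x p w * (cos (2 * pi * x p) * complex.Re (f p) -
      sin (2 * pi * x p) * complex.Im (f p)).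
Proof.
move=> [dr di] dx.
have dk : differentiable (fun=> 2 * pi : R^o) p by exact: differentiable_cst.
have d2 : differentiable (fun y => 2 * pi * x y : R^o) p by exact: differentiableM.
have d2E : Dr (fun y => 2 * pi * x y) p w = 2 * pi * Dr x p w.
  by rewrite (DrM w dk dx) Dr_cst mulr0 addr0.
have [dc _] := diff_comp_scalar d2 (is_derive_cos (2 * pi * x p)).
have [ds _] := diff_comp_scalar d2 (is_derive_sin (2 * pi * x p)).
have dcE := Dr_comp w d2 (is_derive_cos (2 * pi * x p)).
have dsE := Dr_comp w d2 (is_derive_sin (2 * pi * x p)).
have dM (a b : U -> R^o) : differentiable a p -> differentiable b p ->
    differentiable (fun y => a y * b y : R^o) p by exact: differentiableM.
split.
  under eq_fun do rewrite Re_mul /=.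
  rewrite (DrB w (dM _ _ dc dr) (dM _ _ ds di)) (DrM w dc dr) (DrM w ds di) dcE dsE d2E.
  move: (Dr (fun y => complex.Re (f y)) p w) (Dr (fun y => complex.Im (f y)) p w) (Dr x p w).
  by move=> A B C; ring.
under eq_fun do rewrite Im_mul /=.
rewrite (DrD w (dM _ _ dc di) (dM _ _ ds dr)) (DrM w dc di) (DrM w ds dr) dcE dsE d2E.
move: (Dr (fun y => complex.Re (f y)) p w) (Dr (fun y => complex.Im (f y)) p w) (Dr x p w).
by move=> A B C; ring.
Qed.

Lemma Dr_sqmod f p w : cdiff f p -> Dr (fun y => sqmod (f y)) p w =
  2 * (complex.Re (f p) * Dr (fun y => complex.Re (f y)) p w +
       complex.Im (f p) * Dr (fun y => complex.Im (f y)) p w).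
Proof.
move=> [dr di]; have dM (a : U -> R^o) : differentiable a p ->
    differentiable (fun y => a y * a y : R^o) p by move=> da; exact: differentiableM.
rewrite /sqmod; under eq_fun do rewrite !expr2.
rewrite (DrD w (dM _ dr) (dM _ di)) (DrM w dr dr) (DrM w di di).
by move: (Dr (fun y => complex.Re (f y)) p w) (Dr (fun y => complex.Im (f y)) p w) => A B; ring.
Qed.

(** In polar form the wedge is minus one half of [d|f|^2 /\ d(theta)], and the rotation adds
    [2 pi dx] to [d(theta)]. The computation in real and imaginary parts also covers the zeros of
    [f]. *)
Lemma wedge_rot f x p u v : cdiff f p -> differentiable x p ->
  wedge (fun y => expi (x y) * f y) p u v = wedge f p u v - pi *
    (Dr (fun y => sqmod (f y)) p u * Dr x p v -
     Dr (fun y => sqmod (f y)) p v * Dr x p u).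
Proof.
move=> df dx; have [rE iE] := (fun w => (Dr_rot w df dx).1, fun w => (Dr_rot w df dx).2).
have := cos2Dsin2 (2 * pi * x p).
rewrite /wedge !rE !iE !(Dr_sqmod _ df).
move: (cos _) (sin _) (complex.Re (f p)) (complex.Im (f p)) (Dr (fun y => complex.Re (f y)) p u)
  (Dr (fun y => complex.Re (f y)) p v) (Dr (fun y => complex.Im (f y)) p u)
  (Dr (fun y => complex.Im (f y)) p v) (Dr x p u) (Dr x p v) => c s r i A A' B B' y y' cs.
transitivity ((c ^+ 2 + s ^+ 2) * ((B + 2 * pi * y * r) * (A' - 2 * pi * y' * i) -
  (A - 2 * pi * y * i) * (B' + 2 * pi * y' * r))); first by ring.
by rewrite cs; ring.
Qed.

Lemma std_form_diff_of_cc m (f : U -> 'I_m -> R[i]^o) p u v :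
  differentiable (fun y => of_cc (f y)) p ->
  std_form ('d (fun y => of_cc (f y)) p u) ('d (fun y => of_cc (f y)) p v) =
  pi^-1 * \sum_a wedge (fun y => f y a) p u v.
Proof.
move=> df; congr (_ * _); apply: eq_bigr => a _.
have rE w : complex.Re (cc ('d (fun y => of_cc (f y)) p w) a) =
    Dr (fun y => complex.Re (f y a)) p w.
  rewrite /= (diff_coord _ _ df); congr (Dr _ p w); apply/funext => y.
  by rewrite /of_cc row_mxEl mxE.
have iE w : complex.Im (cc ('d (fun y => of_cc (f y)) p w) a) =
    Dr (fun y => complex.Im (f y a)) p w.
  rewrite /= (diff_coord _ _ df); congr (Dr _ p w); apply/funext => y.
  by rewrite /of_cc row_mxEr mxE.
by rewrite !rE !iE.
Qed.

End Wedge.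

Section ChartSmooth.
Variables (R : realType) (n : nat) (J : finType) (X : J -> 'rV[R]_n) (lam : J -> R).
Variables (I : {set J}) (mu : 'cV[R]_n) (e : J -> 'cV[R]_n).
Hypothesis cI : corner X lam I mu e.
Local Notation VI := 'rV[R]_(#|I| + #|I|).
Variable W : set VI.
Hypothesis oW : open W.

Lemma Cck_cc k a : Cck W k (fun v : VI => cc v a).
Proof.
by split; apply: (Ck_linear oW k); [exact: coord_linear|exact: coord_cont|
  exact: coord_linear|exact: coord_cont].
Qed.

Lemma Ck_xi_fun k y : Ck k W (fun v : VI => pairing (xi_fun mu e v) y : R^o).
Proof.
under eq_fun do rewrite xi_funE; apply: (CkD oW); first exact: (Ck_cst oW).
apply: (Ck_sum oW) => a; apply: (CkM oW); last exact: (Ck_cst oW).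
by apply: (Ck_sqmod oW); exact: Cck_cc.
Qed.

Lemma Cck_toric_u k j : W `<=` toric_dom X lam I ->
  Cck W k (fun v : VI => toric_u X lam v j).
Proof.
move=> WD; have [jI|jI] := boolP (j \in I).
  rewrite (_ : (fun v : VI => _) = (fun v : VI => cc v (enum_rank_in jI j))).
    exact: Cck_cc.
  by apply/funext => v; rewrite toric_u_in.
rewrite (_ : (fun v : VI => _) = (fun v : VI =>
    ((Num.sqrt (pairing (xi_fun mu e v) (X j) - lam j))%:C)%C)); last first.
  by apply/funext => v; rewrite (toric_u_out cI).
apply: (Cck_real oW).
apply: (@Ck_comp _ _ _ oW k _ _ _ (@open_pos R) _ (Ck_sqrt R k)).
  by move=> v /WD/(toric_domP cI)/(_ _ jI); rewrite /= subr_gt0.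
by apply: (CkB oW); [exact: Ck_xi_fun|exact: (Ck_cst oW)].
Qed.

End ChartSmooth.

Section Transition.
Variables (R : realType) (n : nat) (J : finType) (X : J -> 'rV[R]_n) (lam : J -> R).
Variables (Ia Ib K : {set J}) (mua mub : 'cV[R]_n) (ea eb : J -> 'cV[R]_n).
Hypothesis ca : corner X lam Ia mua ea.
Hypothesis cb : corner X lam Ib mub eb.
Hypothesis KE : K = Ia :&: Ib.
Local Notation CJ := (CJ R J).
Local Notation TJ := (TJ R J).
Local Notation cova := (cover X lam Ia K).
Local Notation covb := (cover X lam Ib K).
Local Notation Va := 'rV[R]_(#|Ia| + #|Ia|).
Local Notation proja := (@cover_proj R n J X lam Ia K).
Local Notation projb := (@cover_proj R n J X lam Ib K).

Lemma overlap_subl : K \subset Ia. Proof. by rewrite KE subsetIl. Qed.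
Lemma overlap_subr : K \subset Ib. Proof. by rewrite KE subsetIr. Qed.

(** Rotating by the gauge of [Ib] makes the coordinates off [Ib] positive, and the arguments follow
    the rotation. On [K] no argument is recorded, hence the value 0. *)
Definition trans_val (p : CJ * TJ) : CJ * TJ :=
  (rotJ (gauge X Ib eb p.2) p.1,
   (fun j => if j \in K then 0 else p.2 j + gauge X Ib eb p.2 j) : TJ).

Lemma trans_cover p : cova p -> covb (trans_val p).
Proof.
move=> [lp ang th0]; split=> /=.
- by apply/set_mem/rot_level_set/mem_set.
- move=> j jK; rewrite (negbTE jK); have [z0 zE] := ang _ jK.
  split; first by rewrite mulf_neq0// expi_neq0.
  by rewrite sqmod_rotJ /rotJ {1}zE mulrCA -expiD [_ + p.2 j]addrC.
- move=> j; rewrite inE negb_and negbK; case: ifP => //= jK jI.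
  by rewrite gauge_out// addrN.
Qed.

(** The return change of charts rotates back by the same phases; this makes the two lifts inverse to
    each other. *)
Lemma gauge_trans p : cova p ->
  gauge X Ia ea (trans_val p).2 = (fun j => - gauge X Ib eb p.2 j).
Proof.
move=> [_ _ th0]; apply/funext => j; rewrite /gauge.
set x := gauge X Ib eb p.2.
(* [w] is the new vector of arguments minus the gauge, which pi does not see; it is supported on
   [Ia], so the section at [Ia] returns it unchanged. *)
pose w j := if j \in K then p.2 j - x j else p.2 j.
have wE : piX X (trans_val p).2 = piX X w.
  rewrite -[RHS]addr0 -(piX_gauge cb p.2) -piXD; congr piX; apply/funext => i.
  rewrite /w /=; case: ifP => // iK; rewrite subrK.
  by rewrite th0// inE iK.
rewrite wE (lift_basis_supp ca); last first.
  move=> i iI; rewrite /w (negbTE (notin_K overlap_subl iI)) th0//.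
  by rewrite inE (negbTE iI) andbF.
rewrite /w /= -/x -/(gauge X Ib eb p.2 j) -/x; case: ifP => jK; last by rewrite opprD addNKr.
by rewrite th0 ?sub0r ?subr0// inE jK.
Qed.

Definition trans (p : cova) : covb := mk_sub (trans_cover (set_mem (valP p))).

Lemma trans_continuous : continuous trans.
Proof.
move=> p; apply: sub_continuous_at; apply: for_cvg => F FF Fp.
have [c1 c2] := cvg_cover _ Fp.
have cg j : (fun q : cova => gauge X Ib eb (val q).2 j : R^o) @ F -->
    (gauge X Ib eb (val p).2 j : R^o) by exact: cvg_gauge.
apply: cvg_to_cover => j /=; first by apply: cvg_mulc; [apply: cvg_expi; exact: cg|exact: c1].
by case: ifP => _; [exact: cvg_cst|apply: cvgD; [exact: c2|exact: cg]].
Qed.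

Definition trans_loc (t0 : J -> R) (v : Va) : 'rV[R]_(#|Ib| + #|Ib|) :=
  res Ib (rotJ (gauge X Ib eb (th_loc Ia K t0 (toric_u X lam v))) (toric_u X lam v)).

Lemma trans_locE t0 (p : cova) : sheet t0 p -> projb (trans p) = trans_loc t0 (proja p).
Proof.
move=> sp; have cp := set_mem (valP p).
rewrite /trans_loc /cover_proj (cover_u ca overlap_subl cp).
by rewrite (th_loc_unique cp sp).
Qed.

Local Notation H := (@half_planes R n J X lam Ia K).

Lemma sector_open t0 : open (H t0). Proof. exact: (half_planes_open ca). Qed.

Lemma Cck_u k t0 j : Cck (H t0) k (fun v : Va => toric_u X lam v j).
Proof. by apply: (Cck_toric_u ca (@sector_open t0)) => v []. Qed.

Lemma Ck_th_loc k t0 j : Ck k (H t0) (fun v => th_loc Ia K t0 (toric_u X lam v) j : R^o).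
Proof.
rewrite /th_loc; have [jIK|jIK] := boolP (j \in Ia :\: K); last exact: (Ck_cst (@sector_open t0)).
apply: (Ck_thloc (@sector_open t0)); last exact: Cck_u.
by move=> v [_]; exact.
Qed.

Lemma Ck_gauge k (W : set Va) (th : Va -> J -> R) j : open W ->
  (forall i, Ck k W (fun v => th v i : R^o)) ->
  Ck k W (fun v => gauge X Ib eb (th v) j : R^o).
Proof.
move=> oW cth; rewrite /gauge /lift_basis; apply: (CkB oW); last exact: cth.
have [jI|jI] := boolP (j \in Ib); last exact: (Ck_cst oW).
under eq_fun do rewrite pairing_piX.
by apply: (Ck_sum oW) => i; apply: (CkM oW); [exact: cth|exact: (Ck_cst oW)].
Qed.

Lemma trans_loc_smooth t0 : smooth_on (H t0) (trans_loc t0).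
Proof.
move=> k; apply: (Ck_of_cc (@sector_open t0)) => a; apply: (Cck_mul (@sector_open t0)); last exact: Cck_u.
apply: (Cck_expi (@sector_open t0)); apply: Ck_gauge (@sector_open t0) _ => i.
exact: Ck_th_loc.
Qed.

Lemma trans_local_expr (p : cova) :
  local_expr proja projb trans p (sheet (val p).2) (trans_loc (val p).2).
Proof.
split.
- exact: sheet_open.
- by move=> j _; rewrite subrr normr0 invr_gt0.
- move=> k; apply: (CkS _ (@trans_loc_smooth (val p).2 k)) => _ [q sq <-].
  by apply: (cover_half_planes ca overlap_subl) => //; exact: set_mem (valP q).
- by move=> q sq; exact: trans_locE.
Qed.

Section AtPoint.
Variables (t0 : J -> R) (p : Va).
Hypothesis Hp : H t0 p.
Local Notation uj j := (fun v : Va => toric_u X lam v j).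
Local Notation thj j := (fun v : Va => th_loc Ia K t0 (toric_u X lam v) j).
Local Notation xj j := (fun v : Va => gauge X Ib eb (th_loc Ia K t0 (toric_u X lam v)) j).

Lemma cdiff_u j : cdiff (uj j) p.
Proof. by have [[dr _] [di _]] := Cck_u 1 t0 j; split; [exact: dr|exact: di]. Qed.

Lemma diff_th j : differentiable (thj j : Va -> R^o) p.
Proof. by have [d _] := Ck_th_loc 1 t0 j; exact: d. Qed.

Lemma diff_x j : differentiable (xj j : Va -> R^o) p.
Proof.
by have [d _] := Ck_gauge j (@sector_open t0) (fun i => Ck_th_loc 1 t0 i); exact: d.
Qed.

Lemma diff_sqmod (f : Va -> R[i]^o) : cdiff f p ->
  differentiable (fun v => sqmod (f v) : R^o) p.
Proof.
move=> [dr di]; rewrite /sqmod; under eq_fun do rewrite !expr2.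
by apply: differentiableD; apply: differentiableM.
Qed.

Lemma cdiff_cc a : cdiff (fun v : Va => cc v a) p.
Proof.
have dc k : differentiable (fun v : Va => v 0 k : R^o) p.
  by have [] := diff_linear p 0 (@coord_linear R _ k) (@coord_cont R _ k).
by split; exact: dc.
Qed.

(** The gauge is linear in the arguments, so it commutes with differentiation; the differentials of
    the phases again form a vector in the kernel of pi. *)
Lemma Dr_x j u : Dr (xj j) p u = gauge X Ib eb (fun i => Dr (thj i) p u) j.
Proof.
have dM (c : R) i : differentiable (fun v => thj i v * c : R^o) p.
  by apply: differentiableM; [exact: diff_th|exact: differentiable_cst].
have DM (c : R) i : Dr (fun v => thj i v * c) p u = Dr (thj i) p u * c.
  rewrite (DrM u (diff_th i) (differentiable_cst c p)) Dr_cst mulr0 add0r.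
  exact: mulrC.
rewrite /gauge /lift_basis; have [jI|jI] := boolP (j \in Ib).
  under eq_fun do rewrite pairing_piX.
  rewrite (DrB u _ (diff_th j)); last by have [d _] := diff_sum_val (fun i => dM (pairing (eb j) (X i)) i).
  rewrite (Dr_sum u (fun i => dM (pairing (eb j) (X i)) i)) pairing_piX.
  by congr (_ - _); apply: eq_bigr => i _; exact: DM.
by rewrite (DrB u (differentiable_cst 0 p) (diff_th j)) Dr_cst.
Qed.

(** The squared moduli are, up to constants, the values of one moment on the normals, so their
    differentials are the values of one functional. *)
Lemma Dr_sqmod_u : exists ze : Va -> 'cV[R]_n, forall j u,
  Dr (fun v => sqmod (toric_u X lam v j)) p u = pairing (ze u) (X j).
Proof.
pose s a v := sqmod (@cc R #|Ia| v a).
exists (fun u => \sum_a Dr (s a) p u *: ea (enum_val a)) => j u.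
have dM (c : R) a : differentiable (fun v => s a v * c : R^o) p.
  by apply: differentiableM; [exact: diff_sqmod (cdiff_cc a)|exact: differentiable_cst].
have DM (c : R) a : Dr (fun v => s a v * c) p u = Dr (s a) p u * c.
  rewrite (DrM u (diff_sqmod (cdiff_cc a)) (differentiable_cst c p)) Dr_cst mulr0 add0r.
  exact: mulrC.
have ds := diff_sum_val (fun a => dM (pairing (ea (enum_val a)) (X j)) a).
rewrite (@Dr_near _ _ _ (fun v => pairing mua (X j) - lam j +
    \sum_a s a v * pairing (ea (enum_val a)) (X j))); first last.
- exact: diff_sqmod (cdiff_u j).
- have : nbhs p (H t0) by apply: open_nbhs_nbhs; split=> //; exact: sector_open.
  apply: filterS => v [Wv _]; rewrite (sqmod_toric_u ca)// xi_funE.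
  by rewrite addrAC.
rewrite (DrD u (differentiable_cst _ p) ds.1) Dr_cst add0r.
rewrite (Dr_sum u (fun a => dM (pairing (ea (enum_val a)) (X j)) a)) pairing_suml.
by apply: eq_bigr => a _; rewrite DM pairingZl.
Qed.

Lemma wedge_u_real j u v : j \notin Ia -> wedge (uj j) p u v = 0.
Proof.
move=> jI; rewrite (_ : uj j = fun v =>
    ((Num.sqrt (pairing (xi_fun mua ea v) (X j) - lam j))%:C)%C); first exact: wedge_real.
by apply/funext => q; rewrite (toric_u_out ca).
Qed.

(** For [j] off [Ib] the rotated coordinate is a positive real with zero wedge, so the wedge of the
    original one is exactly the correction term of [wedge_rot]. *)
Lemma wedge_u_out j u v : j \notin Ib ->
  wedge (uj j) p u v = pi *
    (Dr (fun q => sqmod (toric_u X lam q j)) p u * Dr (xj j) p v -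
     Dr (fun q => sqmod (toric_u X lam q j)) p v * Dr (xj j) p u).
Proof.
move=> jIb; have xE w : Dr (xj j) p w = - Dr (thj j) p w.
  by rewrite Dr_x gauge_out.
have [jI|jI] := boolP (j \in Ia); last first.
  rewrite wedge_u_real//.
  have th0 w : Dr (thj j) p w = 0.
    rewrite (_ : thj j = fun=> 0); first exact: Dr_cst.
    by apply/funext => q; rewrite /th_loc inE (negbTE jI) andbF.
  by rewrite !xE !th0 oppr0 !mulr0 subrr mulr0.
have jIK : j \in Ia :\: K by rewrite !inE jI KE inE negb_and jIb orbT.
pose r q : R[i]^o := ((Num.sqrt (sqmod (toric_u X lam (q : Va) j)))%:C)%C.
have sE : (fun q => sqmod (r q)) = fun q => sqmod (toric_u X lam q j).
  by apply/funext => q; rewrite /r sqmod_real sqr_sqrtr// sqmod_ge0.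
have u0 : 0 < sqmod (toric_u X lam p j).
  rewrite sqmod_gt0; apply/eqP => u0; have [_ /(_ _ jIK)] := Hp.
  by rewrite u0 mul0r ltxx.
have dr : cdiff r p.
  split; last exact: differentiable_cst.
  by have [] := diff_comp_scalar (diff_sqmod (cdiff_u j)) (is_derive1_sqrt u0).
rewrite (@wedge_near _ _ _ (fun q => expi (thj j q) * r q)); first last.
- exact: cdiff_u.
- have : nbhs p (H t0) by apply: open_nbhs_nbhs; split=> //; exact: sector_open.
  apply: filterS => q [_ /(_ _ jIK) hq]; rewrite /th_loc jIK mulrC.
  exact: thlocE.
rewrite (wedge_rot u v dr (diff_th j)) sE !xE wedge_real.
by move: (Dr (thj j) p u) (Dr (thj j) p v) => A B; ring.
Qed.

(** The corrections cancel in the sum over all of [J], while the two forms are sums over [Ia] and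
    [Ib]. Both sums extend to [J]: off [Ib] the rotated coordinates are real, off [Ia] the original
    ones are. *)
Lemma trans_loc_symplectic u v :
  std_form ('d (trans_loc t0) p u) ('d (trans_loc t0) p v) = std_form u v.
Proof.
have dG : differentiable (trans_loc t0) p by have [d _] := @trans_loc_smooth t0 1; exact: d.
have [ze zeE] := Dr_sqmod_u.
pose w j := wedge (uj j) p u v.
pose tau j := Dr (fun q => sqmod (toric_u X lam q j)) p u * Dr (xj j) p v -
     Dr (fun q => sqmod (toric_u X lam q j)) p v * Dr (xj j) p u.
have tau0 : \sum_j tau j = 0.
  rewrite /tau sumrB.
  have S0 a b : \sum_j Dr (fun q => sqmod (toric_u X lam q j)) p a * Dr (xj j) p b = 0.
    under eq_bigr do rewrite zeE Dr_x mulrC.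
    by rewrite -pairing_piX (piX_gauge cb) pairing0r.
  by rewrite !S0 subrr.
rewrite (std_form_diff_of_cc u v dG).
under eq_bigr do rewrite (wedge_rot u v (cdiff_u _) (diff_x _)).
rewrite -(sum_enum_val Ib (fun j => w j - pi * tau j)) /std_form; congr (_ * _).
transitivity (\sum_j (w j - pi * tau j)).
  rewrite [RHS](bigID (mem Ib))/= [X in _ + X]big1 ?addr0// => j jI.
  by rewrite /w (wedge_u_out u v jI) subrr.
rewrite sumrB -mulr_sumr tau0 mulr0 subr0 (bigID (mem Ia))/= [X in _ + X]big1 ?addr0.
  rewrite sum_enum_val; apply: eq_bigr => a _.
  rewrite /w (_ : uj _ = fun q => cc q a); last by apply/funext => q; rewrite toric_u_ix.
  have dc k b : Dr (fun q : Va => q 0 k) p b = b 0 k.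
    by have [_ h] := diff_linear p b (@coord_linear R _ k) (@coord_cont R _ k).
  by rewrite /wedge !dc.
by move=> j jI; exact: wedge_u_real.
Qed.

End AtPoint.

End Transition.

(** * Open quotient maps, products and subspaces *)

Lemma cls_nbhs (T : topologicalType) (r : T -> T -> Prop) (t : T) (B : set T) :
  (forall A : set T, open A -> open (cls r @` A)) ->
  nbhs t B -> nbhs (cls r t) (cls r @` B).
Proof.
move=> o; rewrite nbhsE => -[C [opC Ct] CB]; rewrite nbhsE; exists (cls r @` C).
  by split; [exact: o|exists t].
exact: image_subset.
Qed.

(** A product of quotient maps need not be a quotient map; openness of the two maps repairs this. *)
Lemma quot_prod_continuous (T1 T2 V : topologicalType) (r1 : T1 -> T1 -> Prop)
    (r2 : T2 -> T2 -> Prop) (f : quot_space r1 * quot_space r2 -> V) :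
  (forall A : set T1, open A -> open (cls r1 @` A)) ->
  (forall A : set T2, open A -> open (cls r2 @` A)) ->
  continuous (fun p : T1 * T2 => f (cls r1 p.1, cls r2 p.2)) -> continuous f.
Proof.
move=> o1 o2 cf [q1 q2] A; rewrite -(cls_rep q1) -(cls_rep q2).
move: (rep q1) (rep q2) => t1 t2 nA.
have [[B1 B2] /= [nB1 nB2] BA] := cf (t1, t2) _ nA.
exists (cls r1 @` B1, cls r2 @` B2).
  by split; apply: cls_nbhs.
by move=> [_ _] /= [[s1 B1s <-] [s2 B2s <-]]; exact: (BA (s1, s2)).
Qed.

(** The lift [h] represents [g] everywhere but may depend on the base point and has to be continuous
    there only. This permits the choice of a vertex and of branches point by point in the cut
    space. *)
Lemma quot_sub_continuous (T1 T2 V : topologicalType) (r1 : T1 -> T1 -> Prop)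
    (r2 : T2 -> T2 -> Prop) (A : set (quot_space r1 * quot_space r2)) (B : set V)
    (r : B -> B -> Prop) (g : A -> quot_space r) :
  (forall C : set T1, open C -> open (cls r1 @` C)) ->
  (forall C : set T2, open C -> open (cls r2 @` C)) ->
  (forall t1 t2, A (cls r1 t1, cls r2 t2) -> exists h : T1 * T2 -> V,
     {for (t1, t2), continuous h} /\
     forall s1 s2 (As : A (cls r1 s1, cls r2 s2)),
       exists b : B, val b = h (s1, s2) /\ g (mk_sub As) = cls r b) ->
  continuous g.
Proof.
move=> o1 o2 gh p.
pose t1 := rep (val p).1; pose t2 := rep (val p).2.
have pE : val p = (cls r1 t1, cls r2 t2) by rewrite !cls_rep -surjective_pairing.
have At : A (cls r1 t1, cls r2 t2) by rewrite -pE; exact: set_mem (valP p).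
have pE' : p = mk_sub At by exact: val_inj.
have [h [ch hP]] := gh _ _ At; have [b [bE gE]] := hP _ _ At.
move=> U; rewrite pE' gE => nU.
have /nbhs_sub[W nW WU] : nbhs b (cls r @^-1` U) by exact: (@cls_continuous _ r b U nU).
have [|[C1 C2] [nC1 nC2] CW] := ch W; first by rewrite -bE.
have nC : nbhs (val p) (cls r1 @` C1 `*` cls r2 @` C2).
  by rewrite pE; exists (cls r1 @` C1, cls r2 @` C2) => //; split; apply: cls_nbhs.
have nq : nbhs p (val @^-1` (cls r1 @` C1 `*` cls r2 @` C2)).
  exact: (@val_continuous _ A p _ nC).
rewrite -pE'; suff : nbhs p (g @^-1` U) by [].
apply: (@filterS _ (nbhs p) (nbhs_filter p) _ _ _ nq) => q [[s1 C1s e1] [s2 C2s e2]].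
have qE : val q = (cls r1 s1, cls r2 s2) by rewrite e1 e2 -surjective_pairing.
have Aq : A (cls r1 s1, cls r2 s2) by rewrite -qE; exact: set_mem (valP q).
have [b' [b'E g'E]] := hP _ _ Aq.
rewrite /= (_ : q = mk_sub Aq) ?g'E; last exact: val_inj.
by apply: WU; rewrite /= -/(val b') b'E; exact: (CW (s1, s2)).
Qed.

(** * The toric quasifold *)

Section Quasilattice.
Variables (R : realType) (n : nat) (Q : set 'rV[R]_n).
Hypothesis QQ : quasilattice Q.

Lemma quasilattice0 : Q 0.
Proof.
by have [k [B [_ ->]]] := QQ; exists 0 => //; rewrite map_mx0 mul0mx.
Qed.

Lemma quasilatticeD a b : Q a -> Q b -> Q (a + b).
Proof.
have [k [B [_ ->]]] := QQ; move=> [c _ <-] [c' _ <-].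
by exists (c + c') => //; rewrite map_mxD mulmxDl.
Qed.

Lemma quasilatticeN a : Q a -> Q (- a).
Proof.
have [k [B [_ ->]]] := QQ; move=> [c _ <-].
by exists (- c) => //; rewrite map_mxN mulNmx.
Qed.

Lemma quasilattice_countable : countable Q.
Proof.
have [k [B [_ ->]]] := QQ.
by apply: (sub_countable (card_image_le _ _)); exact: countableP.
Qed.

End Quasilattice.

Section ToricQuasifold.
Variables (R : realType) (n : nat) (Q : set 'rV[R]_n).
Hypothesis QQ : quasilattice Q.
Variables (J : finType) (X : J -> 'rV[R]_n) (lam : J -> R) (P : set 'cV[R]_n).
Hypothesis sP : simple_pointed P.
Hypothesis qP : quasirational Q P X lam.
Let Q0 := quasilattice0 QQ.
Let QD := quasilatticeD QQ.
Let QN := quasilatticeN QQ.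
Local Notation L := (level_set X lam).
Local Notation N := (@N_rel R n Q J X lam).
Local Notation S := (toric_space Q X lam).
Local Notation A := (toric_charts Q P X lam).

Lemma vertex_corner mu : vertex P mu ->
  exists e, corner X lam (active X lam mu) mu e.
Proof.
move=> vmu; have [PE _ _] := qP; have := vmu; rewrite {1}PE => vh.
have [e de] := exists_dual_basis (card_active_vertex qP sP vmu) (@vertex_active_span _ _ _ _ _ _ vh).
exists e; split=> // j; rewrite activeE; first by move/eqP.
move=> ne; rewrite lt_neqAle eq_sym ne /=.
by have := vertex_in vh; exact.
Qed.

Lemma toric_corner : exists I mu e, @corner R n J X lam I mu e.
Proof.
by have [_ _ [mu /vertex_corner[e ce]] _] := sP; exists (active X lam mu), mu, e.
Qed.

Lemma toric_span v : (forall j, pairing v (X j) = 0) -> v = 0.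
Proof.
move=> h; have [I [mu [e ce]]] := toric_corner; apply: (corner_inj ce) => i _.
by rewrite h /pairing mulmx0 mxE.
Qed.

Lemma toric_interior : exists xi, forall j, lam j < pairing xi (X j).
Proof.
have [PE _ _] := qP; have [_ dP _ _] := sP.
by apply: has_dim_interior; [exact: quasirational_nonzero qP dP|rewrite -PE].
Qed.

Lemma moment_point xi : P xi ->
  exists z : L, forall j, val z j = ((Num.sqrt (pairing xi (X j) - lam j))%:C)%C.
Proof.
have [PE _ _] := qP; rewrite PE => Pxi.
have zl : L (fun j => ((Num.sqrt (pairing xi (X j) - lam j))%:C)%C).
  apply: (level_of_moment (xi := xi)) => j.
  by rewrite sqmod_real sqr_sqrtr ?subr_ge0 ?subrK.
by exists (mk_sub zl).
Qed.

Lemma moment_in (z : L) xi : moment_set X lam (val z) xi -> P xi.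
Proof.
by have [-> _ _] := qP; move=> h j; rewrite h lerDr sqmod_ge0.
Qed.

(** All facets through the moment of [z] pass through the chosen vertex, so off its active set no
    coordinate of [z] vanishes. *)
Lemma charts_cover (s : S) : exists a, range (ch_map A a) s.
Proof.
have [PE _ _] := qP; have [I [mu [e ce]]] := toric_corner.
rewrite -(cls_rep s); move: (rep s) => z.
have [xi xiP] := level_moment ce (set_mem (valP z)).
have Pxi : halfspaces X lam xi by rewrite -PE; exact: moment_in xiP.
have [nu vnu sub] := exists_vertex_active Pxi toric_span.
rewrite -PE in vnu; exists (exist _ nu vnu); have [e' ce'] := vertex_corner vnu.
apply/(range_chart Q0 QD QN ce') => j jI; rewrite -sqmod_gt0.
rewrite -(ltrD2r (lam j)) -xiP add0r lt_neqAle Pxi andbT eq_sym -activeE.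
by apply: contra jI; move: (j); exact/fintype.subsetP.
Qed.

Lemma chart_overlap (Ia Ib : {set J}) mua mub ea eb :
  corner X lam Ia mua ea -> corner X lam Ib mub eb ->
  [set val x | x in [set x : toric_dom X lam Ia |
     range (@toric_chart R n Q J X lam Ib) (toric_chart (cls (orbit_rel (toric_grp Q X Ia)) x))]] =
  locus X lam (Ia :&: Ib).
Proof.
move=> ca cb; apply/seteqP; split=> [_ [x + <-]|v [Wv v0]].
  rewrite /= (chartE Q0 QD QN ca) => /(range_chart Q0 QD QN cb) h.
  split=> [|j]; first exact: set_mem (valP x).
  by rewrite !inE negb_and => /andP[/orP[/negbTE->//|jb] ja]; exact: h.
exists (mk_sub Wv) => //=; rewrite (chartE Q0 QD QN ca); apply/(range_chart Q0 QD QN cb).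
move=> j jb /=; have [ja|ja] := boolP (j \in Ia); first by apply: v0; rewrite !inE ja jb.
by have [] := toric_u_positive_off ca Wv ja.
Qed.

Lemma transK (Ia Ib K : {set J}) mua mub ea eb (ca : corner X lam Ia mua ea)
    (cb : corner X lam Ib mub eb) (KE : K = Ia :&: Ib) :
  cancel (@trans R n J X lam Ia Ib K eb) (@trans R n J X lam Ib Ia K ea).
Proof.
move=> p; apply: val_inj; have cp := set_mem (valP p).
rewrite [RHS]surjective_pairing [LHS]/= {1}/trans_val (gauge_trans ca cb KE cp).
congr (_, _); apply/funext => j /=.
  by rewrite /rotJ expiNK.
have [jK|jK] := boolP (j \in K); last by rewrite addrK.
by have [_ _ th0] := cp; rewrite th0// inE jK.
Qed.

Lemma trans_chart (Ia Ib K : {set J}) mua mub ea eb (ca : corner X lam Ia mua ea)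
    (cb : corner X lam Ib mub eb) (KE : K = Ia :&: Ib)
    (p : cover X lam Ia K) (x : toric_dom X lam Ia) (y : toric_dom X lam Ib) :
  val x = cover_proj p -> val y = cover_proj (trans Ib eb p) ->
  toric_chart (cls (orbit_rel (toric_grp Q X Ia)) x) =
  toric_chart (cls (orbit_rel (toric_grp Q X Ib)) y).
Proof.
move=> xp yp; rewrite (chartE Q0 QD QN ca) (chartE Q0 QD QN cb).
apply/(toric_cls_eq Q0 QD QN); exists (gauge X Ib eb (val p).2).
  by rewrite (piX_gauge cb).
have cp := set_mem (valP p).
apply: val_inj => /=; rewrite xp yp (cover_u ca (overlap_subl KE) cp).
exact: (cover_u cb (overlap_subr KE) (trans_cover Ib eb cp)).
Qed.

Lemma toric_symplectic_quasifold : symplectic_quasifold A (n + n).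
Proof.
have [_ QX _] := qP; split.
- move=> [mu vmu]; split; first by rewrite /= (card_active_vertex qP sP vmu).
  have [e ce] := vertex_corner vmu.
  exact: (toric_quasifold_model Q0 QD QN (quasilattice_countable QQ) ce toric_interior).
- move=> [mu vmu] /=; have [e ce] := vertex_corner vmu; split.
  + exact: (chart_injective Q0 QD QN ce QX).
  + exact: (chart_continuous Q0 QD QN ce).
  + by move=> O; exact: (chart_open Q0 QD QN ce QX).
- exact: charts_cover.
- move=> [mu vmu] /=; have [e ce] := vertex_corner vmu; split.
    exact: (toric_symplectic_form ce).
  by move=> g x u v; exact: toric_form_invariant.
move=> [mua va] [mub vb] _; have [ea ca] := vertex_corner va; have [eb cb] := vertex_corner vb.
set Ia := active X lam mua in ca *; set Ib := active X lam mub in cb *.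
pose K := Ia :&: Ib; have KE' : K = Ib :&: Ia by rewrite /K finset.setIC.
(* The midpoint of the two vertices is tight exactly on their common facets, and serves as the
   centre of contraction for both covers. *)
have [xi0 xi0K xi0N] : exists2 xi0, forall j, j \in K -> pairing xi0 (X j) = lam j &
    forall j, j \notin K -> lam j < pairing xi0 (X j).
  have [_ aK aN] := ca; have [_ bK bN] := cb.
  have aG j : lam j <= pairing mua (X j).
    by have [/aK ->|/aN/ltW] := boolP (j \in Ia).
  have bG j : lam j <= pairing mub (X j).
    by have [/bK ->|/bN/ltW] := boolP (j \in Ib).
  exists (2^-1 *: mua + 2^-1 *: mub) => j; rewrite inE pairingDl !pairingZl.
    by move=> /andP[ja jb]; rewrite aK// bK//; lra.
  rewrite negb_and => /orP[/aN h|/bN h]; first by have := bG j; lra.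
  by have := aG j; lra.
have oab : @overlap R S A (exist _ mua va) (exist _ mub vb) = locus X lam K.
  exact: chart_overlap ca cb.
have oba : @overlap R S A (exist _ mub vb) (exist _ mua va) = locus X lam K.
  by rewrite KE'; exact: chart_overlap cb ca.
exists (cover X lam Ia K), (cover X lam Ib K), (@cover_proj R n J X lam Ia K),
  (@cover_proj R n J X lam Ib K), (@trans R n J X lam Ia Ib K eb); split; last first.
  move=> p; exists (sheet (val p).2), (trans_loc X lam Ib K eb (val p).2); split.
    exact: (trans_local_expr eb ca erefl).
  move=> u v; apply: (trans_loc_symplectic ca cb erefl).
  apply: (cover_half_planes ca (overlap_subl erefl) (set_mem (valP p))) => j _.
  by rewrite subrr normr0 invr_gt0.
split.
- rewrite oab; split; first exact: (cover_simply_connected ca xi0K xi0N).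
  exact: (cover_covering ca (overlap_subl erefl)).
- rewrite oba; split; first exact: (cover_simply_connected cb xi0K xi0N).
  exact: (cover_covering cb (overlap_subr erefl)).
- exists (@trans R n J X lam Ib Ia K ea); split.
  + exact: (transK ca cb erefl).
  + exact: (transK cb ca KE').
  + exact: trans_continuous.
  + exact: trans_continuous.
  + split=> p.
      exists (sheet (val p).2), (trans_loc X lam Ib K eb (val p).2).
      exact: (trans_local_expr eb ca erefl).
    exists (sheet (val p).2), (trans_loc X lam Ia K ea (val p).2).
    exact: (trans_local_expr ea cb KE').
- by move=> p x y; exact: (trans_chart ca cb erefl).
Qed.

Lemma expD_open (B : set 'rV[R]_n) : open B -> open (expD Q @` B).
Proof.
apply: cls_open => [y|y y'|y y' y'' h h'|y y' Qy].
- by rewrite subrr; exact: Q0.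
- by move=> /QN; rewrite opprB.
- by have := QD h h'; rewrite addrC addrA subrK.
- exists (fun t => t + (y - y')); split; last by move=> t; rewrite addrAC subrr add0r -opprB; exact: QN.
    by apply: for_cvg => F FF Fy; apply: cvgD => //; exact: cvg_cst.
  by rewrite addrC subrK.
Qed.

Lemma toric_effective : effective_action (@toric_act R n Q J X lam).
Proof.
have [_ QX _] := qP; have [I [mu [e ce]]] := toric_corner.
have actE y z : toric_act (expD Q y) (cls N z) = cls N (rotL (lift_basis I e y) z).
  by apply: (toric_actE Q0 QD QN ce); rewrite (piX_lift_basis ce) subrr; exact: Q0.
split.
- move=> s; rewrite -(cls_rep s) (toric_actE Q0 QD QN ce (x := fun=> 0)); last first.
    by rewrite piX0 subrr; exact: Q0.
  by rewrite rotL0.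
- move=> y y' s; rewrite -(cls_rep s) !actE -rotLD; congr (cls N (rotL _ _)).
  apply/funext => j; rewrite /lift_basis; case: ifP => _; last by rewrite addr0.
  by rewrite pairingDr.
- apply: quot_prod_continuous; [exact: expD_open|exact: (toric_cls_open Q0 QD QN)|].
  rewrite (_ : (fun p => _) = cls N \o (fun p : 'rV[R]_n * L => rotL (lift_basis I e p.1) p.2)).
    move=> p; apply: continuous_comp; last exact: cls_continuous.
    apply: sub_continuous_at; apply: for_cvg => F FF Fp; apply: cvg_rotJ => j.
      by apply: cvg_val; exact: cvg_pr2 Fp.
    have c1 := cvg_pr1 Fp.
    rewrite /lift_basis; case: ifP => _; last exact: cvg_cst.
    rewrite (_ : (fun p : 'rV[R]_n * L => pairing (e j) p.1) = fun p : 'rV[R]_n * L =>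
      \sum_k p.1 0 k * e j k 0); last by apply/funext => q; rewrite /pairing mxE.
    rewrite /pairing mxE; apply: cvg_sumr => k _; apply: cvgM; last exact: cvg_cst.
    by apply: (cvg_comp _ (fun v : 'rV[R]_n => v 0 k : R^o) c1); exact: coord_cont.
  by apply/funext => -[y z] /=; exact: actE.
(* Effectiveness is tested at a point over the interior of the polyhedron, where no coordinate
   vanishes: a rotation that fixes its orbit has integer phases up to an element of [N]. *)
move=> y yfix; have [xi xiP] := toric_interior.
have Pxi : P xi by have [-> _ _] := qP; move=> j; rewrite ltW.
have [z zE] := moment_point Pxi.
have := yfix (cls N z); rewrite actE => /(toric_cls_eq Q0 QD QN)[x Qx /(congr1 val) zx].
apply/(expD_eq Q0 QD QN); rewrite sub0r; apply: QN.
have /choice[k kP] : forall j, exists k : int, x j + lift_basis I e y j = k%:~R.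
  move=> j; apply: expi_eq1; have := congr1 (fun f => f j) zx.
  have z0 : val z j != 0.
    by rewrite zE -sqmod_gt0 sqmod_real exprn_gt0// sqrtr_gt0 subr_gt0.
  rewrite /= /rotJ mulrA -expiD => h; apply: (mulIf z0).
  by rewrite mul1r -h.

have : Q (piX X (fun j => x j + lift_basis I e y j)).
  rewrite /piX; elim/big_ind: _; [exact: Q0|exact: QD|].
  by move=> j _; rewrite kP; exact: (Qint Q0 QD QN).
rewrite piXD (piX_lift_basis ce) => h.
by have := QD h (QN Qx); rewrite addrAC subrr add0r.
Qed.

(** * Hamiltonian flows in a chart *)

Section Flow.
Variables (I : {set J}) (mu : 'cV[R]_n) (e : J -> 'cV[R]_n) (y : 'rV[R]_n).
Hypothesis cI : corner X lam I mu e.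
Local Notation VI := 'rV[R]_(#|I| + #|I|).
Local Notation ya a := (pairing (e (enum_val a)) y).

Definition flow (t : R) (v : VI) : VI := of_cc (fun a => expi (t * ya a) * cc v a).

Definition flow_field (v : VI) : VI :=
  of_cc (fun a => (0 +i* (2 * pi * ya a))%C * cc v a).

Definition hamiltonian (v : VI) : R^o := pairing (xi_fun mu e v) y.

Lemma flow_field_smooth W : open W -> smooth_on W flow_field.
Proof.
move=> oW k; apply: (Ck_of_cc oW) => a; apply: (Cck_mul oW); first exact: (Cck_cst oW).
exact: (Cck_cc oW).
Qed.

Lemma flow_derive t v :
  is_derive (t : R^o) 1 (fun s : R^o => flow s v : VI) (flow_field (flow t v)).
Proof.
have oT : open [set: R^o] by exact: openT.
have dx a : differentiable (fun s : R^o => s * ya a : R^o) t /\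
    Dr (fun s : R^o => s * ya a) t 1 = ya a.
  have [|s' |d dE] := @diff_linear R R^o R^o (fun s => s * ya a) t 1.
  - by move=> c x x' /=; rewrite mulrDl -mulrA.
  - by apply: for_cvg => F FF Fs; apply: cvgM => //; exact: cvg_cst.
  - by split=> //; rewrite /Dr dE mul1r.
have df : differentiable (fun s : R^o => flow s v : VI) t.
  have [d _] : Ck 1 setT (fun s : R^o => flow s v : VI); last exact: d.
  apply: (Ck_of_cc oT) => a; apply: (Cck_mul oT); last exact: (Cck_cst oT).
  apply: (Cck_expi oT); apply: (CkM oT); last exact: (Ck_cst oT).
  apply: (Ck_linear oT) => //.
  by move=> s; exact: cvg_id.
apply: DeriveDef; first exact: diff_derivable.
rewrite deriveE//; apply/rowP => i; rewrite (diff_coord _ _ df).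
have cst z : cdiff (fun _ : R^o => z : R[i]^o) t by split; exact: differentiable_cst.
have dr a := Dr_rot (1 : R^o) (cst (cc v a)) (dx _ a).1.
rewrite /flow_field mxE; case: splitP => a ia; rewrite mxE cc_of_cc.
  transitivity (Dr (fun s : R^o => complex.Re (expi (s * ya a) * cc v a)) t 1).
    congr (Dr _ t 1); apply/funext => s; rewrite /flow.
    by rewrite (_ : i = lshift _ a) ?row_mxEl ?mxE//; apply: val_inj.
  rewrite (dr a).1 !Dr_cst (dx _ a).2 Re_mul Im_mul /=; ring.
transitivity (Dr (fun s : R^o => complex.Im (expi (s * ya a) * cc v a)) t 1).
  congr (Dr _ t 1); apply/funext => s; rewrite /flow.
  by rewrite (_ : i = rshift _ a) ?row_mxEr ?mxE//; apply: val_inj.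
rewrite (dr a).2 !Dr_cst (dx _ a).2 Im_mul Re_mul /=; ring.
Qed.

Lemma hamiltonian_diff v u : 'd hamiltonian v u = std_form (flow_field v) u.
Proof.
have dc (a : 'I_#|I|) : cdiff (fun v : VI => cc v a) v.
  exact: cdiff_cc.
have dcE k : Dr (fun v : VI => v 0 k) v u = u 0 k.
  by have [_ h] := diff_linear v u (@coord_linear R _ k) (@coord_cont R _ k).
have dM (a : 'I_#|I|) : differentiable (fun v : VI => sqmod (cc v a) * ya a : R^o) v.
  by apply: differentiableM; [exact: diff_sqmod|exact: differentiable_cst].
have -> : hamiltonian = fun v : VI => pairing mu y + \sum_a sqmod (cc v a) * ya a.
  by apply/funext => w; rewrite /hamiltonian xi_funE.
rewrite -/(Dr _ v u) (DrD u (differentiable_cst _ v) (diff_sum_val dM).1) Dr_cst add0r.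
rewrite (Dr_sum u dM) /std_form mulr_sumr; apply: eq_bigr => a _.
rewrite /flow_field cc_of_cc Re_mul Im_mul; move: (ya a) => c.
rewrite (DrM u (diff_sqmod (dc a)) (differentiable_cst (c : R^o) v)) Dr_cst mulr0 add0r.
rewrite (Dr_sqmod u (dc a)).
rewrite /= !dcE.
have := lt0r_neq0 (pi_gt0 R); move: (@pi R) => q q0.
by field.
Qed.

End Flow.

Lemma toric_hamiltonian :
  hamiltonian_action A (@toric_act R n Q J X lam) (@moment R n Q J X lam).
Proof.
split=> [q s|[mu vmu] y]; first exact: moment_act.
have [e ce] := vertex_corner vmu; set I := active X lam mu in ce *.
have oW := toric_dom_open ce.
exists (@flow_field I e y), (@hamiltonian I mu e y); split.
- exact: (flow_field_smooth e y oW).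
- by move=> k; exact: (Ck_xi_fun mu e oW).
- move=> x; rewrite /chart_pt /= (chartE Q0 QD QN ce).
  have mx := toric_u_moment ce (set_mem (valP x)).
  by rewrite (@moment_clsE _ _ Q _ _ _ _ _ _ ce (toric_uL x) _ mx).
- by move=> x _ u; exact: hamiltonian_diff.
(* The flow maps the domain into itself at all times, so any radius serves. *)
move=> x; exists 1 => //.
have fd t : toric_dom X lam I (flow e y t (val x)).
  by apply: (toric_dom_rot ce); exact: set_mem (valP x).
exists (fun t => mk_sub (fd t)); split.
  apply: val_inj; rewrite /= -[RHS]of_cc_cc; apply: of_cc_ext => a.
  by rewrite mul0r expi0 mul1r.
move=> t _; split; first exact: (flow_derive e y t (val x)).
rewrite /chart_pt /= !(chartE Q0 QD QN ce).
rewrite (toric_actE Q0 QD QN ce (x := ext (fun a : 'I_#|I| => t * pairing (e (enum_val a)) y))).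
  by congr (cls N _); apply: val_inj; rewrite /= -(toric_u_rot ce).
have [[_ sp] _ _] := ce; rewrite piX_ext [X in t *: X](sp y) sum_enum_val scaler_sumr.
under eq_bigr do rewrite -scalerA.
by rewrite subrr; exact: Q0.
Qed.

Lemma toric_symplectic_toric_quasifold :
  symplectic_toric_quasifold A (@toric_act R n Q J X lam) (@moment R n Q J X lam).
Proof.
by split; [exact: toric_symplectic_quasifold|exact: toric_effective|exact: toric_hamiltonian].
Qed.

End ToricQuasifold.

(** * Transport of structure along a homeomorphism *)

Section Transport.
Variables (R : realType) (S S' : topologicalType) (A : charts R S).
Variables (n : nat) (Q : set 'rV[R]_n).
Variables (act : quasitorus Q -> S -> S) (act' : quasitorus Q -> S' -> S').
Variables (Phi : S -> 'cV[R]_n) (f : S -> S') (g : S' -> S).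
Hypotheses (fK : cancel f g) (gK : cancel g f) (cf : continuous f) (cg : continuous g).
Hypothesis fact : forall q s, f (act q s) = act' q (f s).

Lemma transport_overlap a b :
  @overlap R S' (transport_charts f A) a b = @overlap R S A a b.
Proof.
rewrite /overlap; congr (_ @` _); apply/seteqP; split=> x [m _ h]; exists m => //.
  exact: (can_inj fK).
by rewrite /= h.
Qed.

Lemma transport_symplectic_quasifold k :
  symplectic_quasifold A k -> symplectic_quasifold (transport_charts f A) k.
Proof.
move=> [h1 h2 h3 h4 h5]; split=> //.
- move=> a; have [inj c o] := h2 a; split.
  + by move=> x y /(can_inj fK)/inj.
  + by move=> x; apply: continuous_comp; [exact: c|exact: cf].
  + move=> B oB; rewrite (_ : [set _ | x in B] = g @^-1` (ch_map A a @` B)).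
      by move/continuousP: cg; apply; exact: o.
    apply/seteqP; split=> [_ [x Bx <-]|s [x Bx xs]].
      by exists x => //; rewrite /= fK.
    by exists x => //=; rewrite xs gK.
- by move=> s; have [a [x _ xs]] := h3 (g s); exists a, x => //=; rewrite xs gK.
- move=> a b; rewrite transport_overlap => /h5[E [E' [p [q [t [[c1 c2 c3 c4] sy]]]]]].
  exists E, E', p, q, t; split=> //; split=> //; rewrite ?transport_overlap//.
  by move=> e x y xe ye; congr f; exact: c4 xe ye.
Qed.

Lemma transport_symplectic_toric_quasifold :
  symplectic_toric_quasifold A act Phi ->
  symplectic_toric_quasifold (transport_charts f A) act' (Phi \o g).
Proof.
have actE q s : act' q s = f (act q (g s)) by rewrite fact gK.
move=> [sq [e1 e2 e3 e4] [m1 m2]]; split; first exact: transport_symplectic_quasifold.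
  split.
  - by move=> s; rewrite actE e1 gK.
  - by move=> y y' s; rewrite !actE fK e2.
  - move=> p; rewrite (_ : (fun p => _) = f \o (fun p => act p.1 p.2) \o
      (fun p : quasitorus Q * S' => (p.1, g p.2))); last first.
      by apply/funext => r /=; exact: actE.
    apply: continuous_comp; last by apply: continuous_comp; [exact: e3|exact: cf].
    apply: for_cvg => F FF Fp; apply: cvg_pr; first exact: cvg_pr1 Fp.
    by apply: (cvg_comp _ g (cvg_pr2 Fp)); exact: cg.
  - move=> y h; apply: e4 => s; apply: (can_inj fK).
    by rewrite fact; exact: h.
split=> [q s|a y]; first by rewrite /= actE fK m1.
have [ze [H [s1 s2 hE dE fl]]] := m2 a y; exists ze, H; split=> //.
  by move=> x; rewrite hE /= /chart_pt /= fK.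
move=> x; have [de de0 [c [c0 cP]]] := fl x; exists de => //; exists c; split=> // t td.
have [d cE] := cP t td; split=> //; rewrite /chart_pt /= -fact; congr f.
exact: cE.
Qed.

End Transport.

(** * The cut space *)

(** The phases [x] are arbitrary: rotations preserve the modulus, so a coordinate tending to 0 may
    be rotated by discontinuous arguments. *)
Lemma cvg_rot0 (R : realType) (S : Type) (F : set_system S) (f : S -> R[i]^o)
    (x : S -> R) : Filter F -> f @ F --> (0 : R[i]^o) ->
  (fun s => expi (x s) * f s) @ F --> (0 : R[i]^o).
Proof.
move=> FF f0.
have fr : (fun s => complex.Re (f s) : R^o) @ F --> (0 : R^o) by have := cvg_Re f0; exact.
have fi : (fun s => complex.Im (f s) : R^o) @ F --> (0 : R^o) by have := cvg_Im f0; exact.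
have small (c s a b eps : R) : c ^+ 2 + s ^+ 2 = 1 -> `|a| < eps / 2 -> `|b| < eps / 2 ->
    `|c * a - s * b| < eps /\ `|c * b + s * a| < eps.
  move=> cs a2 b2.
  have c1 : `|c| <= 1 by rewrite -(@ler_pXn2r _ 2) ?nnegrE// expr1n real_normK ?num_real// -cs lerDl sqr_ge0.
  have s1 : `|s| <= 1 by rewrite -(@ler_pXn2r _ 2) ?nnegrE// expr1n real_normK ?num_real// -cs lerDr sqr_ge0.
  have m (u v : R) : `|u| <= 1 -> `|u * v| <= `|v|.
    by move=> u1; rewrite normrM ler_piMl.
  split.
    apply: le_lt_trans (ler_normB _ _) _; have := m c a c1; have := m s b s1; lra.
  apply: le_lt_trans (ler_normD _ _) _; have := m c b c1; have := m s a s1; lra.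
apply: cvg_complex => /=; apply/cvgr0Pnorm_lt => eps eps0.
  near=> s; rewrite Re_mul; apply: (small _ _ _ _ _ (cos2Dsin2 (2 * pi * x s)) _ _).1;
    near: s; move: fr fi => /cvgr0Pnorm_lt fr /cvgr0Pnorm_lt fi; [apply: fr|apply: fi];
    exact: divr_gt0.
near=> s; rewrite Im_mul; apply: (small _ _ _ _ _ (cos2Dsin2 (2 * pi * x s)) _ _).2;
  near: s; move: fr fi => /cvgr0Pnorm_lt fr /cvgr0Pnorm_lt fi; [apply: fr|apply: fi];
  exact: divr_gt0.
Unshelve. all: by end_near. Qed.

Section CircleQuotient.
Variables (R : realType) (n : nat) (Q : set 'rV[R]_n) (Y : 'rV[R]_n).
Hypotheses (Q0 : Q 0) (QD : forall a b, Q a -> Q b -> Q (a + b)).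
Hypothesis QN : forall a, Q a -> Q (- a).

Definition lam_rel (w w' : R[i]^o) : Prop := exists2 t : R, Q (t *: Y) & w' = expi t * w.

Lemma lam_refl w : lam_rel w w.
Proof. by exists 0; rewrite ?scale0r ?expi0 ?mul1r. Qed.

Lemma lam_sym w w' : lam_rel w w' -> lam_rel w' w.
Proof. by move=> [t Qt ->]; exists (- t); rewrite ?scaleNr ?expiNK//; exact: QN. Qed.

Lemma lam_trans w w' w'' : lam_rel w w' -> lam_rel w' w'' -> lam_rel w w''.
Proof.
move=> [t Qt ->] [s Qs ->]; exists (s + t); first by rewrite scalerDl; exact: QD.
by rewrite expiD mulrA.
Qed.

Definition lam_cls_eq := cls_eq lam_refl lam_sym lam_trans.

Lemma lam_cls_open (A : set R[i]^o) : open A -> open (cls lam_rel @` A).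
Proof.
apply: cls_open; [exact: lam_refl|exact: lam_sym|exact: lam_trans|].
move=> w _ [t Qt ->]; exists (fun v => expi (- t) * v); split.
- by apply: for_cvg => F FF Fw; apply: cvg_mulc; [exact: cvg_cstc|exact: Fw].
- by rewrite expiNK.
- by move=> v; exists (- t) => //; rewrite scaleNr; exact: QN.
Qed.

Lemma sqmod_rep w : sqmod (rep (cls lam_rel w)) = sqmod w.
Proof. by have [t _ ->] := rep_rel lam_refl lam_sym lam_trans w; rewrite sqmod_expi. Qed.

Lemma lam_cls_rot s w : cls lam_rel (expi s * rep (cls lam_rel w)) = cls lam_rel (expi s * w).
Proof.
have [t Qt ->] := rep_rel lam_refl lam_sym lam_trans w.
by apply/lam_cls_eq/lam_sym; exists t => //; rewrite mulrCA.
Qed.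

End CircleQuotient.

Section CutSpace.
Variables (R : realType) (n : nat) (Q : set 'rV[R]_n).
Hypothesis QQ : quasilattice Q.
Variables (J : finType) (X : J -> 'rV[R]_n) (lam : J -> R) (D P : set 'cV[R]_n).
Variables (Y Z : 'rV[R]_n) (eps c sg : R).
Hypotheses (sD : simple_pointed D) (qD : quasirational Q D X lam) (QY : Q Y) (Y0 : Y != 0).
Hypothesis sg1 : sg = 1 \/ sg = -1.
Hypotheses (ZE : Z = sg *: Y) (cE : c = sg * eps).
Hypothesis PE : P = D `&` [set mu | c <= pairing mu Z].
Hypotheses (sP : simple_pointed P) (dN : has_dim (D `&` [set mu | pairing mu Z <= c]) n).
Let Q0 := quasilattice0 QQ.
Let QD := quasilatticeD QQ.
Let QN := quasilatticeN QQ.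
Local Notation J' := (cut_idx P X lam).
Local Notation X' := (cut_normal P X lam Z).
Local Notation lam' := (cut_const P X lam c).
Local Notation L := (level_set X lam).
Local Notation L' := (level_set X' lam').
Local Notation N := (@N_rel R n Q J X lam).
Local Notation N' := (@N_rel R n Q J' X' lam').
Local Notation CL := (lam_rel Q Y).
Local Notation isf := (fun j : J => `[< facet P (P `&` [set mu | pairing mu (X j) = lam j]) >]).
Local Notation old j := (insub j : option {j : J | isf j}).
Implicit Types (z : CJ R J').

Let QsgZ t v : Q (t *: v) -> Q (t *: (sg *: v)).
Proof.
move=> h; case: sg1 => ->; first by rewrite scale1r.
by rewrite scalerA mulrN1 scaleNr; exact: QN.
Qed.

Lemma cut_QZ : Q Z.
Proof. by rewrite ZE -[sg *: Y]scale1r; apply: QsgZ; rewrite scale1r. Qed.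

Lemma cut_sgK : sg * sg = 1.
Proof. by case: sg1 => ->; rewrite ?mulrNN mulr1. Qed.

Lemma cut_Z0 : Z != 0.
Proof.
rewrite ZE scaler_eq0 negb_or Y0 andbT; apply/eqP => s0.
by have := cut_sgK; rewrite s0 mul0r => /eqP; rewrite eq_sym oner_eq0.
Qed.

Lemma cut_poly_quasirational : quasirational Q P X' lam'.
Proof.
have [_ dD _ _] := sD; have [_ dP _ _] := sP.
exact: (cut_quasirational qD dD cut_QZ cut_Z0 PE dP dN).
Qed.

Lemma cut_P_D : P `<=` D. Proof. by rewrite PE => mu []. Qed.

Definition pull (x : J' -> R) (j : J) : R := if old j is Some j' then x (Some j') else 0.

(** Compares the groups of the two polyhedra: forgetting the phase of the new coordinate shifts the
    image under pi by a multiple of [Z], which the action of [D^1] makes good. *)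
Lemma piX_cut (x : J' -> R) : piX X' x = x None *: Z + piX X (pull x).
Proof.
rewrite /piX (bigD1 None)//=; congr (_ + _).
rewrite (reindex_omap Some id)/=; last by case.
rewrite [RHS](bigID isf)/= [X in _ = _ + X]big1 ?addr0; last first.
  by move=> j nj; rewrite /pull insubF ?scale0r//; exact: negbTE.
rewrite (reindex_omap (val : {j : J | isf j} -> J) (fun j => old j)); last first.
  by move=> j fj; rewrite /= insubT.
apply: eq_big => [j'|j' _]; first by rewrite eqxx (valP j') valK eqxx.
by rewrite /pull valK.
Qed.

Variables (I0 : {set J}) (mu0 : 'cV[R]_n) (e0 : J -> 'cV[R]_n).
Hypothesis c0 : corner X lam I0 mu0 e0.
Variables (I1 : {set J'}) (mu1 : 'cV[R]_n) (e1 : J' -> 'cV[R]_n).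
Hypothesis c1 : corner X' lam' I1 mu1 e1.

(** The moment of [z'] computed from the coordinates at one fixed vertex of [P]; this formula makes
    its continuity in [z'] visible. *)
Definition xi1 (z' : CJ R J') : 'cV[R]_n := xi_fun mu1 e1 (res I1 z').

Lemma xi1P z' : L' z' -> moment_set X' lam' z' (xi1 z').
Proof. by move=> /(level_moment c1)[xi h]; rewrite /xi1 (xi_fun_res c1 h). Qed.

Lemma xi1_in z' : L' z' -> P (xi1 z').
Proof.
by move=> /xi1P h; have [-> _ _] := cut_poly_quasirational; move=> k; rewrite h lerDr sqmod_ge0.
Qed.

Lemma xi1_le z' j : L' z' -> lam j <= pairing (xi1 z') (X j).
Proof. by move=> /xi1_in/cut_P_D; have [-> _ _] := qD; exact. Qed.

Lemma xi1_rot x z' : xi1 (rotJ x z') = xi1 z'.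
Proof.
congr (_ + _); apply: eq_bigr => a _; rewrite !cc_res sqmod_rotJ//.
Qed.

Definition cut_z (z' : CJ R J') : CJ R J := fun j =>
  if old j is Some j' then z' (Some j') else
  ((Num.sqrt (pairing (xi1 z') (X j) - lam j))%:C)%C.

Lemma cut_z_val z' j' : cut_z z' (val j') = z' (Some j').
Proof. by rewrite /cut_z valK. Qed.

Lemma cut_z_out z' j : ~~ isf j ->
  cut_z z' j = ((Num.sqrt (pairing (xi1 z') (X j) - lam j))%:C)%C.
Proof. by move=> nj; rewrite /cut_z insubF//; exact: negbTE. Qed.

Lemma cut_z_moment z' : L' z' -> moment_set X lam (cut_z z') (xi1 z').
Proof.
move=> lz j; have [fj|nj] := boolP (isf j).
  rewrite -[j]/(val (exist (fun j => isf j) j fj)) cut_z_val.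
  exact: (xi1P lz (Some (exist _ j fj))).
by rewrite cut_z_out// sqmod_real sqr_sqrtr ?subrK// subr_ge0 xi1_le.
Qed.

Lemma cut_z_level (z' : L') : L (cut_z (val z')).
Proof. exact: level_of_moment (cut_z_moment (set_mem (valP z'))). Qed.

Definition cut_zL (z' : L') : L := mk_sub (cut_z_level z').

Lemma cut_z_rot x z' : cut_z (rotJ x z') = rotJ (pull x) (cut_z z').
Proof.
apply/funext => j; rewrite /rotJ /pull /cut_z xi1_rot.
by case: insub => [j'|]//; rewrite expi0 mul1r.
Qed.

Definition cut_pt (z' : L') : cut_amb Q X lam Y := (cls N (cut_zL z'), cls CL (val z' None)).

(** Since [sg] squares to 1, multiplying the level equation by [sg] gives the moment equation of the
    new facet. *)
Lemma nu_cut (z : CJ R J) w xi (lz : L z) : moment_set X lam z xi ->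
  nu sg (cls N (mk_sub lz), cls CL w) = eps <-> pairing xi Z = sqmod w + c.
Proof.
move=> h; rewrite /nu /= (@moment_clsE _ _ Q _ _ _ _ _ _ c0 (mk_sub lz) xi h).
rewrite sqmod_rep// ZE pairingZr cE; have s2 := cut_sgK.
split=> [<-|h']; first by rewrite mulrBr mulrA s2 mul1r addrC subrK.
have := congr1 (fun r => sg * r) h'; rewrite mulrA s2 mul1r mulrDr mulrA s2 mul1r => ->.
by rewrite addrAC subrr add0r.
Qed.

Lemma cut_pt_level (z' : L') : nu_level eps sg (cut_pt z').
Proof.
apply/(nu_cut _ _ (cut_z_moment (set_mem (valP z')))).
exact: (xi1P (set_mem (valP z')) None).
Qed.

Definition cut_lev (z' : L') : nu_level eps sg := mk_sub (cut_pt_level z').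

Lemma cut_lev_continuous : continuous cut_lev.
Proof.
move=> z'; apply: sub_continuous_at; apply: for_cvg => F FF Fz.
have cz k := cvg_val (j := k) FF Fz.
apply: cvg_pr; last first.
  by apply: (cvg_comp _ (cls CL) (cz None)); exact: cls_continuous.
suff : cut_zL @ F --> cut_zL z'.
  by move=> h; apply: (cvg_comp _ (cls N) h); exact: cls_continuous.
suff : {for z', continuous cut_zL} by move=> h; exact: (cvg_comp _ cut_zL Fz h).
apply: sub_continuous_at; apply: for_cvg => G FG Gz.
have cg k := cvg_val (j := k) FG Gz.
apply: cvg_prod_topology => j /=; rewrite /cut_z; case: insub => [j'|]; first exact: cg.
apply: cvg_realc; apply: cvg_sqrt; apply: cvgB; last exact: cvg_cst.
by apply: cvg_xi_fun; apply: cvg_res => k _; exact: cg.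
Qed.

Local Notation D1 := (@D1_act R n Q J X lam Y sg).
Let act1 (s : toric_space Q X lam) : toric_act (expD Q 0) s = s.
Proof. by have [h _ _ _] := toric_effective QQ sD qD; exact: h. Qed.
Let actD y y' (s : toric_space Q X lam) : toric_act (expD Q (y + y')) s =
  toric_act (expD Q y) (toric_act (expD Q y') s).
Proof. by have [_ h _ _] := toric_effective QQ sD qD; exact: h. Qed.

Lemma D1_cls t m w : D1 t (m, cls CL w) =
  (toric_act (expD Q (t *: Y)) m, cls CL (expi (- sg * t) * w)).
Proof. by congr (_, _); rewrite lam_cls_rot. Qed.

Lemma amb_cls (p : cut_amb Q X lam Y) : exists m w, p = (m, cls CL w).
Proof. by case: p => m w; exists m, (rep w); congr (_, _); rewrite -[LHS]cls_rep. Qed.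

Lemma D1_0 p : D1 0 p = p.
Proof.
have [m [w ->]] := amb_cls p.
by rewrite D1_cls scale0r act1 mulr0 expi0 mul1r.
Qed.

Lemma D1_D t s p : D1 (t + s) p = D1 t (D1 s p).
Proof.
have [m [w ->]] := amb_cls p.
by rewrite (D1_cls s) !D1_cls scalerDl actD mulrDr expiD mulrA.
Qed.

Local Notation D1r := (fun p p' : nu_level eps sg => exists t : R, val p' = D1 t (val p)).

Lemma D1_refl p : D1r p p. Proof. by exists 0; rewrite D1_0. Qed.

Lemma D1_sym p p' : D1r p p' -> D1r p' p.
Proof. by move=> [t ->]; exists (- t); rewrite -D1_D addNr D1_0. Qed.

Lemma D1_trans p p' p'' : D1r p p' -> D1r p' p'' -> D1r p p''.
Proof. by move=> [t ->] [s ->]; exists (s + t); rewrite D1_D. Qed.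

Definition D1_cls_eq := cls_eq D1_refl D1_sym D1_trans.

(* The rotation of the new coordinate is absorbed by the action of [D^1]. *)
Lemma cut_pt_rot x y (z' : L') : Q (piX X' x - y) ->
  cut_pt (rotL x z') =
  D1 (- sg * x None) (toric_act (expD Q y) (cut_pt z').1, (cut_pt z').2).
Proof.
move=> Qx; rewrite D1_cls mulrA mulrNN cut_sgK mul1r; congr (_, _).
rewrite -actD (toric_actE Q0 QD QN c0 (x := pull x)).
  by congr (cls N _); apply: val_inj; rewrite /= cut_z_rot.
have -> : piX X (pull x) = piX X' x - (sg * x None) *: Y.
  by rewrite piX_cut addrAC {1}ZE scalerA mulrC subrr add0r.
by rewrite mulNr scaleNr opprD opprK addrA subrK.
Qed.

Definition cut_f (m : toric_space Q X' lam') : cut_space Q X lam Y eps sg :=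
  cls D1r (cut_lev (rep m)).

Lemma cut_f_cls (z' : L') : cut_f (cls N' z') = cls D1r (cut_lev z').
Proof.
apply/D1_cls_eq; rewrite /cut_f; move: (rep _) (cls_rep (cls N' z')) => t.
move=> /(toric_cls_eq Q0 QD QN)[x Qx ->]; exists (- sg * x None).
rewrite -[LHS]/(cut_pt (rotL x t)) (cut_pt_rot (y := 0)) ?subr0// act1.
by [].
Qed.

Lemma cut_f_continuous : continuous cut_f.
Proof.
apply: quot_continuous => z'; rewrite (_ : _ \o _ = cls D1r \o cut_lev).
  by apply: continuous_comp; [exact: cut_lev_continuous|exact: cls_continuous].
by apply/funext => t; rewrite -[LHS]/(cut_f (cls N' t)) cut_f_cls.
Qed.

Lemma act_nuE y (p : nu_level eps sg) :
  cut_act (expD Q y) (cls D1r p) = cls D1r (act_nu (expD Q y) p).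
Proof.
apply/D1_cls_eq/D1_sym; have [t tE] := rep_rel D1_refl D1_sym D1_trans p; exists t.
have aE r : val (act_nu (expD Q y) r) = (toric_act (expD Q y) (val r).1, (val r).2) by [].
rewrite !aE tE; have [m [w ->]] := amb_cls (val p).
by rewrite !D1_cls /= -!actD [y + _]addrC.
Qed.

Lemma cut_f_equivariant q m : cut_f (toric_act q m) = cut_act q (cut_f m).
Proof.
rewrite -(cls_rep q) -(cls_rep m) -/(expD Q (rep q)); move: (rep q) (rep m) => y z'.
have Qy : Q (piX X' (lift_basis I1 e1 y) - y) by rewrite (piX_lift_basis c1) subrr.
rewrite (toric_actE Q0 QD QN c1 (x := lift_basis I1 e1 y))// !cut_f_cls act_nuE.
apply/D1_cls_eq/D1_sym; exists (- sg * lift_basis I1 e1 y None).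
exact: cut_pt_rot.
Qed.

(* The redundant normals that are active at a point lie in the span of the
   active normals of the cut polyhedron, so that the phases of the
   corresponding coordinates only rotate coordinates that vanish. *)
Lemma redundant_lift (I : {set J'}) mu e (z' : L') j k : corner X' lam' I mu e ->
  active X' lam' (xi1 (val z')) \subset I -> ~~ isf j ->
  cut_z (val z') j = 0 -> val z' k != 0 -> k \in I -> pairing (e k) (X j) = 0.
Proof.
have lz := set_mem (valP z'); have xP := xi1P lz.
move=> cI sub nj z0 zk kI; have [_ dD _ _] := sD; have [_ dP _ _] := sP.
apply: (cut_redundant_span qD dD cut_QZ cut_Z0 PE dP dN (xi1_in lz) (j := j)).
  by rewrite (cut_z_moment lz) z0 sqmod0 add0r.
move=> i ia; have [[du _] _ _] := cI; rewrite (du _ _ kI (fintype.subsetP sub _ ia)).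
case: eqP => // ki; move: zk ia; rewrite ki activeE xP -sqmod_gt0.
by rewrite -[X in _ == X]add0r (inj_eq (addIr _)) => /gt_eqF ->.
Qed.

(** Supplies the vertex that [redundant_lift] asks for; it depends on the point. *)
Lemma cut_vertex_corner (z' : L') : exists I mu e,
  corner X' lam' I mu e /\ active X' lam' (xi1 (val z')) \subset I.
Proof.
have Px : halfspaces X' lam' (xi1 (val z')).
  by move=> k; rewrite (xi1P (set_mem (valP z'))) lerDr sqmod_ge0.
have [nu vnu sub] := exists_vertex_active Px (toric_span sP cut_poly_quasirational).
have vP : vertex P nu by have [-> _ _] := cut_poly_quasirational.
have [e ce] := vertex_corner sP cut_poly_quasirational vP.
by exists (active X' lam' nu), nu, e.
Qed.

Lemma cut_f_injective : injective cut_f.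
Proof.
move=> m m'; rewrite -(cls_rep m) -(cls_rep m'); move: (rep m) (rep m') => z1 z2.
rewrite !cut_f_cls => /D1_cls_eq[t].
rewrite -[LHS]/(cut_pt z2) -[val (cut_lev z1)]/(cut_pt z1) D1_cls => -[].
rewrite (toric_actE Q0 QD QN c0 (x := lift_basis I0 e0 (t *: Y))); last first.
  by rewrite (piX_lift_basis c0) subrr; exact: Q0.
move=> /esym/(toric_cls_eq Q0 QD QN)[x0 Qx0 /(congr1 val) /= zE].
move=> /esym/(lam_cls_eq Y Q0 QD QN)[l Ql wE].
(* [x] collects the phases that carry the coordinates of [z1] to those of [z2]; pi sends it to
   [t *: Y] up to [Q]. *)
pose x j := x0 j + lift_basis I0 e0 (t *: Y) j.
have Qx : Q (piX X x - t *: Y) by rewrite piXD (piX_lift_basis c0) addrK.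
have {}zE j : cut_z (val z2) j = expi (x j) * cut_z (val z1) j.
  by rewrite [val z2]/= zE /rotJ mulrA -expiD.
have {}wE : val z2 None = expi (l - sg * t) * val z1 None.
  by rewrite [LHS]wE mulrA -expiD mulNr.
have [I [mu [e [cI sub]]]] := cut_vertex_corner z1.
(* The phases at vanishing redundant coordinates carry no information, yet pi sees them. They are
   collected in [xz], and [lift_basis] moves their image to facets at [I] whose coordinates
   vanish. *)
pose zer j := ~~ isf j && (cut_z (val z1) j == 0).
pose xz j := if zer j then x j else 0.
have b0 k : val z1 k != 0 -> lift_basis I e (piX X xz) k = 0.
  move=> zk; rewrite /lift_basis; case: ifP => // kI; rewrite pairing_piX big1// => j _.
  rewrite /xz /zer; case: ifP => [/andP[nj /eqP z0]|_]; last by rewrite mul0r.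
  by rewrite (redundant_lift cI sub nj z0 zk kI) mulr0.
(* A redundant coordinate that does not vanish is positive at both points, so its phase is an
   integer. *)
have xint j : ~~ isf j -> cut_z (val z1) j != 0 -> exists k : int, x j = k%:~R.
  move=> nj z0; apply: expi_eq1; apply: (mulIf z0); rewrite -zE mul1r.
  have := congr1 (@sqmod R) (zE j); rewrite sqmod_expi !(cut_z_out _ nj) !sqmod_real.
  by move=> /eqP; rewrite eqrXn2 ?sqrtr_ge0// => /eqP ->.
pose y (k : J') : R := if k is Some j' then x (val j') else l - sg * t.
apply/(toric_cls_eq Q0 QD QN); exists (fun k => y k + lift_basis I e (piX X xz) k).
  rewrite piXD (piX_lift_basis cI) piX_cut -addrA.
  have -> : piX X (pull y) + piX X xz =
      piX X x - piX X (fun j => if ~~ isf j && (cut_z (val z1) j != 0) then x j else 0).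
    apply/eqP; rewrite eq_sym subr_eq -!piXD; apply/eqP; congr piX; apply/funext => j.
    rewrite /xz /zer /pull; case: insubP => [j' fj <-|/negbTE nj].
      by rewrite (valP j') /= !addr0.
    by rewrite nj /=; case: eqP => _ /=; rewrite ?add0r ?addr0.
  set S := piX X (fun j : J => if _ then _ else _); have QS : Q S.
    rewrite /S /piX; elim/big_ind: _ => [||j _]; [exact: Q0|exact: QD|].
    case: ifP => [/andP[nj z0]|_]; last by rewrite scale0r; exact: Q0.
    have [k ->] := xint j nj z0; apply: (Qint Q0 QD QN).
    by have [_ QX _] := qD; exact: QX.
  (* As [sg * sg = 1], the phase [l - sg * t] of the new coordinate contributes [- t *: Y] and an
     element of [Q]. *)
  have -> : y None *: Z + (piX X x - S) = (piX X x - t *: Y) + l *: (sg *: Y) - S.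
    rewrite /= ZE scalerBl [X in _ - X]scalerA mulrAC cut_sgK mul1r [LHS]addrA; congr (_ - S).
    by rewrite addrC addrA addrAC.
  by apply: QD; [apply: QD => //; exact: QsgZ|exact: QN].
apply: rotL_eq => k.
have yE : val z2 k = expi (y k) * val z1 k.
  by case: k => [j'|]//=; have := zE (val j'); rewrite !cut_z_val.
rewrite yE; have [->|zk] := eqVneq (val z1 k) 0; first by rewrite !mulr0.
by rewrite b0// addr0.
Qed.

Definition push (z : CJ R J) (w : R[i]^o) : CJ R J' :=
  fun k => if k is Some j' then z (val j') else w.

Lemma push_moment (z : CJ R J) w xi : moment_set X lam z xi -> pairing xi Z = sqmod w + c ->
  moment_set X' lam' (push z w) xi.
Proof. by move=> h hw [j'|]//=; exact: h. Qed.

(** Where a redundant coordinate vanishes, any value of [th] is allowed. *)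
Definition phases (z : CJ R J) (th : J -> R) :=
  (forall j, isf j -> th j = 0) /\
  (forall j, ~~ isf j -> z j = ((Num.sqrt (sqmod (z j)))%:C)%C * expi (th j)).

Lemma cut_z_push (z : CJ R J) w xi th : moment_set X lam z xi -> pairing xi Z = sqmod w + c ->
  phases z th -> cut_z (push z w) = rotJ (fun j => - th j) z.
Proof.
move=> h hw [th0 thP]; apply/funext => j; rewrite /rotJ; have [fj|nj] := boolP (isf j).
  by rewrite th0// oppr0 expi0 mul1r -[j in LHS]/(val (exist (fun j => isf j) j fj)) cut_z_val.
rewrite cut_z_out// [xi1 _](xi_fun_res c1 (push_moment h hw)) h addrK.
by rewrite {2}(thP _ nj) mulrCA -expiD addNr expi0 mulr1.
Qed.

(** Removing [th] from the redundant coordinates acts on [M] as the torus element of [- piX X th];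
    rotating the pushed point by a lift of [piX X th] undoes this. *)
Definition unphase (I : {set J'}) e th (z : CJ R J) w : CJ R J' :=
  rotJ (lift_basis I e (piX X th)) (push z w).

Lemma cut_f_unphase (I : {set J'}) mu e (z : L) w th (cI : corner X' lam' I mu e)
    (h : nu_level eps sg (cls N z, cls CL w)) : phases (val z) th ->
  exists z' : L', val z' = unphase I e th (val z) w /\ cut_f (cls N' z') = cls D1r (mk_sub h).
Proof.
move=> thP; have lz := set_mem (valP z); have [xi xiP] := level_moment c0 lz.
have zE : z = mk_sub lz by exact: val_inj.
have hw : pairing xi Z = sqmod w + c by apply/(nu_cut w lz xiP); rewrite -zE.
pose z1 : L' := mk_sub (level_of_moment (push_moment xiP hw)).
exists (rotL (lift_basis I e (piX X th)) z1); split=> //.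
rewrite cut_f_cls; apply/D1_cls_eq/D1_sym.
exists (- sg * lift_basis I e (piX X th) None); rewrite -[LHS]/(cut_pt _).
rewrite (cut_pt_rot (y := piX X th)); last by rewrite (piX_lift_basis cI) subrr; exact: Q0.
congr (D1 _ (_, _)).
have -> : (cut_pt z1).1 = toric_act (expD Q (- piX X th)) (cls N z).
  rewrite (toric_actE Q0 QD QN c0 (x := fun j => - th j)); last first.
    by rewrite piXN subrr; exact: Q0.
  by congr (cls N _); apply: val_inj; exact: cut_z_push thP.
by rewrite -actD subrr act1.
Qed.

(** A total choice of arguments that is a continuous branch around the direction [t0 j]. Outside the
    half-plane any argument is taken, so that [phases] holds at every point. *)
Definition arg_near (t0 : J -> R) (z : CJ R J) (j : J) : R :=
  if isf j then 0 else
  if 0 < complex.Re (z j * expi (- t0 j)) then thloc (t0 j) (z j) else sval (cid (polar (z j))).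

Lemma arg_nearP t0 (z : CJ R J) : phases z (arg_near t0 z).
Proof.
split=> j fj; rewrite /arg_near ?fj// (negbTE fj).
by case: ifP => [/thlocE//|_]; exact: (svalP (cid (polar (z j)))).
Qed.

Lemma cut_f_surjective s : exists m, cut_f m = s.
Proof.
rewrite -(cls_rep s); move: (rep s) => p.
have [m [w pE]] := amb_cls (val p).
have h : nu_level eps sg (cls N (rep m), cls CL w) by rewrite cls_rep -pE; exact: set_mem (valP p).
have [z' [_ z'E]] := cut_f_unphase c1 h (arg_nearP (fun=> 0) _).
exists (cls N' z'); rewrite z'E; congr (cls D1r _); apply: val_inj.
by rewrite pE /= cls_rep.
Qed.

Definition cut_g s : toric_space Q X' lam' := sval (cid (cut_f_surjective s)).

Lemma cut_gK : cancel cut_g cut_f.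
Proof. by move=> s; exact: (svalP (cid (cut_f_surjective s))). Qed.

Lemma cut_fK : cancel cut_f cut_g.
Proof. by move=> m; apply: cut_f_injective; rewrite cut_gK. Qed.

Lemma unphase_continuous (z0 : L) w0 xi : moment_set X lam (val z0) xi ->
    pairing xi Z = sqmod w0 + c ->
  exists t0 (I : {set J'}) mu e, corner X' lam' I mu e /\
    {for (z0, w0), continuous (fun q : L * R[i]^o =>
      unphase I e (arg_near t0 (val q.1)) (val q.1) q.2)}.
Proof.
move=> h hw; have [t0 t0P] := choice (fun j => polar (val z0 j)).
pose z1 : L' := mk_sub (level_of_moment (push_moment h hw)).
have [I [mu [e [cI sub]]]] := cut_vertex_corner z1.
exists t0, I, mu, e; split=> //; apply: for_cvg => F FF Fp.
have cz j := cvg_val (j := j) FF (cvg_pr1 Fp); have cw := cvg_pr2 Fp.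
have cpush k : (fun q : L * R[i]^o => push (val q.1) q.2 k) @ F --> push (val z0) w0 k.
  by case: k => [j'|]; [exact: cz|exact: cw].
apply: cvg_prod_topology => k; rewrite /unphase /rotJ.
(* A coordinate that vanishes at the base point tolerates any phases. *)
have [k0|kn0] := eqVneq (push (val z0) w0 k) 0.
  by rewrite k0 mulr0; apply: cvg_rot0; rewrite -k0; exact: cpush.
apply: cvg_mulc; last exact: cpush.
apply: cvg_expi; rewrite /lift_basis; case: ifP => kI; last exact: cvg_cst.
rewrite pairing_piX; under eq_fun do rewrite pairing_piX.
apply: cvg_sumr => j _; rewrite /arg_near.
have [fj|nj] := boolP (isf j); first exact: cvg_cst.
(* The argument of a vanishing redundant coordinate may jump, but its coefficient is 0 by the choice
   of the vertex. *)
have [z0j|z0j] := eqVneq (val z0 j) 0.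
  have cz0 : cut_z (val z1) j = 0.
    by rewrite (cut_z_push h hw (arg_nearP t0 _)) /rotJ z0j mulr0.
  rewrite (redundant_lift cI sub nj cz0 kn0 kI) mulr0.
  by under eq_fun do rewrite mulr0; exact: cvg_cst.
apply: cvgM; last exact: cvg_cst.
have pos : 0 < complex.Re (val z0 j * expi (- t0 j)).
  rewrite t0P; apply: Re_expi_gt0; first by rewrite sqrtr_gt0 sqmod_gt0.
  by rewrite subrr normr0 invr_gt0.
(* Near the base point the half-plane condition persists, so the chosen argument agrees with the
   continuous branch. *)
rewrite pos; apply: cvg_trans (cvg_thloc _ pos (cz j)).
apply: near_eq_cvg.
have cre : (fun q : L * R[i]^o => complex.Re (val q.1 j * expi (- t0 j)) : R^o) @ F -->
    (complex.Re (val z0 j * expi (- t0 j)) : R^o).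
  by apply: cvg_Re; apply: cvg_mulc; [exact: cz|exact: cvg_cstc].
by near=> q; rewrite ifT//; near: q; exact: (cvgr_gt _ cre _ pos).
Unshelve. all: by end_near. Qed.

Lemma cut_g_continuous : continuous cut_g.
Proof.
apply: quot_continuous; apply: quot_sub_continuous.
- exact: (toric_cls_open Q0 QD QN).
- exact: (lam_cls_open Q0 QD QN).
move=> z0 w0 h0; have [xi xiP] := level_moment c0 (set_mem (valP z0)).
have hw : pairing xi Z = sqmod w0 + c.
  apply/(nu_cut w0 (set_mem (valP z0)) xiP).
  by rewrite (_ : mk_sub _ = z0) //; exact: val_inj.
have [t0 [I [mu [e [cI cH]]]]] := unphase_continuous xiP hw.
exists (fun q : L * R[i]^o => unphase I e (arg_near t0 (val q.1)) (val q.1) q.2).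
split=> // z w h; have [z' [z'1 z'2]] := cut_f_unphase cI h (arg_nearP t0 _).
(* Injectivity of [cut_f] shows that every local lift computes the same [cut_g], whichever vertex it
   uses. *)
by exists z'; split=> //; apply: cut_f_injective; rewrite [LHS]cut_gK z'2.
Qed.

Lemma cut_space_toric :
  exists (f : toric_space Q X' lam' -> cut_space Q X lam Y eps sg)
         (g : cut_space Q X lam Y eps sg -> toric_space Q X' lam'),
     [/\ cancel f g /\ cancel g f, continuous f, continuous g,
         forall q m, f (toric_act q m) = cut_act q (f m) &
         symplectic_toric_quasifold (transport_charts f (toric_charts Q P X' lam'))
           (@cut_act _ _ Q _ X lam Y eps sg) (@moment _ _ Q _ X' lam' \o g)].
Proof.
exists cut_f, cut_g; split.
- by split; [exact: cut_fK|exact: cut_gK].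
- exact: cut_f_continuous.
- exact: cut_g_continuous.
- exact: cut_f_equivariant.
- apply: (transport_symplectic_toric_quasifold cut_fK cut_gK cut_f_continuous
    cut_g_continuous cut_f_equivariant).
  exact: (toric_symplectic_toric_quasifold QQ sP cut_poly_quasirational).
Qed.

End CutSpace.

Theorem theorem2p3 (R : realType) (n d : nat) (Q : set 'rV[R]_n)
    (Delta : set 'cV[R]_n) (X : 'I_d -> 'rV[R]_n) (lam : 'I_d -> R)
    (Y : 'rV[R]_n) (eps : R)
    (Deltap := Delta `&` [set mu | pairing mu Y >= eps])
    (Deltam := Delta `&` [set mu | pairing mu Y <= eps])
    (Xp := cut_normal Deltap X lam Y) (lamp := cut_const Deltap X lam eps)
    (Xm := cut_normal Deltam X lam (- Y)) (lamm := cut_const Deltam X lam (- eps)) :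
  quasilattice Q ->
  simple_pointed Delta ->
  quasirational Q Delta X lam ->
  Q Y -> Y <> 0 ->
  simple_pointed Deltap ->
  simple_pointed Deltam ->
  (exists (f : toric_space Q Xp lamp -> cut_space Q X lam Y eps 1)
          (g : cut_space Q X lam Y eps 1 -> toric_space Q Xp lamp),
     [/\ cancel f g /\ cancel g f, continuous f, continuous g,
         forall q m, f (toric_act q m) = cut_act q (f m) &
         symplectic_toric_quasifold (transport_charts f (toric_charts Q Deltap Xp lamp))
           (@cut_act _ _ Q _ X lam Y eps 1) (@moment _ _ Q _ Xp lamp \o g)]) /\
  (exists (f : toric_space Q Xm lamm -> cut_space Q X lam Y eps (-1))
          (g : cut_space Q X lam Y eps (-1) -> toric_space Q Xm lamm),
     [/\ cancel f g /\ cancel g f, continuous f, continuous g,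
         forall q m, f (toric_act q m) = cut_act q (f m) &
         symplectic_toric_quasifold (transport_charts f (toric_charts Q Deltam Xm lamm))
           (@cut_act _ _ Q _ X lam Y eps (-1)) (@moment _ _ Q _ Xm lamm \o g)]).
Proof.
move=> QQ sD qD QY /eqP Y0 sp sm.
have [_ dp _ _] := sp; have [_ dm _ _] := sm.
split.
  have ZE : Y = 1 *: Y by rewrite scale1r.
  have cE : eps = 1 * eps by rewrite mul1r.
  have qp := cut_poly_quasirational QQ sD qD QY Y0 (or_introl erefl) ZE erefl sp dm.
  have [I0 [mu0 [e0 c0]]] := toric_corner sD qD.
  have [I1 [mu1 [e1 c1]]] := toric_corner sp qp.
  exact: (cut_space_toric QQ sD qD QY Y0 (or_introl erefl) ZE cE erefl sp dm c0 c1).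
have ZE : - Y = -1 *: Y by rewrite scaleN1r.
have cE : - eps = -1 * eps by rewrite mulN1r.
(* The half-space below [eps] for [Y] is the one above [- eps] for [- Y]; the two halves exchange
   roles. *)
have PE : Deltam = Delta `&` [set mu | - eps <= pairing mu (- Y)].
  by rewrite /Deltam; congr (_ `&` _); apply/seteqP; split=> mu /=; rewrite pairingNr lerN2.
have dN : has_dim (Delta `&` [set mu | pairing mu (- Y) <= - eps]) n.
  rewrite (_ : [set mu | _] = [set mu | eps <= pairing mu Y])//.
  by apply/seteqP; split=> mu /=; rewrite pairingNr lerN2.
have qm := cut_poly_quasirational QQ sD qD QY Y0 (or_intror erefl) ZE PE sm dN.
have [I0 [mu0 [e0 c0]]] := toric_corner sD qD.
have [I1 [mu1 [e1 c1]]] := toric_corner sm qm.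
exact: (cut_space_toric QQ sD qD QY Y0 (or_intror erefl) ZE cE PE sm dN c0 c1).
Qed.
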